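(* Let $p\ge 1$ and $q\ge 1$, let $Y$ be a real random variable, $\mathbf{X}$ an $\mathbb{R}^p$-valued random vector and $\mathbf{Z}$ an $\mathbb{R}^q$-valued random vector on the same probability space, and suppose that $Y$ is not almost surely equal to a measurable function of $\mathbf{X}$. Suppose that the following two assumptions hold. (A1) There are nonnegative real numbers $\beta$ and $C$ such that for any $t\in\mathbb{R}$, $\mathbf{x},\mathbf{x}'\in\mathbb{R}^p$ and $\mathbf{z},\mathbf{z}'\in\mathbb{R}^q$, $$|\mathbb{P}(Y\ge t|\mathbf{X}=\mathbf{x},\mathbf{Z}=\mathbf{z})-\mathbb{P}(Y\ge t|\mathbf{X}=\mathbf{x}',\mathbf{Z}=\mathbf{z}')|\le C(1+\|\mathbf{x}\|^\beta+\|\mathbf{x}'\|^\beta+\|\mathbf{z}\|^\beta+\|\mathbf{z}'\|^\beta)(\|\mathbf{x}-\mathbf{x}'\|+\|\mathbf{z}-\mathbf{z}'\|)$$ and $$|\mathbb{P}(Y\ge t|\mathbf{X}=\mathbf{x})-\mathbb{P}(Y\ge t|\mathbf{X}=\mathbf{x}')|\le C(1+\|\mathbf{x}\|^\beta+\|\mathbf{x}'\|^\beta)\|\mathbf{x}-\mathbf{x}'\|.$$ (A2) There are positive numbers $C_1$ and $C_2$ such that for any $t>0$, $\mathbb{P}(\|\mathbf{X}\|\ge t)$ and $\mathbb{P}(\|\mathbf{Z}\|\ge t)$ are bounded by $C_1e^{-C_2t}$. Then, with $T=T(Y,\mathbf{Z}|\mathbf{X})$ and $T_n=T_n(Y,\mathbf{Z}|\mathbf{X})$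 as defined in the context, as $n\to\infty$, $$T_n-T=O_P\biggl(\frac{(\log n)^{p+q+\beta+1}}{n^{1/(p+q)}}\biggr).$$
   Context: Conditional probabilities $\mathbb{P}(Y\ge t|\mathbf{X}=\mathbf{x})$ and $\mathbb{P}(Y\ge t|\mathbf{X}=\mathbf{x},\mathbf{Z}=\mathbf{z})$ refer to (some fixed version of) the regular conditional distribution of $Y$. $\|\cdot\|$ is the Euclidean norm. Let $\mu$ be the law of $Y$ and $$T(Y,\mathbf{Z}|\mathbf{X}) := \frac{\int \mathbb{E}(\mathrm{Var}(\mathbb{P}(Y\ge t|\mathbf{Z},\mathbf{X})|\mathbf{X}))\, d\mu(t)}{\int \mathbb{E}(\mathrm{Var}(1_{\{Y\ge t\}}|\mathbf{X}))\,d\mu(t)}.$$ Let $(Y_1,\mathbf{X}_1,\mathbf{Z}_1),\ldots,(Y_n,\mathbf{X}_n,\mathbf{Z}_n)$, $n\ge2$, be i.i.d. copies of $(Y,\mathbf{X},\mathbf{Z})$. For $1\le i\le n$, let $R_i$ be the number of $j$ with $Y_j\le Y_i$; let $N(i)$ be the index $j\ne i$ such that $\mathbf{X}_j$ is the Euclidean nearest neighbor of $\mathbf{X}_i$ among $\{\mathbf{X}_k:k\ne i\}$; let $M(i)$ be the index $j\ne i$ such that $(\mathbf{X}_j,\mathbf{Z}_j)$ is the Euclidean nearest neighbor of $(\mathbf{X}_i,\mathbf{Z}_i)$ in $\mathbb{R}^{p+q}$; ties are broken uniformly at random (independently of the data and independently for different $i$). Then $$T_n := \frac{\sum_{i=1}^n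 (\min\{R_i,R_{M(i)}\}-\min\{R_i,R_{N(i)}\})}{\sum_{i=1}^n (R_i-\min\{R_i,R_{N(i)}\})},$$ undefined if the denominator is zero. *)

(* Defs.v *)
From HB Require Import structures.
From mathcomp Require Import all_boot all_order all_algebra.
From mathcomp Require Import finmap.
From mathcomp Require Import all_classical all_reals all_analysis.

Set Implicit Arguments.
Unset Strict Implicit.
Unset Printing Implicit Defensive.
Import Order.TTheory GRing.Theory Num.Theory.
Import numFieldNormedType.Exports.

Local Open Scope classical_set_scope.
Local Open Scope ring_scope.

Section euclidean.
Context {R : realType}.

Definition euclid_norm (m : nat) (x : m.-tuple R) : R :=
  Num.sqrt (\sum_(i < m) tnth x i ^+ 2).

Definition euclid_dist (m : nat) (x y : m.-tuple R) : R :=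
  euclid_norm [tuple tnth x i - tnth y i | i < m].

(* [nearest u i] is the set of all nearest neighbours of [u i], ties included;
   it is nonempty as soon as [1 < n]. *)
Definition nearest (m n : nat) (u : 'I_n -> m.-tuple R) (i : 'I_n) :
    {set 'I_n} :=
  [set k | (k != i) &&
     [forall l, (l != i) ==> (euclid_dist (u i) (u k) <= euclid_dist (u i) (u l))]]%SET.

End euclidean.

Section conditioning.
Context {R : realType} {d d' : measure_display}.
Context {Omega : measurableType d} {S : measurableType d'}.
Variable P : probability Omega R.

(* [K u B] is a version of P(Y \in B | U = u). *)
Definition regular_cond_distribution (U : Omega -> S) (Y : Omega -> R)
    (K : R.-pker S ~> R) : Prop :=
  forall (A : set S) (B : set R), measurable A -> measurable B ->
    P (U @^-1` A `&` Y @^-1` B) = (\int[P]_(w in U @^-1` A) K (U w) B)%E.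

Definition is_cond_expectation (U : Omega -> S) (W h : Omega -> R) : Prop :=
  [/\ (forall B : set R, measurable B ->
         g_sigma_algebra_preimage U (h @^-1` B)),
      P.-integrable [set: Omega] (EFin \o h) &
      forall A : set Omega, g_sigma_algebra_preimage U A ->
        (\int[P]_(w in A) (h w)%:E = \int[P]_(w in A) (W w)%:E)%E].

(* The version of P(Y >= t | U = u) given by [K]. *)
Definition cond_tail (K : R.-pker S ~> R) (u : S) (t : R) : R :=
  fine (K u `[t, +oo[%classic).

(* A version of E(W | U); versions exist for every integrable [W], and the
   default value is only taken when there is none. *)
Definition cond_expectation (U : Omega -> S) (W : Omega -> R) : Omega -> R :=
  xget (cst 0) [set h | is_cond_expectation U W h].

Definition cond_variance (U : Omega -> S) (W : Omega -> R) : Omega -> R :=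
  cond_expectation U (fun w => (W w - cond_expectation U W w) ^+ 2).

End conditioning.

Section coefficient.
Context {R : realType} {d : measure_display} {Omega : measurableType d}.
Variables (P : probability Omega R) (p q : nat).
Variables (Y : {RV P >-> R}) (X : {RV P >-> p.-tuple R})
  (Z : {RV P >-> q.-tuple R}).

(* [KXZ] is the chosen version of the conditional law of Y given (X, Z). *)
Definition Tcoef (KXZ : R.-pker (p.-tuple R * q.-tuple R)%type ~> R) : R :=
  let num (t : R) : Omega -> R :=
    cond_variance P X (fun w => cond_tail KXZ (X w, Z w) t) in
  let den (t : R) : Omega -> R :=
    cond_variance P X \1_[set w | t <= Y w] in
  fine (\int[distribution P Y]_t 'E_P[num t])%E /
  fine (\int[distribution P Y]_t 'E_P[den t])%E.

End coefficient.

Section statistic.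
Context {R : realType}.
Variable n : nat.

Definition rank_of (y : 'I_n -> R) (i : 'I_n) : nat :=
  #|[set j | y j <= y i]%SET|.

Definition Tstat (y : 'I_n -> R) (N M : 'I_n -> 'I_n) : option R :=
  let r := rank_of y in
  let num := \sum_(i < n)
    ((minn (r i) (r (M i)))%:R - (minn (r i) (r (N i)))%:R) : R in
  let den := \sum_(i < n) ((r i)%:R - (minn (r i) (r (N i)))%:R) : R in
  if den == 0 then None else Some (num / den).

End statistic.

Section sampling.
Context {R : realType} {d : measure_display} {Omega : measurableType d}.
Variable P : probability Omega R.

Definition mutually_independent (d' : measure_display) (S : measurableType d')
    (V : nat -> Omega -> S) : Prop :=
  forall (J : {fset nat}) (A : nat -> set S),
    (forall i, i \in J -> measurable (A i)) ->
    P (\bigcap_(i in [set` J]) V i @^-1` A i) =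
    (\prod_(i <- J) P (V i @^-1` A i))%E.

(* Conditionally on the data [D], the indices [N i] are independent, and [N i]
   is uniform on [cand w i]: the joint conditional law of the family is the
   product of the uniform laws. *)
Definition uniform_tie_breaking (d' : measure_display) (S : measurableType d')
    (n : nat) (D : Omega -> S) (cand : Omega -> 'I_n -> {set 'I_n})
    (N : 'I_n -> Omega -> 'I_n) : Prop :=
  (forall i k, measurable [set w | N i w = k]) /\
  (forall (A : set S) (k : 'I_n -> 'I_n), measurable A ->
    P (D @^-1` A `&` [set w | forall i, N i w = k i]) =
    \int[P]_(w in D @^-1` A)
      (\prod_(i < n) (if k i \in cand w i then #|cand w i|%:R^-1 else 0))%:E)%E.

(* U_n = O_P(a_n) for partially defined U_n; being undefined counts as being
   out of bounds. *)
Definition bigO_P (U : nat -> Omega -> option R) (a : nat -> R) : Prop :=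
  forall eps : R, 0 < eps -> exists K : R, \forall n \near \oo,
    (P [set w | ~~ oapp (fun v => (`|v| <= K * a n)%R) false (U n w)]
       <= eps%:E)%E.

End sampling.

(* Main.v *)
Require Import Defs.
From HB Require Import structures.
From mathcomp Require Import all_boot all_order all_algebra.
From mathcomp Require Import finmap.
From mathcomp Require Import all_classical all_reals all_analysis.
From mathcomp Require Import measurable_realfun.
From mathcomp Require Import ring lra zify.
Import Order.TTheory GRing.Theory Num.Theory.
Import numFieldNormedType.Exports.
Local Open Scope classical_set_scope.
Local Open Scope ring_scope.
Set Implicit Arguments.
Unset Strict Implicit.
Unset Printing Implicit Defensive.

(** Write the numerator and the denominator of the statistic with the averages
    W(k) = n^-2 sum_(i,j) 1{Y_j <= Y_i} 1{Y_j <= Y_(k i)} and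
    L = n^-2 sum_(i,j) 1{Y_j <= Y_i}.  The minimum of two ranks counts the
    responses below both, so that T_n = (W(M) - W(N)) / (L - W(N)) ([TstatE]).
    On the side of the limit, total variance gives T = (a - b) / (c - b), where
    a and b are the means of P(Y >= t | X, Z)^2 and P(Y >= t | X)^2 over t drawn
    from the law of Y independently of (X, Z), and c is the mean of P(Y >= t)
    ([TcoefE]).  It is enough to compare W(M) with a, W(N) with b and L with c up
    to O_P((log n)^(p+q+beta+1) / n^(1/(p+q))), because c - b > 0
    ([ratio_error]).

    The denominator c - b is the average over the law of Y of the mean
    conditional variance of 1{Y >= t} given X.  If it vanished, these conditional
    variances would vanish at every level, also at the levels that the law of Y
    does not charge ([cond_var_at0]), and Y would be a function of X
    ([response_determined]).

    For W(N), suppose that each N(i) is a nearest neighbour of i.  Given the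
    vectors X_i, the neighbours and the threshold Y_j, the two indicators in a
    term have conditional probabilities G(X_i, Y_j) and G(X_(N i), Y_j), with
    G(x, t) = P(Y >= t | X = x), and three errors separate W(N) from b.
    - The difference between W(N) and the average of
      G(X_i, Y_j) G(X_(N i), Y_j).  For a fixed j, the terms of two indices i and
      i' are uncorrelated unless the pairs {i, N i} and {i', N i'} meet.  A point
      is the nearest neighbour of boundedly many points, by a covering of the
      directions of space ([cone_bound]); random tie breaking makes the bound hold
      for the expected number even if points coincide ([sum_tie_weight_in]).
      Hence there are O(n) pairs that meet, and the error is O_P(n^(-1/2))
      ([mean_fluct_second_moment]).
    - The replacement of G(X_(N i), Y_j) by G(X_i, Y_j).  By the Lipschitz
      assumption this costs at most a constant that is polynomial in the norms
      times the average distance to the neighbour.  The exponential tails confine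
      the sample to a ball of radius (2 / C2) log n, where a packing argument at
      dyadic scales bounds that average ([nn_sum_le]) and gives the logarithmic
      factors of the rate ([neighbour_bias_le_rate]).
    - The average of G(X_i, Y_j)^2 over i and j, which is a two-sample average with
      mean square error O(1/n) ([vstat_second_moment]).
    The same argument with (X, Z) in place of X treats W(M), and L is again a
    two-sample average.  Since p + q >= 2, the errors of order n^(-1/2) are below
    the rate.

    Both conditioning steps are swaps of one weight for another with the same
    integral over the events of a sigma-algebra ([weight_transfer]), combined with
    the fact that resampling one observation does not change the law of the
    sample ([resample]). *)

(** * Expectations of bounded measurable functions *)

Section bounded_measurable.
Context {R : realType} {d : measure_display} {T : measurableType d}.
Implicit Types f g : T -> R.

(** On this class the integral against a probability is linear and monotone
    without integrability conditions. *)
Definition bmeas f := measurable_fun [set: T] f /\ exists M, forall x, `|f x| <= M.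

Lemma bmeas_cst c : bmeas (fun=> c).
Proof. by split => //; exists `|c|. Qed.

Lemma bmeasD f g : bmeas f -> bmeas g -> bmeas (fun x => f x + g x).
Proof.
move=> [mf [M fM]] [mg [N gN]]; split; first exact: measurable_funD.
by exists (M + N) => x; rewrite (le_trans (ler_normD _ _))// lerD.
Qed.

Lemma bmeasN f : bmeas f -> bmeas (fun x => - f x).
Proof.
move=> [mf [M fM]]; split; first exact: measurableT_comp.
by exists M => x; rewrite normrN.
Qed.

Lemma bmeasB f g : bmeas f -> bmeas g -> bmeas (fun x => f x - g x).
Proof. by move=> bf bg; apply: bmeasD => //; exact: bmeasN. Qed.

Lemma bmeasM f g : bmeas f -> bmeas g -> bmeas (fun x => f x * g x).
Proof.
move=> [mf [M fM]] [mg [N gN]]; split; first exact: measurable_funM.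
by exists (M * N) => x; rewrite normrM ler_pM.
Qed.

Lemma bmeasX f n : bmeas f -> bmeas (fun x => f x ^+ n).
Proof.
move=> bf; elim: n => [|n IH].
  by have -> : (fun x => f x ^+ 0) = fun=> 1 by []; exact: bmeas_cst.
have -> : (fun x => f x ^+ n.+1) = fun x => f x * f x ^+ n.
  by apply/funext => x; rewrite exprS.
exact: bmeasM.
Qed.

Lemma bmeas_sum (I : Type) (s : seq I) (Q : pred I) (F : I -> T -> R) :
  (forall i, Q i -> bmeas (F i)) -> bmeas (fun x => \sum_(i <- s | Q i) F i x).
Proof.
move=> bF; elim: s => [|i s IH].
  have -> : (fun x => \sum_(i <- [::] | Q i) F i x) = fun=> 0.
    by apply/funext => x; rewrite big_nil.
  exact: bmeas_cst.
have -> : (fun x => \sum_(j <- i :: s | Q j) F j x) =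
    fun x => (if Q i then F i x else 0) + \sum_(j <- s | Q j) F j x.
  by apply/funext => x; rewrite big_cons; case: ifP => // _; rewrite add0r.
by apply: bmeasD => //; case: (boolP (Q i)) => [/bF//|_]; exact: bmeas_cst.
Qed.

Lemma bmeas_prod (I : Type) (s : seq I) (Q : pred I) (F : I -> T -> R) :
  (forall i, Q i -> bmeas (F i)) -> bmeas (fun x => \prod_(i <- s | Q i) F i x).
Proof.
move=> bF; elim: s => [|i s IH].
  have -> : (fun x => \prod_(i <- [::] | Q i) F i x) = fun=> 1.
    by apply/funext => x; rewrite big_nil.
  exact: bmeas_cst.
have -> : (fun x => \prod_(j <- i :: s | Q j) F j x) =
    fun x => (if Q i then F i x else 1) * \prod_(j <- s | Q j) F j x.
  by apply/funext => x; rewrite big_cons; case: ifP => // _; rewrite mul1r.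
by apply: bmeasM => //; case: (boolP (Q i)) => [/bF//|_]; exact: bmeas_cst.
Qed.

Lemma measurable_boolset (b : T -> bool) : measurable_fun [set: T] b ->
  measurable [set x | b x].
Proof.
move=> mb; rewrite -[X in measurable X]setTI.
by rewrite (_ : [set x | b x] = b @^-1` [set true])//; exact: mb.
Qed.

Lemma bmeas_bool (b : T -> bool) : measurable_fun [set: T] b ->
  bmeas (fun x => (b x)%:R).
Proof.
move=> mb; split; last first.
  by exists 1 => x; case: (b x); rewrite ?normr1 ?normr0.
rewrite (_ : (fun _ => _) = \1_[set x | b x]).
  exact/measurable_indic/measurable_boolset.
apply/funext => x; rewrite indicE; congr (nat_of_bool _)%:R.
by apply/idP/idP => [bx|/set_mem//]; exact/mem_set.
Qed.

Lemma bmeas_le1 f : measurable_fun [set: T] f -> (forall x, 0 <= f x <= 1) ->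
  bmeas f.
Proof.
move=> mf f01; split => //; exists 1 => x.
by have /andP[f0 f1] := f01 x; rewrite ger0_norm.
Qed.

End bounded_measurable.

Lemma bmeas_comp {R : realType} {d d'} {T : measurableType d}
    {T' : measurableType d'} (phi : T' -> T) (f : T -> R) :
  measurable_fun [set: T'] phi -> bmeas f -> bmeas (fun x => f (phi x)).
Proof.
by move=> mphi [mf [M fM]]; split; [exact: measurableT_comp | exists M].
Qed.

Section mean.
Context {R : realType} {d : measure_display} {T : measurableType d}.
Variable P : probability T R.
Implicit Types f g : T -> R.

Definition mean f : R := \int[P]_x f x.

Lemma bmeas_integrable f : bmeas f -> P.-integrable [set: T] (EFin \o f).
Proof.
move=> [mf [M fM]]; apply: measurable_bounded_integrable => //.
  exact: (le_lt_trans (probability_le1 P measurableT) (ltry _)).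
exists M; split; first by rewrite num_real.
by move=> N MN x _ /=; rewrite (le_trans (fM x))// ltW.
Qed.

Lemma meanE f : bmeas f -> (mean f)%:E = (\int[P]_x (f x)%:E)%E.
Proof.
by move=> /bmeas_integrable bf; rewrite /mean /Rintegral fineK//; exact: integrable_fin_num.
Qed.

Lemma eq_mean f g : f =1 g -> mean f = mean g.
Proof. by move=> fg; congr mean; exact/funext. Qed.

Lemma mean_cst c : mean (fun=> c) = c.
Proof.
rewrite /mean Rintegral_cst//.
have h : fine (P [set: T]) = 1 by rewrite probability_setT.
by rewrite h mulr1.
Qed.

Lemma meanD f g : bmeas f -> bmeas g ->
  mean (fun x => f x + g x) = mean f + mean g.
Proof. by move=> /bmeas_integrable ? /bmeas_integrable ?; exact: RintegralD. Qed.

Lemma meanB f g : bmeas f -> bmeas g ->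
  mean (fun x => f x - g x) = mean f - mean g.
Proof. by move=> /bmeas_integrable ? /bmeas_integrable ?; exact: RintegralB. Qed.

Lemma meanZ c f : bmeas f -> mean (fun x => c * f x) = c * mean f.
Proof. by move=> /bmeas_integrable ?; exact: RintegralZl. Qed.

Lemma mean_sum (I : Type) (s : seq I) (Q : pred I) (F : I -> T -> R) :
  (forall i, Q i -> bmeas (F i)) ->
  mean (fun x => \sum_(i <- s | Q i) F i x) = \sum_(i <- s | Q i) mean (F i).
Proof.
move=> bF; elim: s => [|i s IH].
  by under eq_mean do rewrite big_nil; rewrite big_nil mean_cst.
under eq_mean do rewrite big_cons; rewrite big_cons; case: ifPn => // Qi.
by rewrite meanD ?IH//; [exact: bF | exact: bmeas_sum].
Qed.

Lemma le_mean f g : bmeas f -> bmeas g -> (forall x, f x <= g x) ->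
  mean f <= mean g.
Proof.
by move=> /bmeas_integrable ? /bmeas_integrable ? fg; apply: le_Rintegral.
Qed.

Lemma mean_ge0 f : (forall x, 0 <= f x) -> 0 <= mean f.
Proof. by move=> f0; apply: Rintegral_ge0. Qed.

Lemma mean_bool (b : T -> bool) : measurable_fun [set: T] b ->
  (mean (fun x => (b x)%:R))%:E = P [set x | b x].
Proof.
move=> mb; rewrite meanE; last exact: bmeas_bool.
rewrite -[X in _ = P X]setIT -integral_indic//; last exact: measurable_boolset.
apply: eq_integral => x _; rewrite indicE; congr (nat_of_bool _)%:R%:E.
by apply/idP/idP => [bx|/set_mem//]; exact/mem_set.
Qed.

Lemma second_moment_tail f (l B : R) : bmeas f -> 0 < l ->
  mean (fun x => f x ^+ 2) <= B ->
  (P [set x | (l <= `|f x|)%R] <= (B / l ^+ 2)%:E)%E.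
Proof.
move=> bf l0 fB.
have mA : measurable_fun [set: T] (fun x => l <= `|f x|).
  apply: measurable_fun_ler => //.
  by apply: measurableT_comp => //; case: bf.
rewrite -mean_bool// lee_fin ler_pdivlMr ?exprn_gt0// mulrC.
rewrite -meanZ; last exact: bmeas_bool.
apply: le_trans fB; apply: le_mean.
- by apply: bmeasM; [exact: bmeas_cst | exact: bmeas_bool].
- exact: bmeasX.
move=> x /=; case: (leP l `|f x|) => lf; rewrite ?mulr1 ?mulr0 ?sqr_ge0//.
by rewrite -[leRHS]real_normK ?num_real// ler_sqr ?nnegrE// ltW.
Qed.

End mean.

Lemma sqr_sum_le {R : realType} (I : finType) (x : I -> R) :
  (\sum_i x i) ^+ 2 <= #|I|%:R * \sum_i x i ^+ 2.
Proof.
have [I0|I_gt0] := posnP #|I|.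
  rewrite I0 mul0r big1 ?expr0n// => i _.
  by have := card0_eq I0 i; rewrite inE.
have n0 : #|I|%:R != 0 :> R by rewrite pnatr_eq0 -lt0n.
set S := \sum_i x i; pose m := S / #|I|%:R.
have : 0 <= \sum_i (x i - m) ^+ 2 by apply: sumr_ge0 => i _; exact: sqr_ge0.
have -> : \sum_i (x i - m) ^+ 2 = \sum_i x i ^+ 2 - S ^+ 2 / #|I|%:R.
  under eq_bigr => i _ do rewrite sqrrB.
  rewrite big_split/= sumrB sumr_const sumrMnl -mulr_suml -/S -mulr_natl /m.
  by field.
by rewrite subr_ge0 ler_pdivrMr ?ltr0n// mulrC.
Qed.

(** * Transferring identities of weights from sets to functions *)

Section weight_transfer.
Context {R : realType} {d d' : measure_display}.
Context {T : measurableType d} {E : measurableType d'}.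
Variables (P : probability T R) (U : T -> E).
Hypothesis mU : measurable_fun [set: T] U.

Import HBNNSimple.

Let simple_weight (f : {nnsfun E >-> R}) (phi : T -> R) :
  measurable_fun [set: T] phi -> (forall w, 0 <= phi w) ->
  (\int[P]_w (f (U w) * phi w)%:E =
   \sum_(r \in range f) r%:E * \int[P]_(w in U @^-1` (f @^-1` [set r])) (phi w)%:E)%E.
Proof.
move=> mphi phi0.
have mA r : measurable (f @^-1` [set r]) by [].
have mUA r : measurable (U @^-1` (f @^-1` [set r])).
  by rewrite -[X in measurable X]setTI; exact: mU.
transitivity (\int[P]_w (\sum_(r \in range f)
    (r * (\1_(f @^-1` [set r]) (U w) * phi w))%:E))%E.
  apply: eq_integral => w _; rewrite fimfunE fsumEFin//; congr EFin.
  rewrite mulr_fsuml//; apply: eq_fsbigr => r _.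
  by rewrite mulrA.
rewrite ge0_integral_fsum//; last 2 first.
- move=> r; apply/measurable_EFinP.
  apply: measurable_funM => //; apply: measurable_funM => //.
  exact: measurableT_comp.
- move=> r w _; rewrite mulrA EFinM mule_ge0 ?lee_fin//.
  by have := nnfun_muleindic_ge0 f r (U w); rewrite -EFinM lee_fin.
apply: eq_fsbigr => r /set_mem[e _ <-].
under eq_integral do rewrite EFinM.
rewrite ge0_integralZl//; last 3 first.
- apply/measurable_EFinP; apply: measurable_funM => //.
  exact: measurableT_comp.
- by move=> w _; rewrite lee_fin mulr_ge0.
- by rewrite lee_fin.
congr (_ * _)%E; rewrite [RHS]integral_mkcond; apply: eq_integral => w _.
rewrite patchE indicE.
have -> : (w \in U @^-1` (f @^-1` [set f e])) = (U w \in f @^-1` [set f e]).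
  by apply/idP/idP => /set_mem h; exact/mem_set.
by case: (U w \in _); rewrite ?mul1r ?mul0r.
Qed.

Let transfer_ge0 (f : E -> R) (phi1 phi2 : T -> R) :
  measurable_fun [set: E] f -> (forall e, 0 <= f e) ->
  measurable_fun [set: T] phi1 -> (forall w, 0 <= phi1 w) ->
  measurable_fun [set: T] phi2 -> (forall w, 0 <= phi2 w) ->
  (forall A, measurable A -> \int[P]_(w in U @^-1` A) (phi1 w)%:E =
                             \int[P]_(w in U @^-1` A) (phi2 w)%:E)%E ->
  (\int[P]_w (f (U w) * phi1 w)%:E = \int[P]_w (f (U w) * phi2 w)%:E)%E.
Proof.
move=> mf f0 m1 p1 m2 p2 eqA.
have mEf : measurable_fun [set: E] (EFin \o f) by exact/measurable_EFinP.
pose g := nnsfun_approx measurableT mEf.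
have limg (phi : T -> R) : measurable_fun [set: T] phi -> (forall w, 0 <= phi w) ->
    (\int[P]_w (f (U w) * phi w)%:E =
     limn (fun n => \int[P]_w (g n (U w) * phi w)%:E))%E.
  move=> mphi phi0; rewrite -monotone_convergence//.
  - apply: eq_integral => w _; apply/esym/cvg_lim => //.
    under eq_fun do rewrite EFinM; rewrite EFinM.
    apply: cvgeZr => //.
    exact: (cvg_nnsfun_approx measurableT mEf (fun e _ => f0 e) (x := U w)).
  - move=> n; apply/measurable_EFinP; apply: measurable_funM => //.
    exact: measurableT_comp.
  - by move=> n w _; rewrite lee_fin mulr_ge0.
  - move=> w _ m n mn; rewrite lee_fin ler_wpM2r//.
    exact/lefP/nd_nnsfun_approx.
rewrite !limg//; congr (limn _); apply/funext => n.
rewrite !simple_weight//; apply: eq_fsbigr => r _; congr (_ * _)%E.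
exact: eqA.
Qed.

(** Two weights that give the same mass to every event of the sigma-algebra
    generated by [U] have the same integral against every function of [U]:
    this is how an identity that defines a conditional law on events, or a
    randomisation mechanism, becomes an identity between expectations. *)
Lemma weight_transfer (f : E -> R) (phi1 phi2 : T -> R) :
  bmeas f -> bmeas phi1 -> (forall w, 0 <= phi1 w) ->
  bmeas phi2 -> (forall w, 0 <= phi2 w) ->
  (forall A, measurable A -> \int[P]_(w in U @^-1` A) (phi1 w)%:E =
                             \int[P]_(w in U @^-1` A) (phi2 w)%:E)%E ->
  mean P (fun w => f (U w) * phi1 w) = mean P (fun w => f (U w) * phi2 w).
Proof.
move=> bf b1 p1 b2 p2 eqA.
have [mf [M fM]] := bf.
(* adding the bound [`|M|] makes the integrand nonnegative *)
have bMf : bmeas (fun e => `|M| + f e) by apply: bmeasD => //; exact: bmeas_cst.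
have bMfU : bmeas (fun w => `|M| + f (U w)) by exact: (bmeas_comp mU bMf).
have bfU : bmeas (fun w => f (U w)) by exact: (bmeas_comp mU bf).
have Mf0 e : 0 <= `|M| + f e.
  have := le_trans (fM e) (ler_norm M); rewrite ler_norml => /andP[h _].
  by rewrite addrC -lerBlDr sub0r.
have eqf g : bmeas g -> (forall e, 0 <= g e) ->
    mean P (fun w => g (U w) * phi1 w) = mean P (fun w => g (U w) * phi2 w).
  move=> bg g0; congr fine; apply: transfer_ge0 => //.
  - by case: bg.
  - by case: b1.
  - by case: b2.
have bM (phi : T -> R) : bmeas phi -> (forall w, 0 <= phi w) ->
    mean P (fun w => f (U w) * phi w) =
    mean P (fun w => (`|M| + f (U w)) * phi w) - mean P (fun w => `|M| * phi w).
  move=> bphi phi0; rewrite -meanB; last 2 first.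
  - by apply: bmeasM.
  - exact: bmeasM (bmeas_cst _) bphi.
  by apply: eq_mean => w; rewrite mulrDl addrAC subrr add0r.
rewrite !bM//; congr (_ - _); first exact: (eqf _ bMf Mf0).
exact: (eqf (fun=> `|M|) (bmeas_cst _) (fun=> normr_ge0 M)).
Qed.

End weight_transfer.

(** * Resampling one observation *)

Section laws.
Context {R : realType}.

(** The image laws are determined by their values on a generating class that is
    stable under intersection. *)
Lemma mean_eq_law {d1 d2 d} {T1 : measurableType d1} {T2 : measurableType d2}
    {E : measurableType d} (P1 : probability T1 R) (P2 : probability T2 R)
    (f1 : T1 -> E) (f2 : T2 -> E) (G : set (set E)) :
  measurable_fun [set: T1] f1 -> measurable_fun [set: T2] f2 ->
  measurable = <<s G >> -> setI_closed G -> G [set: E] ->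
  (forall A, G A -> P1 (f1 @^-1` A) = P2 (f2 @^-1` A)) ->
  forall F : E -> R, bmeas F ->
    mean P1 (fun x => F (f1 x)) = mean P2 (fun x => F (f2 x)).
Proof.
move=> mf1 mf2 mG GI GT eqG F bF.
pose g1 : {mfun T1 >-> E} := HB.pack f1 (isMeasurableFun.Build _ _ _ _ _ mf1).
pose g2 : {mfun T2 >-> E} := HB.pack f2 (isMeasurableFun.Build _ _ _ _ _ mf2).
have intE d' (T' : measurableType d') (P' : probability T' R) (g : {mfun T' >-> E}) :
    (\int[P']_x (F (g x))%:E = \int[pushforward P' g]_y (F y)%:E)%E.
  rewrite integral_pushforward//=.
  - by apply/measurable_EFinP; case: bF.
  - exact: (bmeas_integrable P' (bmeas_comp (f := F) (phi := g) _ bF)).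
rewrite /mean /Rintegral; congr fine.
rewrite (intE _ _ P1 g1) (intE _ _ P2 g2); apply: eq_measure_integral => A mA _.
apply: (measure_unique G (fun=> setT)) => //.
- by apply/seteqP; split => // x _; exists 0%N.
- move=> _; apply: (le_lt_trans (probability_le1 P1 _)); last exact: ltry.
  by rewrite -[X in measurable X]setTI; exact (mf1 measurableT _ measurableT).
Qed.

Lemma bmeas_mean2 {d1 d2} {T1 : measurableType d1} {T2 : measurableType d2}
    (P2 : probability T2 R) (F : T1 * T2 -> R) :
  bmeas F -> bmeas (fun x => mean P2 (fun y => F (x, y))).
Proof.
move=> bF; have [mF [M FM]] := bF.
have bFx x : bmeas (fun y => F (x, y)).
  by split; [exact: measurableT_comp | exists M].
split.
  pose G := fun z => `|M| + F z.
  have G0 z : 0 <= G z.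
    have := le_trans (FM z) (ler_norm M); rewrite ler_norml => /andP[h _].
    by rewrite /G addrC -lerBlDr sub0r.
  have mG : measurable_fun [set: T1 * T2] (EFin \o G).
    by apply/measurable_EFinP; apply: measurable_funD.
  have -> : (fun x => mean P2 (fun y => F (x, y))) =
      fun x => fine (\int[P2]_y (EFin \o G) (x, y))%E - `|M|.
    apply/funext => x; rewrite -/(Rintegral _ _ _) -/(mean P2 (fun y => G (x, y))).
    have -> : mean P2 (fun y => G (x, y)) = `|M| + mean P2 (fun y => F (x, y)).
      by rewrite (meanD P2 (bmeas_cst `|M|) (bFx x)) mean_cst.
    by rewrite addrAC subrr add0r.
  apply: measurable_funB => //; apply: measurableT_comp => //.
  apply: (measurable_fun_fubini_tonelli_F (m2 := P2) (EFin \o G)) => //.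
exists M => x; rewrite ler_norml; apply/andP; split.
- rewrite -(mean_cst P2 (- M)); apply: le_mean => //; first exact: bmeas_cst.
  by move=> y; have := FM (x, y); rewrite ler_norml => /andP[].
- rewrite -(mean_cst P2 M); apply: le_mean => //; first exact: bmeas_cst.
  by move=> y; have := FM (x, y); rewrite ler_norml => /andP[].
Qed.

Lemma mean_fubini {d1 d2} {T1 : measurableType d1} {T2 : measurableType d2}
    (P1 : probability T1 R) (P2 : probability T2 R) (F : T1 * T2 -> R) :
  bmeas F ->
  mean (P1 \x P2)%E F = mean P1 (fun x => mean P2 (fun y => F (x, y))).
Proof.
move=> bF; have [mF [M FM]] := bF.
have bFx x : bmeas (fun y => F (x, y)).
  by split; [exact: measurableT_comp | exists M].
rewrite {1 2}/mean /Rintegral; congr fine.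
rewrite -integral12_prod_meas1; last exact: (bmeas_integrable (P1 \x P2)%E bF).
by apply: eq_integral => x _; rewrite /fubini_F -meanE.
Qed.

End laws.

Section resampling.
Context {R : realType} {d dS : measure_display}.
Context {T : measurableType d} {S : measurableType dS}.
Variables (P : probability T R) (V : nat -> T -> S) (mu : probability S R).
Hypothesis mV : forall i, measurable_fun [set: T] (V i).
Hypothesis indep : mutually_independent P V.
Hypothesis law : forall i A, measurable A -> P (V i @^-1` A) = mu A.
Variable n : nat.

Definition sample (w : T) : n.-tuple S := [tuple V i w | i < n].

Definition upd (t : n.-tuple S) (i : 'I_n) (v : S) : n.-tuple S :=
  [tuple if j == i then v else tnth t j | j < n].

Lemma tnth_upd t i v j : tnth (upd t i v) j = if j == i then v else tnth t j.
Proof. by rewrite tnth_mktuple. Qed.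

Lemma measurable_sample : measurable_fun [set: T] sample.
Proof.
apply/measurable_fun_tnthP => i; rewrite (_ : _ \o _ = V i)//.
by apply/funext => w /=; rewrite tnth_mktuple.
Qed.

Lemma measurable_upd i :
  measurable_fun [set: n.-tuple S * S] (fun x => upd x.1 i x.2).
Proof.
apply/measurable_fun_tnthP => j; have [->|ji] := eqVneq j i.
  rewrite (_ : _ \o _ = snd)//.
  by apply/funext => x /=; rewrite tnth_upd eqxx.
rewrite (_ : _ \o _ = (@tnth _ _ ^~ j) \o fst).
  by apply: measurableT_comp => //; exact: measurable_tnth.
by apply/funext => x /=; rewrite tnth_upd (negbTE ji).
Qed.

Definition box (B : 'I_n -> set S) : set (n.-tuple S) :=
  [set t | forall i, B i (tnth t i)].

Definition boxes : set (set (n.-tuple S)) :=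
  [set A | exists2 B, (forall i, measurable (B i)) & A = box B].

Lemma measurable_box B : (forall i, measurable (B i)) -> measurable (box B).
Proof.
move=> mB.
have -> : box B = \bigcap_(i in [set: 'I_n]) ((@tnth _ _ ^~ i) @^-1` B i).
  by apply/seteqP; split => [t h i _|t h i]; [exact: h|exact: (h i I)].
apply: fin_bigcap_measurable; first exact: finite_finset.
move=> i _; rewrite -[X in measurable X]setTI.
exact: measurable_tnth.
Qed.

Lemma boxes_generate : @measurable _ (n.-tuple S) = <<s boxes >>.
Proof.
apply/seteqP; split.
  apply: smallest_sub; first exact: smallest_sigma_algebra.
  move=> A; rewrite -bigcup_seq => -[i _ [B mB <-]].
  apply: sub_sigma_algebra; exists (fun j => if j == i then B else setT).
    by move=> j; case: ifP.
  rewrite setTI; apply/seteqP; split => t /=.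
    by move=> Bt j; case: eqP => // ->.
  by move=> /(_ i); rewrite eqxx.
apply: smallest_sub; first exact: sigma_algebra_measurable.
by move=> _ [B mB ->]; exact: measurable_box.
Qed.

Lemma boxesI : setI_closed boxes.
Proof.
move=> _ _ [A mA ->] [B mB ->]; exists (fun i => A i `&` B i).
  by move=> i; exact: measurableI.
apply/seteqP; split => t /=; first by case=> At Bt i; split.
by move=> h; split => i; case: (h i).
Qed.

Lemma boxesT : boxes setT.
Proof. by exists (fun=> setT) => //; apply/seteqP; split. Qed.

Lemma sample_box B : (forall i, measurable (B i)) ->
  (P (sample @^-1` box B) = \prod_(i < n) mu (B i))%E.
Proof.
move=> mB.
pose A (k : nat) : set S := if insub k is Some i then B i else setT.
have AB (i : 'I_n) : A i = B i by rewrite /A valK.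
pose J := [fset k in iota 0 n]%fset.
have JE k : (k \in J) = (k < n)%N by rewrite !inE mem_iota.
have mA k : measurable (A k) by rewrite /A; case: insub.
have := indep (J := J) (A := A) (fun k _ => mA k).
rewrite (_ : \bigcap_(i in _) _ = sample @^-1` box B); last first.
  apply/seteqP; split => w /=.
    move=> h i; rewrite tnth_mktuple -AB; apply: h => /=.
    by rewrite JE.
  move=> h k /=; rewrite JE => kn; rewrite /A insubT/=.
  by have := h (Ordinal kn); rewrite tnth_mktuple.
move=> ->; rewrite (perm_big (iota 0 n)); last first.
  apply: uniq_perm; [exact: fset_uniq | exact: iota_uniq |].
  by move=> k; rewrite JE mem_iota.
rewrite -[X in iota 0 X]subn0 -/(index_iota 0 n) big_mkord.
by apply: eq_bigr => i _; rewrite law// AB.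
Qed.

(** Replacing one observation of an i.i.d. sample by an independent copy does
    not change the law of the sample.  It is enough to check this on boxes,
    where both sides are products of marginal probabilities. *)
Lemma resample (i : 'I_n) (F : n.-tuple S -> R) : bmeas F ->
  mean P (fun w => F (sample w)) =
  mean P (fun w => mean mu (fun v => F (upd (sample w) i v))).
Proof.
move=> bF.
have m2 : measurable_fun [set: T * S] (fun x => upd (sample x.1) i x.2).
  apply: (measurableT_comp (f := fun x : n.-tuple S * S => upd x.1 i x.2)
    (g := fun x : T * S => (sample x.1, x.2))); first exact: measurable_upd.
  apply/measurable_fun_pairP; split; last exact: measurable_snd.
  exact: (measurableT_comp measurable_sample measurable_fst).
rewrite -(mean_fubini P mu (F := fun x => F (upd (sample x.1) i x.2))); last first.
  exact: (bmeas_comp m2 bF).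
apply: (mean_eq_law measurable_sample m2 boxes_generate boxesI boxesT) => //.
move=> _ [B mB ->]; rewrite sample_box//.
pose B' j := if j == i then setT else B j.
have mB' j : measurable (B' j) by rewrite /B'; case: ifP.
have -> : (fun x : T * S => upd (sample x.1) i x.2) @^-1` box B =
    (sample @^-1` box B') `*` B i.
  apply/seteqP; split => -[w v] /=.
    move=> h; split.
      move=> j; rewrite /B'; case: (eqVneq j i) => // ji.
      by have := h j; rewrite tnth_upd (negbTE ji).
    by have := h i; rewrite tnth_upd eqxx.
  move=> [h1 h2] j; rewrite tnth_upd; case: (eqVneq j i) => [->//|ji].
  by have := h1 j; rewrite /B' (negbTE ji).
transitivity (P (sample @^-1` box B') * mu (B i))%E; last first.
  apply/esym/product_measure1E => //; rewrite -[X in measurable X]setTI; apply: measurable_sample => //.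
  exact: measurable_box.
rewrite sample_box// (bigD1 i)//= [in RHS](bigD1 i)//= {1}/B' eqxx.
rewrite probability_setT mul1e muleC; congr (_ * _)%E; apply: eq_bigr => j ji.
by rewrite /B' (negbTE ji).
Qed.

End resampling.

(** * Mean square of a two-sample average *)

Lemma sum_diag {R : realType} (I : finType) (i : I) :
  \sum_(j : I) (i == j)%:R = 1 :> R.
Proof.
rewrite (bigD1 i)//= eqxx big1 ?addr0// => j; rewrite eq_sym.
by move=> /negbTE ->.
Qed.

Section vstat.
Context {R : realType} {d dS : measure_display}.
Context {T : measurableType d} {S : measurableType dS}.
Variables (P : probability T R) (V : nat -> T -> S) (mu : probability S R).
Hypothesis mV : forall i, measurable_fun [set: T] (V i).
Hypothesis indep : mutually_independent P V.
Hypothesis law : forall i A, measurable A -> P (V i @^-1` A) = mu A.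
Variable n : nat.
Hypothesis n_gt0 : (0 < n)%N.

Let smp := @sample _ _ T S V n.
Let msmp : measurable_fun [set: T] smp := measurable_sample mV (n := n).

Lemma bmeas_tnth (i : 'I_n) (f : S -> R) : bmeas f ->
  bmeas (fun t : n.-tuple S => f (tnth t i)).
Proof. by move=> bf; apply: (bmeas_comp _ bf); exact: measurable_tnth. Qed.

Lemma bmeas_tnth2 (i j : 'I_n) (F : S * S -> R) : bmeas F ->
  bmeas (fun t : n.-tuple S => F (tnth t i, tnth t j)).
Proof.
move=> bF.
apply: (bmeas_comp (phi := fun t : n.-tuple S => (tnth t i, tnth t j)) _ bF).
by apply/measurable_fun_pairP; split; exact: measurable_tnth.
Qed.

(** A factor that ignores the observations [i] and [j] splits off, because these two
    observations can be resampled. *)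
Lemma mean_vterm (F : S * S -> R) (i j : 'I_n) (psi : n.-tuple S -> R) :
  bmeas F -> bmeas psi -> i != j ->
  (forall t v, psi (upd t i v) = psi t) -> (forall t v, psi (upd t j v) = psi t) ->
  mean P (fun w => F (tnth (smp w) i, tnth (smp w) j) * psi (smp w)) =
  mean mu (fun v' => mean mu (fun v => F (v, v'))) * mean P (fun w => psi (smp w)).
Proof.
move=> bF bpsi ij psii psij.
have bF' : bmeas (fun x : S * S => F (x.2, x.1)).
  apply: (bmeas_comp _ bF); apply/measurable_fun_pairP; split.
    exact: measurable_snd.
  exact: measurable_fst.
have bh := bmeas_mean2 mu bF'.
have bFv v' : bmeas (fun v => F (v, v')).
  exact: (bmeas_comp (phi := fun v => (v, v')) _ bF).
set h := fun v' => mean mu (fun v => F (v, v')).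
have b1 : bmeas (fun t : n.-tuple S => F (tnth t i, tnth t j) * psi t).
  by apply: bmeasM => //; exact: bmeas_tnth2.
have b2 : bmeas (fun t : n.-tuple S => h (tnth t j) * psi t).
  by apply: bmeasM => //; exact: bmeas_tnth.
rewrite (resample mV indep law i b1).
transitivity (mean P (fun w => h (tnth (smp w) j) * psi (smp w))).
  apply: eq_mean => w; rewrite [RHS]mulrC -meanZ//.
  apply: eq_mean => v; rewrite !tnth_upd eqxx psii.
  by rewrite eq_sym (negbTE ij) mulrC.
rewrite (resample mV indep law j b2) -meanZ; last exact: (bmeas_comp msmp bpsi).
apply: eq_mean => w; rewrite [RHS]mulrC -meanZ//.
by apply: eq_mean => v; rewrite tnth_upd eqxx psij mulrC.
Qed.

(** In the expanded square only the pairs of terms that share an observation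
    survive, and there are O(n^3) of them among n^4. *)
Lemma vstat_second_moment (F : S * S -> R) (theta : R) :
  bmeas F -> (forall x, 0 <= F x <= 1) ->
  theta = mean mu (fun v' => mean mu (fun v => F (v, v'))) ->
  mean P (fun w => (n%:R ^- 2 * \sum_(i < n) \sum_(j < n)
            (F (V i w, V j w) - theta)) ^+ 2) <= 6 / n%:R.
Proof.
move=> bF F01 thetaE.
have n0 : n%:R != 0 :> R by rewrite pnatr_eq0 -lt0n.
have bFv v' : bmeas (fun v => F (v, v')).
  exact: (bmeas_comp (phi := fun v => (v, v')) _ bF).
have bh : bmeas (fun v' => mean mu (fun v => F (v, v'))).
  apply: (bmeas_mean2 mu (F := fun x : S * S => F (x.2, x.1))).
  apply: (bmeas_comp _ bF); apply/measurable_fun_pairP; split.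
    exact: measurable_snd.
  exact: measurable_fst.
have theta01 : 0 <= theta <= 1.
  have h01 v' : 0 <= mean mu (fun v => F (v, v')) <= 1.
    rewrite mean_ge0/=; last by move=> v; have /andP[] := F01 (v, v').
    rewrite -(mean_cst mu 1); apply: le_mean => //; first exact: bmeas_cst.
    by move=> v; have /andP[] := F01 (v, v').
  rewrite thetaE mean_ge0/=; last by move=> v; have /andP[] := h01 v.
  rewrite -(mean_cst mu 1); apply: le_mean => //; first exact: bmeas_cst.
  by move=> v; have /andP[] := h01 v.
pose D (i j : 'I_n) (t : n.-tuple S) := F (tnth t i, tnth t j) - theta.
have bD i j : bmeas (D i j).
  by apply: bmeasB; [exact: bmeas_tnth2|exact: bmeas_cst].
have bDw i j : bmeas (fun w => D i j (smp w)) by exact: (bmeas_comp msmp (bD i j)).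
have D1 i j t : `|D i j t| <= 1.
  have /andP[f0 f1] := F01 (tnth t i, tnth t j).
  have /andP[t0 t1] := theta01.
  by rewrite ler_norml /D; lra.
pose shared (i j i' j' : 'I_n) : R :=
  (i == j)%:R + (i' == j')%:R + (i == i')%:R + (i == j')%:R + (j == i')%:R + (j == j')%:R.
have cov i j i' j' :
    mean P (fun w => D i j (smp w) * D i' j' (smp w)) <= shared i j i' j'.
  have le1 : mean P (fun w => D i j (smp w) * D i' j' (smp w)) <= 1.
    rewrite -(mean_cst P 1); apply: le_mean; [exact: bmeasM|exact: bmeas_cst|].
    move=> w; rewrite (le_trans (ler_norm _))// normrM.
    by rewrite mulr_ile1.
  have [disj|] := boolP [|| i == j, i' == j', i == i', i == j', j == i' | j == j'].
    apply: (le_trans le1); rewrite /shared -!natrD ler1n; move: disj.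
    by case: (i == j); case: (i' == j'); case: (i == i'); case: (i == j');
      case: (j == i'); case: (j == j').
  rewrite !negb_or => /and5P[ij ij' ii' ijj /andP[ji' jj']].
  rewrite /shared (negbTE ij) (negbTE ij') (negbTE ii') (negbTE ijj).
  rewrite (negbTE ji') (negbTE jj') !addr0.
  have insi t v : D i' j' (upd t i v) = D i' j' t.
    by rewrite /D !tnth_upd [i' == i]eq_sym (negbTE ii') [j' == i]eq_sym (negbTE ijj).
  have insj t v : D i' j' (upd t j v) = D i' j' t.
    by rewrite /D !tnth_upd [i' == j]eq_sym (negbTE ji') [j' == j]eq_sym (negbTE jj').
  have bFp : bmeas (fun w => F (tnth (smp w) i, tnth (smp w) j) * D i' j' (smp w)).
    apply: bmeasM => //; exact: (bmeas_comp msmp (bmeas_tnth2 i j bF)).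
  under eq_mean do rewrite {1}/D mulrBl.
  rewrite meanB//; last by apply: bmeasM => //; exact: bmeas_cst.
  by rewrite (mean_vterm bF (bD i' j') ij insi insj) meanZ// thetaE subrr.
have -> : (fun w => (n%:R ^- 2 * \sum_(i < n) \sum_(j < n)
            (F (V i w, V j w) - theta)) ^+ 2) =
    (fun w => n%:R ^- 4 * \sum_(i < n) \sum_(j < n) \sum_(i' < n) \sum_(j' < n)
       D i j (smp w) * D i' j' (smp w)).
  apply/funext => w.
  have -> : \sum_(i < n) \sum_(j < n) (F (V i w, V j w) - theta) =
      \sum_(i < n) \sum_(j < n) D i j (smp w).
    by apply: eq_bigr => i _; apply: eq_bigr => j _; rewrite /D !tnth_mktuple.
  rewrite exprMn -exprVn -exprM exprVn; congr (_ * _).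
  rewrite expr2 mulr_suml; apply: eq_bigr => i _.
  rewrite mulr_suml; apply: eq_bigr => j _.
  rewrite mulr_sumr; apply: eq_bigr => i' _.
  by rewrite mulr_sumr.
have b4 i j i' j' : bmeas (fun w => D i j (smp w) * D i' j' (smp w)).
  exact: bmeasM.
rewrite meanZ; last first.
  by do 4 (apply: bmeas_sum => ? _).
rewrite mean_sum; last by move=> i _; do 3 (apply: bmeas_sum => ? _).
apply: (@le_trans _ _ (n%:R ^- 4 * \sum_(i < n) \sum_(j < n) \sum_(i' < n)
    \sum_(j' < n) shared i j i' j')).
  rewrite ler_wpM2l ?invr_ge0 ?exprn_ge0//.
  apply: ler_sum => i _.
  rewrite mean_sum; last by move=> j _; do 2 (apply: bmeas_sum => ? _).
  apply: ler_sum => j _; rewrite mean_sum; last by move=> i' _; apply: bmeas_sum.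
  by apply: ler_sum => i' _; rewrite mean_sum//; apply: ler_sum => j' _; exact: cov.
have -> : \sum_(i < n) \sum_(j < n) \sum_(i' < n) \sum_(j' < n) shared i j i' j' =
    6 * n%:R ^+ 3.
  have [dl dlE sdl] : exists2 dl : 'I_n -> 'I_n -> R,
      (forall i j, (i == j)%:R = dl i j) & forall i, \sum_j dl i j = 1.
    by exists (fun i j => (i == j)%:R) => // i; exact: sum_diag.
  rewrite /shared.
  under eq_bigr => i _ do under eq_bigr => j _ do under eq_bigr => i' _ do
    (under eq_bigr => j' _ do rewrite !dlE; rewrite !big_split/= !sdl !sumr_const card_ord).
  under eq_bigr => i _ do under eq_bigr => j _ do
    rewrite !big_split/= !sumrMnl !sdl !sumr_const card_ord.
  under eq_bigr => i _ do
    rewrite !big_split/= !sumrMnl !sdl !sumr_const card_ord.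
  rewrite !big_split/= !sumrMnl !sumr_const card_ord.
  by ring.
rewrite le_eqVlt; apply/orP; left; apply/eqP; field.
exact: n0.
Qed.

End vstat.

(** * Geometry of nearest neighbours *)

Section euclid.
Context {R : realType} {m : nat}.
Implicit Types x y z : m.-tuple R.

Lemma euclid_distE x y :
  euclid_dist x y = Num.sqrt (\sum_(c < m) (tnth x c - tnth y c) ^+ 2).
Proof.
by congr Num.sqrt; apply: eq_bigr => c _; rewrite tnth_mktuple.
Qed.

Lemma euclid_dist_ge0 x y : 0 <= euclid_dist x y.
Proof. exact: sqrtr_ge0. Qed.

Lemma sqr_euclid_dist x y :
  euclid_dist x y ^+ 2 = \sum_(c < m) (tnth x c - tnth y c) ^+ 2.
Proof.
by rewrite euclid_distE sqr_sqrtr// sumr_ge0// => c _; exact: sqr_ge0.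
Qed.

Lemma euclid_dist_eq0 x y : (euclid_dist x y == 0) = (x == y).
Proof.
rewrite -sqrf_eq0 sqr_euclid_dist psumr_eq0; last by move=> c _; exact: sqr_ge0.
apply/allP/eqP => [h|-> c _]; last by rewrite /= subrr expr0n/= eqxx.
apply: eq_from_tnth => c; apply/eqP; rewrite -subr_eq0 -sqrf_eq0.
by apply: (h c); rewrite mem_index_enum.
Qed.

Lemma normr_coord_le x c : `|tnth x c| <= euclid_norm x.
Proof.
rewrite -sqrtr_sqr; apply: ler_wsqrtr.
by rewrite (bigD1 c)//= lerDl sumr_ge0// => c' _; exact: sqr_ge0.
Qed.

Lemma euclid_dist_le_coord x y (h : R) : 0 <= h ->
  (forall c, `|tnth x c - tnth y c| <= h) ->
  euclid_dist x y <= Num.sqrt m%:R * h.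
Proof.
move=> h0 xy; rewrite -ler_sqr ?nnegrE ?euclid_dist_ge0 ?mulr_ge0 ?sqrtr_ge0//.
rewrite sqr_euclid_dist exprMn sqr_sqrtr// mulr_natl.
rewrite -[X in _ *+ X]card_ord -sumr_const; apply: ler_sum => c _.
by rewrite -real_normK ?num_real// ler_sqr ?nnegrE.
Qed.

(** Two vectors whose directions are closer than 1 make an angle smaller than
    60 degrees, so that the longer one is closer to the shorter one than to the
    origin. *)
Lemma dist_lt_in_cone x y z :
  0 < euclid_dist x z -> euclid_dist x z <= euclid_dist y z ->
  \sum_(c < m) ((tnth x c - tnth z c) / euclid_dist x z -
                (tnth y c - tnth z c) / euclid_dist y z) ^+ 2 < 1 ->
  euclid_dist y x < euclid_dist y z.
Proof.
set A := euclid_dist x z; set B := euclid_dist y z => A0 AB.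
have B0 : 0 < B by exact: lt_le_trans AB.
pose ip := \sum_(c < m) (tnth x c - tnth z c) * (tnth y c - tnth z c).
have -> : \sum_(c < m) ((tnth x c - tnth z c) / A - (tnth y c - tnth z c) / B) ^+ 2 =
    2 - 2 * ip / (A * B).
  transitivity (\sum_(c < m) ((tnth x c - tnth z c) ^+ 2 / A ^+ 2
      + (tnth y c - tnth z c) ^+ 2 / B ^+ 2
      - (2 / (A * B)) * ((tnth x c - tnth z c) * (tnth y c - tnth z c)))).
    by apply: eq_bigr => c _; field; rewrite !gt_eqF.
  rewrite sumrB big_split/= -!mulr_suml -mulr_sumr -/ip -!sqr_euclid_dist -/A -/B.
  by field; rewrite !gt_eqF.
move=> h.
have {h} : A * B < 2 * ip.
  have AB0 : 0 < A * B by exact: mulr_gt0.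
  have : 1 < 2 * ip / (A * B) by lra.
  by rewrite ltr_pdivlMr// mul1r.
move=> h; rewrite -ltr_sqr ?nnegrE ?euclid_dist_ge0//.
have -> : euclid_dist y x ^+ 2 = A ^+ 2 + B ^+ 2 - 2 * ip.
  rewrite /A /B !sqr_euclid_dist /ip mulr_sumr -big_split -sumrB/=.
  by apply: eq_bigr => c _; ring.
have := ler_wpM2l (ltW A0) AB.
by rewrite -expr2; lra.
Qed.

End euclid.

Section nearest_facts.
Context {R : realType} {m n : nat}.
Variable u : 'I_n -> m.-tuple R.
Implicit Types i k l : 'I_n.

Lemma nearest_neq i k : k \in nearest u i -> k != i.
Proof. by rewrite inE => /andP[]. Qed.

Lemma nearest_le i k l : k \in nearest u i -> l != i ->
  euclid_dist (u i) (u k) <= euclid_dist (u i) (u l).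
Proof. by rewrite inE => /andP[_ /forallP/(_ l)/implyP]. Qed.

Lemma nearest_neq0 i : (1 < n)%N -> (0 < #|nearest u i|)%N.
Proof.
move=> n1.
have [j ji] : exists j, j != i.
  have : (0 < #|~: [set i]%SET|)%N by rewrite cardsC1 card_ord; case: (n) n1 => [|[]].
  by move=> /card_gt0P[j]; rewrite !inE => ji; exists j.
pose k := [arg min_(k < j | k != i) euclid_dist (u i) (u k)]%O.
apply/card_gt0P; exists k; rewrite inE /k.
case: arg_minP => //= l li lmin; rewrite li; apply/forallP => l'.
by apply/implyP => ?; exact: lmin.
Qed.

(** The cube [-1,1]^m is covered by this number of half-open cells of side
    1/(m+1); the 3 allows for the endpoint 1 on each axis. *)
Definition cone_count : nat := (2 * m + 3) ^ m.

(** Directions lying in a common cell are less than 1 apart, so that at most one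
    point per cell can have [u l] as nearest neighbour at a positive distance. *)
Lemma cone_bound l :
  (#|[set i | (u i != u l) && (l \in nearest u i)]%SET| <= cone_count)%N.
Proof.
set A := [set i | _]%SET.
pose v i c := (tnth (u i) c - tnth (u l) c) / euclid_dist (u i) (u l).
pose cell i : {ffun 'I_m -> 'I_(2 * m + 3)} :=
  [ffun c => insubd (Ordinal (ltn_addl (2 * m) (isT : 0 < 3)%N))
    (Num.truncn ((v i c + 1) * m.+1%:R))].
have dpos i : i \in A -> 0 < euclid_dist (u i) (u l).
  by rewrite inE => /andP[ul _]; rewrite lt_neqAle euclid_dist_ge0 eq_sym euclid_dist_eq0 ul.
have v1 i c : i \in A -> -1 <= v i c <= 1.
  move=> iA; rewrite -ler_norml /v normrM normfV (gtr0_norm (dpos _ iA)).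
  rewrite ler_pdivrMr ?dpos// mul1r.
  have := normr_coord_le [tuple tnth (u i) c - tnth (u l) c | c < m] c.
  by rewrite tnth_mktuple.
have cellE i c : i \in A -> (cell i c : nat) = Num.truncn ((v i c + 1) * m.+1%:R).
  move=> iA; rewrite ffunE val_insubd.
  have /andP[v1l v1r] := v1 i c iA.
  rewrite ifT// -(ltr_nat R).
  apply: (@le_lt_trans _ _ ((v i c + 1) * m.+1%:R)).
    by rewrite truncn_le// mulr_ge0//; lra.
  apply: (@le_lt_trans _ _ (2 * m.+1%:R)).
    by rewrite ler_wpM2r//; lra.
  by rewrite -natrM ltr_nat; lia.
have close i i' c : i \in A -> i' \in A -> cell i = cell i' ->
    (v i c - v i' c) ^+ 2 <= m.+1%:R ^- 2.
  move=> iA i'A ii'.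
  have e : Num.truncn ((v i c + 1) * m.+1%:R) = Num.truncn ((v i' c + 1) * m.+1%:R).
    by rewrite -!cellE// ii'.
  have /andP[vl vr] := v1 i c iA; have /andP[vl' vr'] := v1 i' c i'A.
  have M0 : 0 < m.+1%:R :> R by rewrite ltr0n.
  have nn : 0 <= (v i c + 1) * m.+1%:R by rewrite mulr_ge0//; lra.
  have nn' : 0 <= (v i' c + 1) * m.+1%:R by rewrite mulr_ge0//; lra.
  have /andP[h1 h2] := truncn_itv nn; have /andP[h3 h4] := truncn_itv nn'.
  move: h1 h2 h3 h4; rewrite e; set k := Num.truncn _ => h1 h2 h3 h4.
  rewrite -exprVn -[leLHS]real_normK ?num_real//.
  rewrite ler_sqr ?nnegrE ?normr_ge0 ?invr_ge0//=.
  rewrite -[leRHS]mul1r ler_pdivlMr// -[X in _ * X](gtr0_norm M0) -normrM ler_norml.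
  have k1 : k.+1%:R = k%:R + 1 :> R by rewrite -addn1 natrD.
  move: h2 h4; rewrite k1 => h2 h4.
  by rewrite mulrBl; move: h1 h2 h3 h4; rewrite !mulrDl => h1 h2 h3 h4;
    apply/andP; split; lra.
have inj : {in A &, injective cell}.
  suff main i i' : i \in A -> i' \in A -> cell i = cell i' ->
      euclid_dist (u i) (u l) <= euclid_dist (u i') (u l) -> i = i'.
    move=> i i' iA i'A e.
    have [h|h] := leP (euclid_dist (u i) (u l)) (euclid_dist (u i') (u l)).
      exact: main.
    by apply/esym/main => //; exact: ltW.
  move=> iA i'A e dd; apply/eqP/negPn/negP => ii'.
  have : euclid_dist (u i') (u i) < euclid_dist (u i') (u l).
    apply: dist_lt_in_cone => //; first exact: dpos.
    apply: (@le_lt_trans _ _ (\sum_(c < m) m.+1%:R ^- 2)).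
      by apply: ler_sum => c _; exact: close.
    rewrite sumr_const card_ord -[_ *+ _]mulr_natl.
    rewrite ltr_pdivrMr ?exprn_gt0 ?ltr0n// mul1r -natrX ltr_nat.
    by nia.
  apply/negP; rewrite -leNgt; apply: nearest_le => //.
  by move: i'A; rewrite inE => /andP[].
rewrite -(card_in_imset inj) (leq_trans (max_card _))//.
by rewrite card_ffun !card_ord.
Qed.

(** The weight of a nearest neighbour when ties are broken uniformly. *)
Definition tie_weight i l : R :=
  if l \in nearest u i then #|nearest u i|%:R^-1 else 0.

Lemma tie_weight_ge0 i l : 0 <= tie_weight i l.
Proof. by rewrite /tie_weight; case: ifP => // _; rewrite invr_ge0. Qed.

Lemma tie_weight_le1 i l : tie_weight i l <= 1.
Proof.
rewrite /tie_weight; case: ifP => // li; rewrite invf_le1 ?ler1n ?ltr0n.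
  by apply/card_gt0P; exists l.
by apply/card_gt0P; exists l.
Qed.

Lemma sum_tie_weight i : (1 < n)%N -> \sum_l tie_weight i l = 1.
Proof.
move=> n1; rewrite /tie_weight -big_mkcond/= sumr_const -[_ *+ _]mulr_natr.
by rewrite mulVf// pnatr_eq0 -lt0n nearest_neq0.
Qed.

(** Coinciding points contribute a total weight at most 1, because each of them
    distributes its unit mass among the others; the remaining points are at a
    positive distance and [cone_bound] applies. *)
Lemma sum_tie_weight_in l : \sum_i tie_weight i l <= 1 + cone_count%:R.
Proof.
rewrite (bigID (fun i => u i == u l))/=; apply: lerD.
  pose E := [set i | (i != l) && (u i == u l)]%SET.
  have nearE i : u i == u l -> l \in nearest u i -> nearest u i = [set k | (k != i) && (u k == u l)]%SET.
    move=> /eqP ul li; apply/setP => k; rewrite [in RHS]inE; apply/idP/andP.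
      move=> ki; split; first exact: nearest_neq.
      have := nearest_le ki (nearest_neq li); rewrite ul.
      have -> : euclid_dist (u l) (u l) = 0 by apply/eqP; rewrite euclid_dist_eq0.
      by move=> h; rewrite eq_sym -euclid_dist_eq0 eq_le h euclid_dist_ge0.
    move=> [ki /eqP kl]; rewrite inE ki /=; apply/forallP => k'; apply/implyP => _.
    have -> : euclid_dist (u i) (u k) = 0 by apply/eqP; rewrite euclid_dist_eq0 kl ul.
    exact: euclid_dist_ge0.
  have cardE i : u i == u l -> l \in nearest u i -> #|nearest u i| = #|E|.
    move=> ul li; rewrite nearE//.
    have := cardsD1 i [set k | u k == u l]%SET; rewrite inE ul add1n.
    have := cardsD1 l [set k | u k == u l]%SET; rewrite inE eqxx add1n => -> [].
    have -> : ([set k | u k == u l] :\ l = E)%SET by apply/setP => k; rewrite !inE.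
    have -> : ([set k | u k == u l] :\ i = [set k | (k != i) && (u k == u l)])%SET.
      by apply/setP => k; rewrite !inE.
    by move=> ->.
  apply: (@le_trans _ _ (\sum_(i in E) #|E|%:R^-1)); last first.
    rewrite sumr_const -[_ *+ _]mulr_natr.
    have [->|E0] := posnP #|E|; first by rewrite mulr0.
    by rewrite mulVf// pnatr_eq0 -lt0n.
  rewrite [leLHS]big_mkcond [leRHS]big_mkcond/=; apply: ler_sum => i _.
  rewrite inE; case: (boolP (u i == u l)) => [ul|]; last by rewrite andbF.
  rewrite /tie_weight; case: ifPn => [li|_]; last by rewrite andbT; case: ifP => // _; rewrite invr_ge0.
  by rewrite andbT eq_sym (nearest_neq li) cardE.
apply: (@le_trans _ _ (\sum_(i in [set i | (u i != u l) && (l \in nearest u i)]%SET) 1)).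
  rewrite [leLHS]big_mkcond [leRHS]big_mkcond/=; apply: ler_sum => i _.
  rewrite inE; case: (u i != u l) => //=.
  by rewrite /tie_weight; case: ifP => // li; have := tie_weight_le1 i l; rewrite /tie_weight li.
by rewrite sumr_const ler_nat cone_bound.
Qed.

End nearest_facts.

(** * The sum of nearest neighbour distances *)

Section nn_sum.
Context {R : realType} {m n : nat}.
Variables (u : 'I_n -> m.-tuple R) (nb : 'I_n -> 'I_n) (r : R).
Hypothesis m_gt0 : (0 < m)%N.
Hypothesis u_lt : forall i c, `|tnth (u i) c| < r.
Hypothesis nbP : forall i, nb i \in nearest u i.

Let D : R := 2 * r * Num.sqrt m%:R.
Let dd i := euclid_dist (u i) (u (nb i)).

(** Points whose nearest neighbour is further than the diameter of a cell lie in
    different cells. *)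
Let far_count K : (0 < K)%N ->
  (#|[set i | (D / K%:R < dd i)%R]%SET| <= K ^ m)%N.
Proof.
move=> K0; set A := [set i | _]%SET.
have K0R : 0 < K%:R :> R by rewrite ltr0n.
have [->|/card_gt0P[i0 _]] := posnP #|A|; first by [].
have r0 : 0 < r by apply: le_lt_trans (u_lt i0 (Ordinal m_gt0)).
pose z i c := (tnth (u i) c + r) * K%:R / (2 * r).
have z0 i c : 0 <= z i c.
  have := u_lt i c; rewrite ltr_norml => /andP[h1 h2].
  by rewrite /z divr_ge0 ?mulr_ge0//; lra.
have zK i c : z i c < K%:R.
  have := u_lt i c; rewrite ltr_norml => /andP[h1 h2].
  rewrite /z ltr_pdivrMr; last by lra.
  by rewrite mulrC ltr_pM2l//; lra.
pose cell i : {ffun 'I_m -> 'I_K} :=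
  [ffun c => insubd (Ordinal K0) (Num.truncn (z i c))].
have cellE i c : (cell i c : nat) = Num.truncn (z i c).
  rewrite ffunE val_insubd ifT// -(ltr_nat R).
  by apply: le_lt_trans (zK i c); rewrite truncn_le.
have inj : {in A &, injective cell}.
  move=> i i' iA i'A e; apply/eqP/negPn/negP => ii'.
  have : euclid_dist (u i) (u i') <= D / K%:R.
    rewrite /D (_ : _ / _ = Num.sqrt m%:R * (2 * r / K%:R)); last by ring.
    apply: euclid_dist_le_coord; first by rewrite divr_ge0 ?mulr_ge0 ?ltW.
    move=> c.
    have /andP[h1 h2] := truncn_itv (z0 i c).
    have /andP[h3 h4] := truncn_itv (z0 i' c).
    move: h1 h2 h3 h4; rewrite -!cellE e.
    set k := nat_of_ord _.
    have k1 : k.+1%:R = k%:R + 1 :> R by rewrite -addn1 natrD.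
    rewrite k1 => h1 h2 h3 h4.
    have -> : tnth (u i) c - tnth (u i') c = (z i c - z i' c) * (2 * r / K%:R).
      by rewrite /z; field; rewrite !gt_eqF.
    have q0 : 0 <= 2 * r / K%:R by rewrite divr_ge0 ?mulr_ge0 ?ltW.
    rewrite normrM (ger0_norm q0) -[leRHS]mul1r ler_wpM2r//.
    by rewrite ler_norml; apply/andP; split; lra.
  apply/negP; rewrite -ltNge.
  move: iA; rewrite inE => /lt_le_trans; apply.
  by apply: (nearest_le (nbP i)); rewrite eq_sym.
rewrite -(card_in_imset inj) (leq_trans (max_card _))//.
by rewrite card_ffun !card_ord.
Qed.

Let dd_le i : dd i <= D.
Proof.
have r0 : 0 < r by apply: le_lt_trans (u_lt i (Ordinal m_gt0)).
rewrite /D mulrC; apply: euclid_dist_le_coord; first by rewrite mulr_ge0 ?ltW.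
move=> c; rewrite (le_trans (ler_normB _ _))//.
by have := u_lt i c; have := u_lt (nb i) c; lra.
Qed.

Let dyadic i L :
  dd i <= D * (2 ^- L + \sum_(l < L) 2 ^- l * (D / (2 ^ l.+1)%:R < dd i)%R%:R).
Proof.
have D0 : 0 <= D.
  by rewrite (le_trans _ (dd_le i))// euclid_dist_ge0.
elim: L => [|L IH]; first by rewrite big_ord0 addr0 expr0 invr1 mulr1 dd_le.
rewrite big_ord_recr/=.
have [h|h] := leP (dd i) (D / (2 ^ L.+1)%:R).
  apply: le_trans h _; rewrite mulr0 addr0.
  rewrite ler_wpM2l// natrX lerDl sumr_ge0//.
apply: (le_trans IH); rewrite ler_wpM2l// mulr1.
have : 0 <= 2 ^- L.+1 :> R by rewrite invr_ge0 exprn_ge0.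
by set s := \sum_(_ < L) _; lra.
Qed.

Let nn_sum_dyadic L : (2 ^ (L * m) <= n)%N ->
  \sum_i dd i <= D * n%:R * 2 ^- L * (1 + 2 ^+ m * L%:R).
Proof.
move=> Ln.
have D0 : 0 <= D.
  have [n0|/card_gt0P[i _]] := posnP #|'I_n|.
    by move: Ln; rewrite card_ord in n0; rewrite n0 leqn0 expn_eq0.
  by rewrite (le_trans _ (dd_le i))// euclid_dist_ge0.
apply: (@le_trans _ _ (\sum_(i < n) D * (2 ^- L +
    \sum_(l < L) 2 ^- l * (D / (2 ^ l.+1)%:R < dd i)%R%:R))).
  by apply: ler_sum => i _; exact: dyadic.
have -> : D * n%:R * 2 ^- L * (1 + 2 ^+ m * L%:R) =
    D * (n%:R * 2 ^- L + n%:R * 2 ^- L * 2 ^+ m * L%:R) by ring.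
rewrite -mulr_sumr ler_wpM2l// big_split/= sumr_const card_ord.
rewrite -[_ *+ n]mulr_natl lerD2l.
rewrite exchange_big/=.
apply: (@le_trans _ _ (\sum_(l < L) 2 ^+ m * (n%:R * 2 ^- L))); last first.
  rewrite sumr_const card_ord -[_ *+ L]mulr_natr.
  by rewrite le_eqVlt; apply/orP; left; apply/eqP; ring.
apply: ler_sum => l _; rewrite -mulr_sumr.
apply: (@le_trans _ _ (2 ^- l * ((2 ^ l.+1) ^ m)%:R)).
  rewrite ler_wpM2l ?invr_ge0 ?exprn_ge0//.
  rewrite -natr_sum ler_nat.
  apply: leq_trans (far_count _); last by rewrite expn_gt0.
  rewrite -sum1_card [leqRHS]big_mkcond/=; apply: leq_sum => i _.
  by rewrite inE; case: (_ < _).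
have lL : (l < L)%N := ltn_ord l.
(* each scale contributes at most as much as the last one, as [m >= 1] *)
have key : (2 ^ L * (2 ^ l.+1) ^ m <= 2 ^ l * (2 ^ m * n))%N.
  have h : (2 ^ L * (2 ^ l.+1) ^ m <= 2 ^ l * (2 ^ m * 2 ^ (L * m)))%N.
    rewrite -expnM -!expnD leq_exp2l//.
    have : (L - l <= (L - l) * m)%N by rewrite leq_pmulr.
    have := ltnW lL; rewrite mulnBl.
    have : (l * m <= L * m)%N by rewrite leq_mul2r ltnW// orbT.
    by rewrite mulSn; lia.
  by apply: leq_trans h _; rewrite !leq_mul2l Ln !orbT.
rewrite -(ler_nat R) !natrM !natrX in key.
rewrite natrX natrX.
have p2 k : 0 < (2 : R) ^+ k by rewrite exprn_gt0.
rewrite mulrC ler_pdivrMr// mulrA mulrAC ler_pdivlMr//.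
by move: key; rewrite mulrC => /le_trans; apply; rewrite mulrC -mulrA.
Qed.

(** There are at most 2^(l m) points with a neighbour at distance of order
    2^-l; summing over the scales above the typical spacing n^(-1/m) loses only
    the number of scales. *)
Lemma nn_sum_le : (0 < n)%N ->
  n%:R^-1 * \sum_i dd i <=
  2 * D * n%:R `^ (- m%:R^-1) * (1 + 2 ^+ m * (2 * ln n%:R)).
Proof.
move=> n0.
have D0 : 0 <= D.
  by rewrite (le_trans _ (dd_le (Ordinal n0)))// euclid_dist_ge0.
have nR0 : 0 < n%:R :> R by rewrite ltr0n.
pose L := (trunc_log 2 n %/ m)%N.
have [Lle Llt] : (2 ^ (L * m) <= n)%N /\ (n < 2 ^ (L.+1 * m))%N.
  split.
    apply: leq_trans (trunc_logP (isT : 1 < 2)%N n0).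
    by rewrite leq_exp2l// leq_trunc_div.
  apply: leq_trans (trunc_log_ltn n (isT : 1 < 2)%N) _.
  by rewrite leq_exp2l// ltn_ceil.
have h := nn_sum_dyadic Lle.
rewrite mulrC ler_pdivrMr//; apply: le_trans h _.
set q := n%:R `^ _; set s := 1 + _ * (_ * _).
have -> : 2 * D * q * s * n%:R = D * n%:R * ((2 * q) * s) by ring.
rewrite -[leLHS]mulrA (ler_wpM2l (mulr_ge0 D0 (ler0n R n)))//; apply: ler_pM.
- by rewrite invr_ge0 exprn_ge0.
- by rewrite addr_ge0// mulr_ge0// exprn_ge0.
- rewrite /q powRN.
  rewrite -[leRHS]mulrC ler_pdivlMl ?powR_gt0//.
  rewrite ler_pdivrMr ?exprn_gt0//.
  rewrite -exprS.
  have -> : (2 : R) ^+ L.+1 = ((2 ^ (L.+1 * m))%:R) `^ (m%:R^-1).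
    rewrite natrX exprM.
    have a0 : 0 <= (2 : R) ^+ L.+1 by rewrite exprn_ge0.
    rewrite -(powR_mulrn m a0) -powRrM.
    by rewrite mulfV ?powRr1// pnatr_eq0 -lt0n.
  apply: ge0_ler_powR; rewrite ?nnegrE ?invr_ge0//.
  by rewrite ler_nat ltnW.
- rewrite /s lerD2l ler_wpM2l ?exprn_ge0//.
  have tl : (L <= trunc_log 2 n)%N by rewrite leq_div.
  apply: (@le_trans _ _ (trunc_log 2 n)%:R); first by rewrite ler_nat.
  have : (trunc_log 2 n)%:R * ln 2 <= ln n%:R :> R.
    rewrite mulr_natl -lnXn// -natrX ler_ln ?posrE ?ltr0n ?expn_gt0// ler_nat.
    exact: trunc_logP.
  have ln2 : 2^-1 <= ln 2 :> R.
    have := @le_ln1Dx R (- 2^-1).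
    have -> : 1 + - 2^-1 = 2^-1 :> R by lra.
    by rewrite lnV ?posrE//; lra.
  have := ler_wpM2l (ler0n R (trunc_log 2 n)) ln2.
  by lra.
Qed.

End nn_sum.

(** * Measurability of finitely valued maps *)

Section finmeas.
Context {d : measure_display} {T : measurableType d}.

Definition finmeas (I : finType) (f : T -> I) : Prop :=
  forall a, measurable [set t | f t = a].

Lemma finmeas_set (I : finType) (f : T -> I) (Q : I -> Prop) :
  finmeas f -> measurable [set t | Q (f t)].
Proof.
move=> mf; have -> : [set t | Q (f t)] = \bigcup_(a in [set a | Q a]) [set t | f t = a].
  apply/seteqP; split => t /=; first by move=> Qt; exists (f t).
  by case=> a /= Qa ->.
by apply: fin_bigcup_measurable; first exact: finite_finset.
Qed.

Lemma finmeas_comp (I J : finType) (f : T -> I) (h : I -> J) :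
  finmeas f -> finmeas (fun t => h (f t)).
Proof. by move=> mf a; exact: (finmeas_set (fun x => h x = a) mf). Qed.

Lemma finmeas_pair (I J : finType) (f : T -> I) (g : T -> J) :
  finmeas f -> finmeas g -> finmeas (fun t => (f t, g t)).
Proof.
move=> mf mg [a b].
have -> : [set t | (f t, g t) = (a, b)] = [set t | f t = a] `&` [set t | g t = b].
  apply/seteqP; split => t /=; first by case=> e1 e2; split.
  by case=> /= -> ->.
exact: measurableI.
Qed.

Lemma finmeas_ffun (I J : finType) (f : I -> T -> J) :
  (forall i, finmeas (f i)) -> finmeas (fun t => [ffun i => f i t]).
Proof.
move=> mf a.
have -> : [set t | [ffun i => f i t] = a] = \bigcap_(i in [set: I]) [set t | f i t = a i].
  apply/seteqP; split => t /=; first by move=> <- i _ /=; rewrite ffunE.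
  by move=> h; apply/ffunP => i; rewrite ffunE; exact: (h i).
by apply: fin_bigcap_measurable => [|i _]; [exact: finite_finset|exact: mf].
Qed.

Lemma finmeas_bool (b : T -> bool) : measurable_fun [set: T] b -> finmeas b.
Proof.
move=> mb a; rewrite -[X in measurable X]setTI.
by rewrite (_ : [set t | b t = a] = b @^-1` [set a])//; exact: mb.
Qed.

Lemma finmeas_pred (I : finType) (f : T -> I) (Q : pred I) :
  finmeas f -> measurable_fun [set: T] (fun t => Q (f t)).
Proof.
move=> mf; apply: (measurable_fun_bool true).
rewrite setTI (_ : _ @^-1` _ = [set t | Q (f t)])//.
exact: (finmeas_set (fun x => Q x) mf).
Qed.

Lemma bmeas_fin {R : realType} (I : finType) (f : T -> I) (F : I -> T -> R) :
  finmeas f -> (forall a, bmeas (F a)) -> bmeas (fun t => F (f t) t).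
Proof.
move=> mf bF.
have -> : (fun t => F (f t) t) = (fun t => \sum_a (f t == a)%:R * F a t).
  apply/funext => t; rewrite (bigD1 (f t))//= eqxx mul1r big1 ?addr0// => a.
  by rewrite eq_sym => /negbTE ->; rewrite mul0r.
apply: bmeas_sum => a _; apply: bmeasM => //; apply: bmeas_bool.
exact: (finmeas_pred (fun x => x == a) mf).
Qed.

End finmeas.

Section measurable_euclid.
Context {R : realType} {d : measure_display} {T : measurableType d} {m : nat}.

Let measurable_sqrt : measurable_fun [set: R] (@Num.sqrt R).
Proof. by apply: continuous_measurable_fun; exact: sqrt_continuous. Qed.

Lemma measurable_euclid_norm (x : T -> m.-tuple R) :
  measurable_fun [set: T] x -> measurable_fun [set: T] (fun t => euclid_norm (x t)).
Proof.
move=> mx; apply: (measurableT_comp measurable_sqrt).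
apply: measurable_sum => c; apply: measurable_funX.
exact: (measurableT_comp (measurable_tnth c) mx).
Qed.

Lemma measurable_euclid_dist (x y : T -> m.-tuple R) :
  measurable_fun [set: T] x -> measurable_fun [set: T] y ->
  measurable_fun [set: T] (fun t => euclid_dist (x t) (y t)).
Proof.
move=> mx my; apply: measurable_euclid_norm; apply/measurable_fun_tnthP => c.
rewrite (_ : _ \o _ = fun t => tnth (x t) c - tnth (y t) c); last first.
  by apply/funext => t /=; rewrite tnth_mktuple.
apply: measurable_funB; first exact: (measurableT_comp (measurable_tnth c) mx).
exact: (measurableT_comp (measurable_tnth c) my).
Qed.

Lemma finmeas_nearest {n : nat} (u : T -> 'I_n -> m.-tuple R) (i : 'I_n) :
  (forall j, measurable_fun [set: T] (fun t => u t j)) ->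
  finmeas (fun t => nearest (u t) i).
Proof.
move=> mu.
pose B t : {ffun 'I_n * 'I_n -> bool} :=
  [ffun kl => euclid_dist (u t i) (u t kl.1) <= euclid_dist (u t i) (u t kl.2)].
have -> : (fun t => nearest (u t) i) = (fun t =>
    [set k | (k != i) && [forall l, (l != i) ==> B t (k, l)]]%SET).
  apply/funext => t; apply/setP => k; rewrite !inE; congr (_ && _).
  by apply: eq_forallb => l; rewrite ffunE.
apply: (finmeas_comp (fun b : {ffun 'I_n * 'I_n -> bool} =>
  [set k | (k != i) && [forall l, (l != i) ==> b (k, l)]]%SET)).
apply: finmeas_ffun => kl; apply: finmeas_bool.
by apply: measurable_fun_ler; exact: measurable_euclid_dist.
Qed.

Lemma bmeas_tie_weight {n : nat} (u : T -> 'I_n -> m.-tuple R) (i l : 'I_n) :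
  (forall j, measurable_fun [set: T] (fun t => u t j)) ->
  bmeas (fun t => tie_weight (u t) i l).
Proof.
move=> mu.
pose F (A : {set 'I_n}) (_ : T) : R := if l \in A then #|A|%:R^-1 else 0.
have bF A : bmeas (F A) by exact: bmeas_cst.
exact: (bmeas_fin (finmeas_nearest i mu) bF).
Qed.

End measurable_euclid.

(** * Pairs of indices with a common neighbour *)

Definition overlap {n : nat} (k : 'I_n -> 'I_n) (i i' : 'I_n) : bool :=
  [|| i == i', k i == i', k i' == i | k i == k i'].

(** Only the coincidence of two neighbours costs anything: its probability for
    distinct indices factorises, and the bound on the in-weights turns the
    resulting double sum into a simple one. *)
Lemma sum_overlap {R : realType} {n : nat} (x : 'I_n -> 'I_n -> R) (B : R) :
  (forall i l, 0 <= x i l) -> (forall i, \sum_l x i l = 1) ->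
  (forall l, \sum_i x i l <= B) ->
  \sum_(k : {ffun 'I_n -> 'I_n}) (\prod_i x i (k i)) *
     \sum_i \sum_i' (overlap k i i')%:R <= (3 + B) * n%:R.
Proof.
move=> x0 x1 xB.
pose w (k : {ffun 'I_n -> 'I_n}) := \prod_i x i (k i).
have w0 k : 0 <= w k by apply: prodr_ge0.
have w1 : \sum_k w k = 1.
  by rewrite -(bigA_distr_bigA x) big1// => i _; exact: x1.
(* the probability that two distinct indices have the same neighbour *)
have pair (i i' : 'I_n) : i != i' ->
    \sum_(k : {ffun 'I_n -> 'I_n}) w k * (k i == k i')%:R = \sum_l x i l * x i' l.
  move=> ii'; have i'i : i' != i by rewrite eq_sym.
  transitivity (\sum_k \sum_l w k * ((k i == l)%:R * (k i' == l)%:R)).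
    apply: eq_bigr => k _; rewrite -mulr_sumr; congr (_ * _).
    rewrite (bigD1 (k i))//= eqxx mul1r big1 ?addr0; first by rewrite eq_sym.
    by move=> l; rewrite eq_sym => /negbTE ->; rewrite mul0r.
  rewrite exchange_big/=; apply: eq_bigr => l _.
  pose y j l' := x j l' * (if (j == i) || (j == i') then (l' == l)%:R else 1).
  transitivity (\sum_(k : {ffun 'I_n -> 'I_n}) \prod_j y j (k j)).
    apply: eq_bigr => k _; rewrite big_split/=; congr (_ * _).
    rewrite (bigD1 i)//= eqxx/=.
    rewrite (bigD1 i')//= eqxx orbT mulrA.
    rewrite big1 ?mulr1// => j /andP[ji ji'].
    by rewrite (negbTE ji) (negbTE ji').
  have ydiag j : (j == i) || (j == i') -> \sum_l' y j l' = x j l.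
    move=> jj; rewrite /y jj (bigD1 l)//= eqxx mulr1 big1 ?addr0//.
    by move=> l' /negbTE ->; rewrite mulr0.
  rewrite -(bigA_distr_bigA y) (bigD1 i)//= [X in _ * X](bigD1 i')//=.
  rewrite !ydiag ?eqxx ?orbT// big1 ?mulr1// => j /andP[ji ji'].
  rewrite /y (negbTE ji) (negbTE ji')/= -[RHS](x1 j).
  by apply: eq_bigr => l' _; rewrite mulr1.
apply: (@le_trans _ _ (\sum_k w k * \sum_i \sum_i' ((i == i')%:R + (k i == i')%:R +
    (k i' == i)%:R + (i != i')%:R * (k i == k i')%:R))).
  apply: ler_sum => k _; apply: (ler_wpM2l (w0 k)).
  apply: ler_sum => i _; apply: ler_sum => i' _; rewrite /overlap.
  rewrite -natrM -!natrD ler_nat.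
  by case: (i == i'); case: (k i == i'); case: (k i' == i); case: (k i == k i').
have -> : \sum_k w k * \sum_i \sum_i' ((i == i')%:R + (k i == i')%:R +
    (k i' == i)%:R + (i != i')%:R * (k i == k i')%:R) =
   3 * n%:R + \sum_(i < n) \sum_(i' < n) (i != i')%:R * \sum_k w k * (k i == k i')%:R.
  transitivity (\sum_k w k * (3 * n%:R) +
    \sum_k w k * \sum_(i < n) \sum_(i' < n) (i != i')%:R * (k i == k i')%:R).
    rewrite -big_split/=; apply: eq_bigr => k _; rewrite -mulrDr; congr (_ * _).
    have -> : 3 * n%:R = n%:R + n%:R + n%:R :> R by ring.
    have sn : \sum_(i < n) (1 : R) = n%:R by rewrite sumr_const card_ord.
    have s1 : \sum_(i < n) \sum_(i' < n) (i == i')%:R = n%:R :> R.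
      by rewrite -[RHS]sn; apply: eq_bigr => i _; exact: sum_diag.
    have s2 : \sum_(i < n) \sum_(i' < n) (k i == i')%:R = n%:R :> R.
      by rewrite -[RHS]sn; apply: eq_bigr => i _; exact: sum_diag.
    have s3 : \sum_(i < n) \sum_(i' < n) (k i' == i)%:R = n%:R :> R.
      by rewrite exchange_big/= -[RHS]sn; apply: eq_bigr => i _; exact: sum_diag.
    rewrite -{1}s1 -{1}s2 -{1}s3 -!big_split/=; apply: eq_bigr => i _.
    by rewrite -!big_split.
  rewrite -mulr_suml w1 mul1r; congr (_ + _).
  under eq_bigr => k _ do rewrite mulr_sumr.
  rewrite exchange_big/=; apply: eq_bigr => i _.
  under eq_bigr => k _ do rewrite mulr_sumr.
  rewrite exchange_big/=; apply: eq_bigr => i' _.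
  by rewrite mulr_sumr; apply: eq_bigr => k _; rewrite mulrCA.
rewrite [(3 + B) * _]mulrDl lerD2l.
apply: (@le_trans _ _ (\sum_(i < n) \sum_(i' < n) \sum_l x i l * x i' l)).
  apply: ler_sum => i _; apply: ler_sum => i' _.
  have [->|ii'] := eqVneq i i'.
    by rewrite mul0r sumr_ge0// => l _; rewrite mulr_ge0.
  by rewrite mul1r pair.
have -> : \sum_(i < n) \sum_(i' < n) \sum_l x i l * x i' l =
    \sum_l (\sum_i x i l) * (\sum_i x i l).
  under eq_bigr => i _ do rewrite exchange_big/=.
  rewrite exchange_big/=; apply: eq_bigr => l _.
  by rewrite mulr_suml; apply: eq_bigr => i _; rewrite mulr_sumr.
have sxn : \sum_l \sum_i x i l = n%:R.
  rewrite exchange_big/=; under eq_bigr => i _ do rewrite x1.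
  by rewrite sumr_const card_ord.
rewrite -sxn mulr_sumr; apply: ler_sum => l _.
by rewrite ler_wpM2r// sumr_ge0.
Qed.

(** * The nearest neighbour average around its conditional mean *)

Section neighbour_average.
Context {R : realType} {d dE : measure_display}.
Context {T : measurableType d} {E : measurableType dE}.
Variables (P : probability T R) (V : nat -> T -> R * E) (mu : probability (R * E)%type R).
Hypothesis mV : forall i, measurable_fun [set: T] (V i).
Hypothesis indep : mutually_independent P V.
Hypothesis law : forall i A, measurable A -> P (V i @^-1` A) = mu A.
(* [G c t] is the conditional probability that the response is at least [t] *)
Variable G : E -> R -> R.
Hypothesis mG : measurable_fun [set: E * R] (fun x => G x.1 x.2).
Hypothesis G01 : forall e s, 0 <= G e s <= 1.
Hypothesis condG : forall s (f : E -> R), bmeas f ->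
  mean mu (fun v => (s <= v.1)%R%:R * f v.2) = mean mu (fun v => G v.2 s * f v.2).
Variable n : nat.
Hypothesis n_gt1 : (1 < n)%N.

Notation tup := (n.-tuple (R * E)%type).
Let smp : T -> tup := @sample _ _ T (R * E)%type V n.
Let msmp : measurable_fun [set: T] smp := measurable_sample mV (n := n).

Definition above (i j : 'I_n) (t : tup) : R := ((tnth t j).1 <= (tnth t i).1)%R%:R.
Definition tail (i j : 'I_n) (t : tup) : R := G (tnth t i).2 (tnth t j).1.

Lemma bmeas_above i j : bmeas (above i j).
Proof.
apply: bmeas_bool; apply: measurable_fun_ler.
  exact: (measurableT_comp measurable_fst (measurable_tnth j)).
exact: (measurableT_comp measurable_fst (measurable_tnth i)).
Qed.

Lemma above01 i j t : 0 <= above i j t <= 1.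
Proof. by rewrite /above ler0n lern1 leq_b1. Qed.

Lemma tail01 i j t : 0 <= tail i j t <= 1.
Proof. exact: G01. Qed.

Lemma bmeas_tail i j : bmeas (tail i j).
Proof.
apply: bmeas_le1; last exact: tail01.
apply: (measurableT_comp (f := fun x : E * R => G x.1 x.2)
  (g := fun t : tup => ((tnth t i).2, (tnth t j).1))) => //.
apply/measurable_fun_pairP; split.
  exact: (measurableT_comp measurable_snd (measurable_tnth i)).
exact: (measurableT_comp measurable_fst (measurable_tnth j)).
Qed.

Definition response_free (i : 'I_n) (psi : tup -> R) : Prop :=
  forall t y, psi (upd t i (y, (tnth t i).2)) = psi t.

Lemma response_freeM i psi phi : response_free i psi -> response_free i phi ->
  response_free i (fun t => psi t * phi t).
Proof. by move=> fp fq t y; rewrite fp fq. Qed.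

Lemma response_freeB i psi phi : response_free i psi -> response_free i phi ->
  response_free i (fun t => psi t - phi t).
Proof. by move=> fp fq t y; rewrite fp fq. Qed.

Lemma response_free_above i l j : l != i -> j != i -> response_free i (above l j).
Proof. by move=> li ji t y; rewrite /above !tnth_upd (negbTE li) (negbTE ji). Qed.

Lemma response_free_tail i l j : j != i -> response_free i (tail l j).
Proof.
move=> ji t y; rewrite /tail !tnth_upd (negbTE ji).
by have [->|//] := eqVneq l i.
Qed.

(** The factor [psi] may depend on everything but the [i]-th response, so that this
    response alone is integrated out and its exceedance indicator is replaced by
    the conditional mean. *)
Lemma swap_response (i j : 'I_n) (psi : tup -> R) : j != i ->
  bmeas psi -> response_free i psi ->
  mean P (fun w => above i j (smp w) * psi (smp w)) =
  mean P (fun w => tail i j (smp w) * psi (smp w)).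
Proof.
move=> ji bpsi freei.
rewrite (resample mV indep law i (bmeasM (bmeas_above i j) bpsi)).
rewrite (resample mV indep law i (bmeasM (bmeas_tail i j) bpsi)).
apply: eq_mean => w; set t := sample _ _ _.
have bf : bmeas (fun e => psi (upd t i (0, e))).
  apply: (bmeas_comp (phi := fun e => upd t i (0, e)) _ bpsi).
  apply: (measurableT_comp (f := fun x : tup * (R * E) => upd x.1 i x.2)
    (g := fun e => (t, (0, e)))); first exact: measurable_upd.
  by apply: measurable_fun_pair => //; exact: pair1_measurable.
have psiE v : psi (upd t i v) = psi (upd t i (0, v.2)).
  rewrite -(freei (upd t i v) 0); congr psi; apply: eq_from_tnth => l.
  by rewrite !tnth_upd eqxx; case: eqP.
under eq_mean => v do rewrite /above !tnth_upd eqxx (negbTE ji) psiE.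
under [in RHS]eq_mean => v do rewrite /tail !tnth_upd eqxx (negbTE ji) psiE.
exact: (condG (tnth t j).1 bf).
Qed.

(** This makes covariances vanish: [psi] will be the product of the term of another
    pair of indices with the weight of a choice of neighbours, which depends on
    the covariates only. *)
Lemma swap_pair (i l j : 'I_n) (psi : tup -> R) : j != i -> j != l -> i != l ->
  bmeas psi -> response_free i psi -> response_free l psi ->
  mean P (fun w => (above i j (smp w) * above l j (smp w) -
                    tail i j (smp w) * tail l j (smp w)) * psi (smp w)) = 0.
Proof.
move=> ji jl il bpsi fi fl.
have ba k := bmeas_comp msmp (bmeas_above k j).
have bt k := bmeas_comp msmp (bmeas_tail k j).
have bp := bmeas_comp msmp bpsi.
under eq_mean do rewrite mulrBl.
rewrite meanB; [|by apply: bmeasM => //; exact: bmeasM|by apply: bmeasM => //; exact: bmeasM].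
apply/eqP; rewrite subr_eq0; apply/eqP.
transitivity (mean P (fun w => tail i j (smp w) * (above l j (smp w) * psi (smp w)))).
  under eq_mean do rewrite -mulrA.
  apply: (@swap_response i j (fun t => above l j t * psi t)) => //.
    by apply: bmeasM => //; exact: bmeas_above.
  by apply: response_freeM => //; apply: response_free_above; rewrite // eq_sym.
under eq_mean do rewrite mulrCA.
under [in RHS]eq_mean do rewrite -mulrA mulrCA.
apply: (@swap_response l j (fun t => tail i j t * psi t)) => //.
  by apply: bmeasM => //; exact: bmeas_tail.
by apply: response_freeM => //; exact: response_free_tail.
Qed.

Variables (m : nat) (emb : E -> m.-tuple R).
Hypothesis memb : measurable_fun [set: E] emb.
Variable N : 'I_n -> T -> 'I_n.
Hypothesis tie : uniform_tie_breaking P smp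
  (fun w => nearest (fun j : 'I_n => emb (V j w).2)) N.

Definition choice_weight (k : {ffun 'I_n -> 'I_n}) (t : tup) : R :=
  \prod_i tie_weight (fun j => emb (tnth t j).2) i (k i).

Definition choice_of (w : T) : {ffun 'I_n -> 'I_n} := [ffun i => N i w].

Lemma choice_weight_ge0 k t : 0 <= choice_weight k t.
Proof. by apply: prodr_ge0 => i _; exact: tie_weight_ge0. Qed.

Lemma bmeas_choice_weight k : bmeas (choice_weight k).
Proof.
apply: bmeas_prod => i _.
apply: (bmeas_tie_weight (u := fun (t : tup) j => emb (tnth t j).2)) => j.
exact: (measurableT_comp memb (measurableT_comp measurable_snd (measurable_tnth j))).
Qed.

Lemma response_free_weight i k : response_free i (choice_weight k).
Proof.
move=> t y; rewrite /choice_weight; apply: eq_bigr => l _; congr tie_weight.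
by apply/funext => j; rewrite tnth_upd; case: eqP => [->|].
Qed.

Lemma finmeas_choice : finmeas choice_of.
Proof. by apply: finmeas_ffun => i a; case: tie. Qed.

(** Given the sample, the choice of neighbours has the product of the tie weights
    as its law. *)
Lemma mean_choice (k : {ffun 'I_n -> 'I_n}) (F : tup -> R) : bmeas F ->
  mean P (fun w => F (smp w) * (choice_of w == k)%:R) =
  mean P (fun w => F (smp w) * choice_weight k (smp w)).
Proof.
move=> bF.
have mk : measurable_fun [set: T] (fun w => choice_of w == k).
  exact: (finmeas_pred (fun x => x == k) finmeas_choice).
apply: (weight_transfer msmp (phi1 := fun w => (choice_of w == k)%:R)
  (phi2 := fun w => choice_weight k (smp w))) => //.
- exact: bmeas_bool.
- exact: (bmeas_comp msmp (bmeas_choice_weight k)).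
- by move=> w; exact: choice_weight_ge0.
move=> A mA; have [_ /(_ A k mA)] := tie.
have msA : measurable (smp @^-1` A) by rewrite -[X in measurable X]setTI; exact: msmp.
have -> : smp @^-1` A `&` [set w | forall i, N i w = k i] =
    [set w | choice_of w == k] `&` smp @^-1` A.
  rewrite setIC; congr (_ `&` _); apply/seteqP; split => w /=.
    by move=> h; apply/eqP/ffunP => i; rewrite ffunE.
  by move=> /eqP <- i; rewrite ffunE.
have e0 : (\int[P]_(w in smp @^-1` A) (\1_[set w | choice_of w == k] w)%:E =
    P ([set w | choice_of w == k] `&` smp @^-1` A))%E.
  by apply: integral_indic => //; exact: measurable_boolset.
have e1 : (\int[P]_(w in smp @^-1` A) (\1_[set w | choice_of w == k] w)%:E =
    \int[P]_(w in smp @^-1` A) (choice_of w == k)%:R%:E)%E.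
  apply: eq_integral => w _; rewrite indicE; congr (nat_of_bool _)%:R%:E.
  by apply/idP/idP => [/set_mem|h]//; exact/mem_set.
rewrite -e0 e1 => ->; apply: eq_integral => w _; congr EFin.
apply: eq_bigr => i _; rewrite /tie_weight.
have -> : (fun j => emb (tnth (smp w) j).2) = (fun j : 'I_n => emb (V j w).2).
  by apply/funext => j; rewrite tnth_mktuple.
by [].
Qed.

Definition proper_choice (k : {ffun 'I_n -> 'I_n}) (t : tup) : bool :=
  [forall i, k i \in nearest (fun j => emb (tnth t j).2) i].

Lemma finmeas_proper_choice k : finmeas (proper_choice k).
Proof.
pose h (A : {ffun 'I_n -> {set 'I_n}}) := [forall i, k i \in A i].
have -> : proper_choice k = (fun t : tup =>
    h [ffun i => nearest (fun j => emb (tnth t j).2) i]).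
  by apply/funext => t; apply: eq_forallb => i; rewrite ffunE.
apply: finmeas_comp; apply: finmeas_ffun => i.
apply: (finmeas_nearest (u := fun (t : tup) j => emb (tnth t j).2)) => j.
exact: (measurableT_comp memb (measurableT_comp measurable_snd (measurable_tnth j))).
Qed.

Lemma finmeas_proper : finmeas (fun w => proper_choice (choice_of w) (smp w)).
Proof.
apply: finmeas_bool.
have m1 : finmeas (fun w => [ffun k => proper_choice k (smp w)]).
  apply: finmeas_ffun => k a; rewrite -[X in measurable X]setTI.
  exact: (msmp measurableT (finmeas_proper_choice k a)).
have -> : (fun w => proper_choice (choice_of w) (smp w)) = (fun w =>
    (fun x : {ffun {ffun 'I_n -> 'I_n} -> bool} * {ffun 'I_n -> 'I_n} => x.1 x.2)
      ([ffun k => proper_choice k (smp w)], choice_of w)).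
  by apply/funext => w /=; rewrite ffunE.
exact: (finmeas_pred (fun x : {ffun {ffun 'I_n -> 'I_n} -> bool} *
  {ffun 'I_n -> 'I_n} => x.1 x.2) (finmeas_pair m1 finmeas_choice)).
Qed.

(** A choice that is not a nearest neighbour for some index has weight 0. *)
Lemma choice_proper : P [set w | ~~ proper_choice (choice_of w) (smp w)] = 0%E.
Proof.
have mb : measurable_fun [set: T] (fun w => ~~ proper_choice (choice_of w) (smp w)).
  exact: (finmeas_pred (fun b => ~~ b) finmeas_proper).
rewrite -(mean_bool P mb); congr EFin.
have bp k : bmeas (fun t => (~~ proper_choice k t)%:R : R).
  apply: bmeas_bool; exact: (finmeas_pred (fun b => ~~ b) (finmeas_proper_choice k)).
have -> : (fun w => (~~ proper_choice (choice_of w) (smp w))%:R : R) =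
    (fun w => \sum_k (~~ proper_choice k (smp w))%:R * (choice_of w == k)%:R).
  apply/funext => w; rewrite (bigD1 (choice_of w))//= eqxx mulr1 big1 ?addr0//.
  by move=> k; rewrite eq_sym => /negbTE ->; rewrite mulr0.
rewrite mean_sum; last first.
  move=> k _; apply: bmeasM; first exact: (bmeas_comp msmp (bp k)).
  by apply: bmeas_bool; exact: (finmeas_pred (fun x => x == k) finmeas_choice).
rewrite big1// => k _; rewrite (mean_choice k (bp k)).
rewrite -[RHS](mean_cst P 0); apply: eq_mean => w.
have [|/forallPn[i ki]] := boolP (proper_choice k (smp w)); first by rewrite mul0r.
by rewrite /choice_weight (bigD1 i)//= /tie_weight (negbTE ki) mul0r mulr0.
Qed.

Definition fluct (j : 'I_n) (k : {ffun 'I_n -> 'I_n}) (t : tup) : R :=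
  \sum_(i | (i != j) && (k i != j))
    (above i j t * above (k i) j t - tail i j t * tail (k i) j t).

Let delta j (k : {ffun 'I_n -> 'I_n}) i t : R :=
  above i j t * above (k i) j t - tail i j t * tail (k i) j t.

Let bmeas_delta j k i : bmeas (delta j k i).
Proof.
by apply: bmeasB; apply: bmeasM; first [exact: bmeas_above | exact: bmeas_tail].
Qed.

Let delta_le1 j k i t : `|delta j k i t| <= 1.
Proof.
have /andP[h1 h2] := tail01 i j t; have /andP[h3 h4] := tail01 (k i) j t.
have /andP[h5 h6] : 0 <= tail i j t * tail (k i) j t <= 1.
  by rewrite mulr_ge0//= mulr_ile1.
have /andP[g1 g2] := above01 i j t; have /andP[g3 g4] := above01 (k i) j t.
have /andP[g5 g6] : 0 <= above i j t * above (k i) j t <= 1.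
  by rewrite mulr_ge0//= mulr_ile1.
by rewrite /delta ler_norml; apply/andP; split; lra.
Qed.

Let mean_delta (j : 'I_n) (k : {ffun 'I_n -> 'I_n}) (i i' : 'I_n) : i != j -> k i != j -> i' != j -> k i' != j ->
  mean P (fun w => delta j k i (smp w) * delta j k i' (smp w) * choice_weight k (smp w))
  <= (overlap k i i')%:R * mean P (fun w => choice_weight k (smp w)).
Proof.
move=> ij kij i'j ki'j.
have bw := bmeas_comp msmp (bmeas_choice_weight k).
have bdl l := bmeas_comp msmp (bmeas_delta j k l).
have [_|] := boolP (overlap k i i').
  rewrite mul1r; apply: le_mean => //; first by apply: bmeasM => //; exact: bmeasM.
  move=> w; rewrite -[leRHS]mul1r ler_wpM2r ?choice_weight_ge0//.
  by rewrite (le_trans (ler_norm _))// normrM mulr_ile1.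
rewrite /overlap !negb_or => /and4P[ii' kii' ki'i kk'].
rewrite mul0r.
have [kii|kii] := eqVneq (k i) i.
  rewrite (_ : mean _ _ = 0)//.
  rewrite -[RHS](mean_cst P 0); apply: eq_mean => w.
  rewrite /choice_weight (bigD1 i)//= /tie_weight kii.
  by rewrite inE eqxx /= mul0r mulr0.
rewrite (_ : mean _ _ = 0)//.
under eq_mean do rewrite -mulrA.
apply: (@swap_pair i (k i) j (fun t => delta j k i' t * choice_weight k t)).
- by rewrite eq_sym.
- by rewrite eq_sym.
- by rewrite eq_sym.
- by apply: bmeasM => //; exact: bmeas_choice_weight.
- apply: response_freeM; last exact: response_free_weight.
  apply: response_freeB; apply: response_freeM.
  + by apply: response_free_above; rewrite eq_sym.
  + by apply: response_free_above; rewrite // eq_sym.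
  + by apply: response_free_tail; rewrite eq_sym.
  + by apply: response_free_tail; rewrite eq_sym.
- apply: response_freeM; last exact: response_free_weight.
  apply: response_freeB; apply: response_freeM.
  + by apply: response_free_above; rewrite eq_sym.
  + by apply: response_free_above; rewrite // eq_sym.
  + by apply: response_free_tail; rewrite eq_sym.
  + by apply: response_free_tail; rewrite eq_sym.
Qed.

Lemma bmeas_fluct j k : bmeas (fluct j k).
Proof. by apply: bmeas_sum => i _; exact: bmeas_delta. Qed.

Let B : R := 1 + (cone_count (m := m))%:R.

Let mean_fluct_sq j :
  mean P (fun w => fluct j (choice_of w) (smp w) ^+ 2) <= (3 + B) * n%:R.
Proof.
have bw k := bmeas_comp msmp (bmeas_choice_weight k).
have bf k := bmeas_comp msmp (bmeas_fluct j k).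
have bdl k l := bmeas_comp msmp (bmeas_delta j k l).
have -> : (fun w => fluct j (choice_of w) (smp w) ^+ 2) =
    (fun w => \sum_k fluct j k (smp w) ^+ 2 * (choice_of w == k)%:R).
  apply/funext => w; rewrite (bigD1 (choice_of w))//= eqxx mulr1 big1 ?addr0//.
  by move=> k; rewrite eq_sym => /negbTE ->; rewrite mulr0.
have bind k : bmeas (fun w => (choice_of w == k)%:R : R).
  by apply: bmeas_bool; exact: (finmeas_pred (fun x => x == k) finmeas_choice).
rewrite mean_sum; last by move=> k _; apply: bmeasM => //; exact: bmeasX.
under eq_bigr => k _ do
  rewrite (mean_choice k (F := fun t => fluct j k t ^+ 2) (bmeasX _ (bmeas_fluct j k))).
apply: (@le_trans _ _ (\sum_(k : {ffun 'I_n -> 'I_n}) mean P (fun w =>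
    choice_weight k (smp w) * \sum_i \sum_i' (overlap k i i')%:R))).
  apply: ler_sum => k _.
  have -> : (fun w => fluct j k (smp w) ^+ 2 * choice_weight k (smp w)) =
     (fun w => \sum_(i | (i != j) && (k i != j)) \sum_(i' | (i' != j) && (k i' != j))
        delta j k i (smp w) * delta j k i' (smp w) * choice_weight k (smp w)).
    apply/funext => w; rewrite expr2 mulr_suml mulr_suml; apply: eq_bigr => i _.
    by rewrite mulr_sumr mulr_suml.
  rewrite mean_sum; last by move=> i _; apply: bmeas_sum => i' _; apply: bmeasM => //; exact: bmeasM.
  have -> : mean P (fun w => choice_weight k (smp w) * \sum_i \sum_i' (overlap k i i')%:R) =
      \sum_i \sum_i' (overlap k i i')%:R * mean P (fun w => choice_weight k (smp w)).
    under eq_mean do rewrite mulrC.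
    by rewrite meanZ// mulr_suml; apply: eq_bigr => i _; rewrite mulr_suml.
  have w0 : 0 <= mean P (fun w => choice_weight k (smp w)).
    by apply: mean_ge0 => w; exact: choice_weight_ge0.
  rewrite big_mkcond/=; apply: ler_sum => i _; case: ifPn => [/andP[ij kij]|_]; last first.
    by apply: sumr_ge0 => i' _; rewrite mulr_ge0.
  rewrite mean_sum; last by move=> i' _; apply: bmeasM => //; exact: bmeasM.
  rewrite big_mkcond/=; apply: ler_sum => i' _; case: ifPn => [/andP[i'j ki'j]|_]; last first.
    by rewrite mulr_ge0.
  exact: mean_delta.
rewrite -mean_sum; last by move=> k _; apply: bmeasM => //; exact: bmeas_cst.
rewrite -[leRHS](mean_cst P); apply: le_mean; [|exact: bmeas_cst|].
  by apply: bmeas_sum => k _; apply: bmeasM => //; exact: bmeas_cst.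
move=> w; apply: sum_overlap => [i l|i|l].
- exact: tie_weight_ge0.
- exact: sum_tie_weight.
- exact: sum_tie_weight_in.
Qed.

Definition mean_fluct (w : T) : R :=
  n%:R ^- 2 * \sum_j fluct j (choice_of w) (smp w).

Lemma bmeas_mean_fluct : bmeas mean_fluct.
Proof.
apply: bmeasM; first exact: bmeas_cst.
apply: bmeas_sum => j _.
apply: (bmeas_fin (F := fun k w => fluct j k (smp w)) finmeas_choice) => k.
exact: (bmeas_comp msmp (bmeas_fluct j k)).
Qed.

(** The outer average over the threshold index [j] goes through Cauchy-Schwarz.  For
    a fixed [j], the terms with disjoint pairs {i, k i} are uncorrelated under the
    weight of the choice [k], and on average O(n) pairs meet. *)
Lemma mean_fluct_second_moment :
  mean P (fun w => mean_fluct w ^+ 2) <= (3 + B) / n%:R.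
Proof.
have n0 : 0 < n%:R :> R by rewrite ltr0n (ltn_trans _ n_gt1).
have bfl j : bmeas (fun w => fluct j (choice_of w) (smp w)).
  apply: (bmeas_fin (F := fun k w => fluct j k (smp w)) finmeas_choice) => k.
  exact: (bmeas_comp msmp (bmeas_fluct j k)).
apply: (@le_trans _ _ (mean P (fun w => n%:R ^- 4 *
    (n%:R * \sum_j fluct j (choice_of w) (smp w) ^+ 2)))).
  apply: le_mean.
  - by apply: bmeasX; exact: bmeas_mean_fluct.
  - apply: bmeasM; first exact: bmeas_cst.
    apply: bmeasM; first exact: bmeas_cst.
    by apply: bmeas_sum => j _; exact: bmeasX.
  move=> w; rewrite /mean_fluct exprMn -exprVn -exprM exprVn ler_wpM2l//.
  by rewrite -[X in X%:R * _](card_ord n); exact: sqr_sum_le.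
rewrite meanZ; last first.
  apply: bmeasM; first exact: bmeas_cst.
  by apply: bmeas_sum => j _; exact: bmeasX.
rewrite meanZ; last by apply: bmeas_sum => j _; exact: bmeasX.
rewrite mean_sum; last by move=> j _; exact: bmeasX.
apply: (@le_trans _ _ (n%:R ^- 4 * (n%:R * (n%:R * ((3 + B) * n%:R))))).
  rewrite ler_wpM2l ?invr_ge0 ?exprn_ge0// ler_wpM2l//.
  rewrite [leRHS]mulr_natl -[X in _ *+ X](card_ord n) -sumr_const.
  by apply: ler_sum => j _; exact: mean_fluct_sq.
rewrite le_eqVlt; apply/orP; left; apply/eqP; field.
by rewrite gt_eqF.
Qed.

(** The terms in which the threshold is one of the two responses are left out of
    the fluctuation; there are at most two of them for each index [i]. *)
Lemma neighbour_average_decomp (w : T) (dl : 'I_n -> R) :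
  (forall (i : 'I_n) s, `|G (V i w).2 s - G (V (N i w) w).2 s| <= dl i) ->
  `|n%:R ^- 2 * \sum_i \sum_j (above i j (smp w) * above (N i w) j (smp w))
    - n%:R ^- 2 * \sum_i \sum_j tail i j (smp w) ^+ 2 - mean_fluct w|
  <= 2 / n%:R + n%:R^-1 * \sum_i dl i.
Proof.
move=> dlP; set t := smp w.
have n0 : 0 < n%:R :> R by rewrite ltr0n (ltn_trans _ n_gt1).
have a01 i j := above01 i j t.
have t01 i j := tail01 i j t.
rewrite /mean_fluct -/t -!mulrBr normrM ger0_norm ?invr_ge0 ?exprn_ge0//.
rewrite mulrC ler_pdivrMr ?exprn_gt0//.
have -> : (2 / n%:R + n%:R^-1 * \sum_i dl i) * n%:R ^+ 2 =
    2 * n%:R + n%:R * \sum_i dl i by field; rewrite gt_eqF.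
have -> : \sum_j fluct j (choice_of w) t = \sum_i \sum_j
    (if (i != j) && (N i w != j) then delta j (choice_of w) i t else 0).
  rewrite exchange_big/=; apply: eq_bigr => j _; rewrite /fluct big_mkcond/=.
  by apply: eq_bigr => i _; rewrite /delta !ffunE.
rewrite -!sumrB.
apply: (@le_trans _ _ (\sum_i \sum_j ((i == j)%:R + (N i w == j)%:R + dl i))); last first.
  rewrite le_eqVlt; apply/orP; left; apply/eqP.
  under eq_bigr => i _ do rewrite !big_split/= !sum_diag sumr_const card_ord.
  rewrite !big_split/= !sumr_const card_ord sumrMnl -[_ *+ n]mulr_natl.
  by rewrite -[(\sum_i dl i) *+ n]mulr_natl; ring.
apply: le_trans (ler_norm_sum _ _ _) _; apply: ler_sum => i _.
rewrite -!sumrB; apply: le_trans (ler_norm_sum _ _ _) _; apply: ler_sum => j _.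
have /andP[x0 x1] := a01 i j; have /andP[y0 y1] := a01 (N i w) j.
have /andP[p0 p1] := t01 i j; have /andP[q0 q1] := t01 (N i w) j.
have /andP[xy0 xy1] : 0 <= above i j t * above (N i w) j t <= 1.
  by rewrite mulr_ge0//= mulr_ile1.
have /andP[pq0 pq1] : 0 <= tail i j t ^+ 2 <= 1.
  by rewrite sqr_ge0/= expr_le1.
have pd : `|tail i j t - tail (N i w) j t| <= dl i.
  by rewrite /tail /t !tnth_mktuple; exact: dlP.
have dl0 : 0 <= dl i by apply: le_trans pd.
have [/andP[ij kij]|] := boolP ((i != j) && (N i w != j)).
  rewrite (negbTE ij) (negbTE kij) !add0r /delta ffunE.
  have -> : above i j t * above (N i w) j t - tail i j t ^+ 2 -
     (above i j t * above (N i w) j t - tail i j t * tail (N i w) j t) =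
     - (tail i j t * (tail i j t - tail (N i w) j t)) by ring.
  rewrite normrN normrM (ger0_norm p0).
  by rewrite (le_trans _ pd)// ler_piMl.
rewrite negb_and !negbK => h.
have : 1 <= (i == j)%:R + (N i w == j)%:R :> R.
  by rewrite -natrD ler1n; case/orP: h => ->; rewrite ?addn1.
by rewrite subr0 ler_norml => h1; apply/andP; split; lra.
Qed.

End neighbour_average.

(** * Conditional expectations and conditional tails *)

Lemma mean_distribution {R : realType} {d d'} {T : measurableType d}
    {E : measurableType d'} (P : probability T R) (U : {mfun T >-> E}) (f : E -> R) :
  bmeas f -> mean (distribution P U) f = mean P (fun w => f (U w)).
Proof.
move=> bf; rewrite /mean /Rintegral integral_distribution//.
  by apply/measurable_EFinP; case: bf.
exact: (bmeas_integrable P (bmeas_comp (f := f) (phi := U) _ bf)).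
Qed.

Section cond_tail.
Context {R : realType} {dE : measure_display} {E : measurableType dE}.
Variable K : R.-pker E ~> R.

Let kernel_le1 u t : (K u `[t, +oo[%classic <= 1)%E.
Proof. by rewrite -(prob_kernel (s := K) u); apply: le_measure; rewrite ?inE. Qed.

Lemma cond_tailE u t : (cond_tail K u t)%:E = K u `[t, +oo[%classic.
Proof.
rewrite /cond_tail fineK// ge0_fin_numE//.
exact: le_lt_trans (kernel_le1 u t) (ltry _).
Qed.

Lemma cond_tail01 u t : 0 <= cond_tail K u t <= 1.
Proof. by rewrite -!lee_fin cond_tailE measure_ge0/= kernel_le1. Qed.

(* Joint measurability in the level: the indicator of exceedance, as a function
   of the point, the level and the response, is integrated against a kernel on
   the product that ignores the level. *)
Let K' : E * R -> {measure set R -> \bar R} := fun x => K x.1.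

Let measurable_K' U : measurable U -> measurable_fun [set: E * R] (K' ^~ U).
Proof.
move=> mU; apply: (measurableT_comp (f := K ^~ U) (g := fst)) => //.
exact: measurable_kernel.
Qed.

HB.instance Definition _ := isKernel.Build _ _ _ _ _ K' measurable_K'.

Let K'_prob x : K' x [set: R] = 1%E.
Proof. exact: prob_kernel. Qed.

HB.instance Definition _ := Kernel_isProbability.Build _ _ _ _ _ K' K'_prob.

Lemma measurable_cond_tail : measurable_fun [set: E * R] (fun x => cond_tail K x.1 x.2).
Proof.
pose f (x : E * R * R) : \bar R := ((x.1.2 <= x.2)%R%:R : R)%:E.
have -> : (fun x => cond_tail K x.1 x.2) =
    (fun x => fine (\int[K' x]_y f (x, y))%E).
  apply/funext => -[u t] /=; congr fine.
  rewrite -[X in K u X]setIT -integral_indic//; apply: eq_integral => y _.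
  rewrite indicE /f/=; congr (nat_of_bool _)%:R%:E.
  by apply/idP/idP => [/set_mem/=|h]; [rewrite in_itv/= andbT|apply/mem_set; rewrite /= in_itv/= h].
apply: measurableT_comp => //.
apply: (measurable_fun_integral_finite_kernel f K').
  by move=> z; rewrite /f lee_fin.
apply/measurable_EFinP.
have [] // := bmeas_bool (R := R) (b := fun x : E * R * R => x.1.2 <= x.2) _.
apply: measurable_fun_ler => //.
exact: (measurableT_comp measurable_snd measurable_fst).
Qed.

Lemma bmeas_cond_tail t : bmeas (fun u => cond_tail K u t).
Proof.
apply: bmeas_le1; last by move=> u; exact: cond_tail01.
exact: (measurable_fun_pair1 t measurable_cond_tail).
Qed.

Context {d : measure_display} {T : measurableType d} (P : probability T R).
Variables (U : T -> E) (Y : T -> R).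
Hypotheses (mU : measurable_fun [set: T] U) (mY : measurable_fun [set: T] Y).
Hypothesis version : regular_cond_distribution P U Y K.

Lemma bmeas_reach t : bmeas (fun w => (t <= Y w)%R%:R : R).
Proof. by apply: bmeas_bool; exact: measurable_fun_ler. Qed.

Lemma bmeas_cond_tailU t : bmeas (fun w => cond_tail K (U w) t).
Proof. exact: (bmeas_comp mU (bmeas_cond_tail t)). Qed.

Lemma cond_tail_integral t (A : set E) : measurable A ->
  (\int[P]_(w in U @^-1` A) ((t <= Y w)%R%:R : R)%:E =
   \int[P]_(w in U @^-1` A) (cond_tail K (U w) t)%:E)%E.
Proof.
move=> mA.
have mUA : measurable (U @^-1` A) by rewrite -[X in measurable X]setTI; exact: mU.
have mYt : measurable (Y @^-1` `[t, +oo[%classic).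
  by rewrite -[X in measurable X]setTI; exact: mY.
under [RHS]eq_integral do rewrite cond_tailE.
rewrite -version// setIC.
have <- : (\int[P]_(w in U @^-1` A) (\1_(Y @^-1` `[t, +oo[%classic) w)%:E =
   P (Y @^-1` `[t, +oo[%classic `&` U @^-1` A))%E by exact: integral_indic.
apply: eq_integral => w _; rewrite indicE; congr (nat_of_bool _)%:R%:E.
by apply/idP/idP => [h|/set_mem/=]; [apply/mem_set; rewrite /= in_itv/= h|rewrite /= in_itv/= andbT].
Qed.

Lemma mean_cond_tail t (f : E -> R) : bmeas f ->
  mean P (fun w => (t <= Y w)%R%:R * f (U w)) =
  mean P (fun w => cond_tail K (U w) t * f (U w)).
Proof.
move=> bf; under eq_mean do rewrite mulrC.
under [in RHS]eq_mean do rewrite mulrC.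
apply: (weight_transfer mU (phi1 := fun w => (t <= Y w)%R%:R)
  (phi2 := fun w => cond_tail K (U w) t)) => //.
- exact: bmeas_reach.
- exact: bmeas_cond_tailU.
- by move=> w; have /andP[] := cond_tail01 (U w) t.
- by move=> A mA; exact: cond_tail_integral.
Qed.

End cond_tail.

Section cond_expectation.
Context {R : realType} {d dE : measure_display}.
Context {T : measurableType d} {E : measurableType dE}.
Variables (P : probability T R) (U : {mfun T >-> E}).

Let mUA A : measurable A -> measurable (U @^-1` A).
Proof. by move=> mA; rewrite -[X in measurable X]setTI; exact: (measurable_funP U). Qed.

(** A version is the Radon-Nikodym derivative, on the space of values of [U], of the
    image of the charge with density [W]. *)
Lemma cond_expectation_exists (W : T -> R) :
  P.-integrable [set: T] (EFin \o W) -> exists h, is_cond_expectation P U W h.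
Proof.
move=> intW.
pose nu' : {charge set E -> \bar R} :=
  pushforward (induced_charge intW) U.
pose nu := nu' (measurable_funP U).
have nuP : nu `<< distribution P U.
  apply/null_content_dominatesP => A mA PA0.
  rewrite /nu/= /pushforward /induced_charge; apply: null_set_integral => //.
  - exact: mUA.
  - by apply: measurable_funTS; exact: measurable_int intW.
pose f := Radon_Nikodym nu (distribution P U).
have ffin e : f e \is a fin_num by exact: Radon_Nikodym_fin_num.
have intf : (distribution P U).-integrable [set: E] f by exact: Radon_Nikodym_integrable.
have mf : measurable_fun [set: E] f by exact: measurable_int intf.
have EFinf : EFin \o (fun w => fine (f (U w))) = f \o U.
  by apply/funext => w /=; rewrite fineK.
have intfU : P.-integrable [set: T] (f \o U).
  apply/integrableP; split.
    by apply: measurableT_comp.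
  case/integrableP : intf => _; rewrite ge0_integral_distribution//.
  by apply: measurableT_comp.
exists (fun w => fine (f (U w))); split.
- move=> B mB; exists ((fine \o f) @^-1` B); last by rewrite setTI.
  by rewrite -[X in measurable X]setTI; apply: measurableT_comp.
- by rewrite EFinf.
move=> _ [A mA <-]; rewrite setTI.
transitivity (\int[distribution P U]_(e in A) f e)%E.
  rewrite integral_pushforward//; last by apply: integrableS intfU => //; exact: mUA.
  by apply: eq_integral => w _ /=; rewrite fineK.
exact/esym/(Radon_Nikodym_integral nuP mA).
Qed.

Lemma cond_expectationP (W : T -> R) : P.-integrable [set: T] (EFin \o W) ->
  is_cond_expectation P U W (cond_expectation P U W).
Proof.
by move=> /cond_expectation_exists[h hP]; exact: (xgetPex (cst 0) (ex_intro _ h hP)).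
Qed.

Lemma cond_expectation_measurable (W h : T -> R) :
  is_cond_expectation P U W h -> measurable_fun [set: T] h.
Proof.
move=> [mh _ _] _ B mB; have [A mA <-] := mh B mB.
by apply: measurableI => //; rewrite setTI; exact: mUA.
Qed.

(** The event where one version exceeds the other belongs to the sigma-algebra of [U],
    so that the positive and the negative part of the difference both have
    integral 0. *)
Lemma cond_expectation_ae_unique (W h h' : T -> R) :
  is_cond_expectation P U W h -> is_cond_expectation P U W h' ->
  {ae P, forall w, h w = h' w}.
Proof.
move=> hP hP'.
have mh := cond_expectation_measurable hP; have mh' := cond_expectation_measurable hP'.
case: (hP) => sh ih eh; case: (hP') => sh' ih' eh'.
pose TU := g_sigma_algebra_preimageType U.
have mle : g_sigma_algebra_preimage U [set w | (h' w <= h w)%R].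
  have := @measurable_fun_ler _ TU R setT h' h.
  move=> /(_ _ _) h1.
  have m1 : measurable_fun [set: TU] (h : TU -> R).
    by move=> _ B mB; rewrite setTI; exact: sh.
  have m2 : measurable_fun [set: TU] (h' : TU -> R).
    by move=> _ B mB; rewrite setTI; exact: sh'.
  have := h1 m2 m1 measurableT [set true] I.
  by rewrite setTI.
pose A := [set w | (h' w <= h w)%R].
have mA : measurable A by apply: measurable_boolset; exact: measurable_fun_ler.
have sAC : g_sigma_algebra_preimage U (~` A).
  exact: (@measurableC _ TU _ mle).
have intd : P.-integrable [set: T] (fun w => (h w - h' w)%:E).
  by have := integrableB measurableT ih ih'; apply: eq_integrable.
have zero B : measurable B -> g_sigma_algebra_preimage U B ->
    (\int[P]_(w in B) (h w - h' w)%:E = 0)%E.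
  move=> mB sB; under eq_integral do rewrite EFinB.
  have iS (k : T -> R) : P.-integrable [set: T] (EFin \o k) -> P.-integrable B (EFin \o k).
    by apply: integrableS.
  rewrite (integralB mB (iS _ ih) (iS _ ih'))/= eh// eh'// subee//.
  rewrite -eh//; exact: integrable_fin_num (iS _ ih).
have : (\int[P]_(w in setT) `|(h w - h' w)%:E| = 0)%E.
  rewrite -(setUv A) ge0_integral_setU//; last 3 first.
  - exact: measurableC.
  - rewrite setUv; apply: measurableT_comp => //; exact: (measurable_int P).
  - by rewrite disj_set2E setICr.
  have -> : (\int[P]_(w in A) `|(h w - h' w)%:E| = 0)%E.
    rewrite -[RHS](zero A mA mle); apply: eq_integral => w /set_mem/= hw.
    by rewrite ger0_norm// subr_ge0.
  rewrite add0e.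
  transitivity (\int[P]_(w in ~` A) (- (h w - h' w)%:E))%E.
    apply: eq_integral => w /set_mem/= hw.
    rewrite ler0_norm// subr_le0.
    by move/negP : hw; rewrite -ltNge => /ltW.
  have := zero _ (measurableC mA) sAC.
  rewrite integralN.
    by move=> ->; rewrite oppe0.
  apply: fin_num_adde_defl; rewrite fin_numN; apply: integrable_neg_fin_num => //.
    exact: measurableC.
  by apply: integrableS intd => //; exact: measurableC.
move/(ae_eq_integral_abs _ measurableT) => /(_ _) h0.
have : ae_eq P setT (fun w => (h w - h' w)%:E) (cst 0%E).
  by apply: h0; exact: (measurable_int P).
apply: filterS => w /(_ I) /= [] /eqP; rewrite subr_eq0 => /eqP.
exact.
Qed.

(** Total variance.  The conditional mean may be replaced by [g (U w)], which is
    another version of it. *)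
Lemma expectation_cond_variance (W : T -> R) (g : E -> R) :
  bmeas W -> (forall w, 0 <= W w) -> bmeas g -> (forall e, 0 <= g e) ->
  (forall A, measurable A -> \int[P]_(w in U @^-1` A) (W w)%:E =
                             \int[P]_(w in U @^-1` A) (g (U w))%:E)%E ->
  ('E_P[cond_variance P U W])%E =
  (mean P (fun w => W w ^+ 2) - mean P (fun w => g (U w) ^+ 2))%:E.
Proof.
move=> bW W0 bg g0 eqA.
have bgU : bmeas (fun w => g (U w)) by exact: (bmeas_comp (phi := U) _ bg).
have gP : is_cond_expectation P U W (fun w => g (U w)).
  split.
  - move=> B mB; exists (g @^-1` B); last by rewrite setTI.
    by rewrite -[X in measurable X]setTI; case: bg => mg _; exact: mg.
  - exact: bmeas_integrable.
  - by move=> _ [A mA <-]; rewrite setTI eqA.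
have hP := cond_expectationP (bmeas_integrable P bW).
set h := cond_expectation P U W in hP.
have hg := cond_expectation_ae_unique hP gP.
have mh := cond_expectation_measurable hP.
pose D w := (W w - h w) ^+ 2; pose D' w := (W w - g (U w)) ^+ 2.
have bD' : bmeas D' by apply: bmeasX; exact: bmeasB.
have mD : measurable_fun [set: T] D.
  by apply: measurable_funX; apply: measurable_funB => //; case: bW.
have DD' : ae_eq P setT (EFin \o D) (EFin \o D').
  by apply: filterS hg => w e _; rewrite /D /D'/= e.
have intD : P.-integrable [set: T] (EFin \o D).
  apply/integrableP; split; first exact/measurable_EFinP.
  have /integrableP[_] := bmeas_integrable P bD'.
  rewrite (ae_eq_integral (fun w => `|(EFin \o D) w|%E))//.
  - by apply: measurableT_comp => //; apply/measurable_EFinP; case: bD'.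
  - by apply: measurableT_comp => //; exact/measurable_EFinP.
  - by apply: filterS DD' => w /(_ I) e _; rewrite e.
have [_ _ /(_ setT)] := cond_expectationP intD.
rewrite -/(cond_variance P U W) => e.
rewrite unlock e; last by exists setT => //; rewrite preimage_setT setTI.
rewrite (ae_eq_integral (EFin \o D'))//; last 2 first.
- exact/measurable_EFinP.
- by apply/measurable_EFinP; case: bD'.
rewrite -[LHS](meanE P bD'); congr EFin.
have eW : mean P (fun w => g (U w) * W w) = mean P (fun w => g (U w) ^+ 2).
  by apply: (weight_transfer (measurable_funP U) (phi1 := W) (phi2 := fun w => g (U w))).
have b2 : bmeas (fun w => 2 * (g (U w) * W w)).
  by apply: bmeasM; [exact: bmeas_cst|exact: bmeasM].
transitivity (mean P (fun w => (W w ^+ 2 + g (U w) ^+ 2) - 2 * (g (U w) * W w))).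
  by apply: eq_mean => w; rewrite /D'; ring.
rewrite meanB//; last by apply: bmeasD; exact: bmeasX.
rewrite meanD; [|exact: bmeasX|exact: bmeasX].
by rewrite meanZ ?eW; [ring|exact: bmeasM].
Qed.

End cond_expectation.

(** * The conditional variance of the exceedance indicators *)

Section conditional_variance.
Context {R : realType} {d dE : measure_display}.
Context {T : measurableType d} {E : measurableType dE}.
Variables (P : probability T R) (Y : {mfun T >-> R}) (U : {mfun T >-> E}).
Variable K : R.-pker E ~> R.
Hypothesis version : regular_cond_distribution P U Y K.

Let mU : measurable_fun [set: T] U := measurable_funP U.
Let mY : measurable_fun [set: T] Y := measurable_funP Y.

Definition reach (t : R) (w : T) : R := (t <= Y w)%R%:R.

Definition cond_var_at (t : R) : R :=
  mean P (fun w => (reach t w - cond_tail K (U w) t) ^+ 2).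

Let bR t : bmeas (reach t) := bmeas_reach mY t.
Let bG t : bmeas (fun w => cond_tail K (U w) t) := bmeas_cond_tailU K mU t.

Lemma cond_var_atE t : cond_var_at t =
  mean P (reach t) - mean P (fun w => cond_tail K (U w) t ^+ 2).
Proof.
have e : mean P (fun w => reach t w * cond_tail K (U w) t) =
    mean P (fun w => cond_tail K (U w) t ^+ 2).
  exact: (mean_cond_tail mU mY version t (bmeas_cond_tail K t)).
transitivity (mean P (fun w => reach t w + cond_tail K (U w) t ^+ 2 -
    2 * (reach t w * cond_tail K (U w) t))).
  by apply: eq_mean => w; rewrite /reach; case: (t <= Y w)%R => /=; ring.
rewrite meanB; [|by apply: bmeasD => //; exact: bmeasX|]; last first.
  by apply: bmeasM; [exact: bmeas_cst|exact: bmeasM].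
rewrite meanD//; last exact: bmeasX.
by rewrite meanZ ?e; [ring|exact: bmeasM].
Qed.

Lemma cond_var_at_ge0 t : 0 <= cond_var_at t.
Proof. by apply: mean_ge0 => w; exact: sqr_ge0. Qed.

Lemma mean_reach t : (mean P (reach t))%:E = P [set w | t <= Y w].
Proof. by rewrite /reach mean_bool//; exact: measurable_fun_ler. Qed.

Let cond_tail_anti u s t : s <= t -> cond_tail K u t <= cond_tail K u s.
Proof.
move=> st; rewrite -lee_fin !cond_tailE; apply: le_measure; rewrite ?inE//.
by move=> y /=; rewrite !in_itv/= !andbT => /(le_trans st).
Qed.

Let measurable_band s t : measurable_fun [set: T] (fun w => (s <= Y w) && (Y w < t)).
Proof.
by apply: measurable_and; [exact: measurable_fun_ler|exact: measurable_fun_ltr].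
Qed.

(** The threshold can be moved up at the cost of the mass that it passes, since
    conditional tails decrease. *)
Lemma cond_var_at_le s t : s <= t ->
  ((cond_var_at s)%:E <= (cond_var_at t)%:E + P [set w | (s <= Y w < t)%R])%E.
Proof.
move=> st; rewrite -(mean_bool P (measurable_band s t)) lee_fin !cond_var_atE.
have -> : mean P (reach s) = mean P (reach t) +
    mean P (fun w => ((s <= Y w) && (Y w < t))%R%:R).
  rewrite -meanD//; last by apply: bmeas_bool; exact: measurable_band.
  apply: eq_mean => w; rewrite /reach.
  have [sy|ys] := leP s (Y w); have [yt|ty] := ltP (Y w) t; rewrite ?addr0 ?add0r//.
  by have := lt_le_trans ys st; rewrite ltNge => /negP; case; exact: le_trans ty _.
rewrite lerBlDr -!addrA lerD2l [leRHS]addrC -addrA [X in _ <= _ + X]addrC lerDl.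
by rewrite addrC subr_ge0; apply: le_mean; [exact: bmeasX|exact: bmeasX|] => w;
  rewrite ler_sqr ?nnegrE; [exact: cond_tail_anti|have /andP[] := cond_tail01 K (U w) t
  |have /andP[] := cond_tail01 K (U w) s].
Qed.

Lemma bmeas_cond_var_at : bmeas cond_var_at.
Proof.
apply: (bmeas_mean2 P (F := fun x : R * T => (reach x.1 x.2 - cond_tail K (U x.2) x.1) ^+ 2)).
apply: bmeasX; apply: bmeasB.
  apply: bmeas_bool; apply: measurable_fun_ler => //.
  exact: (measurableT_comp mY measurable_snd).
apply: bmeas_le1; last by move=> x; exact: cond_tail01.
apply: (measurableT_comp (f := fun x : E * R => cond_tail K x.1 x.2)
  (g := fun x : R * T => (U x.2, x.1))); first exact: measurable_cond_tail.
by apply: measurable_fun_pair => //; exact: (measurableT_comp mU measurable_snd).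
Qed.

Section null_denominator.
Hypothesis mean_var0 : mean P (fun w => cond_var_at (Y w)) = 0.

Let bv : bmeas (fun w => cond_var_at (Y w)) := bmeas_comp mY bmeas_cond_var_at.

Let good_point (B : set R) : measurable B -> (0 < P (Y @^-1` B))%E ->
  exists2 t, B t & cond_var_at t = 0.
Proof.
move=> mB PB; apply/not_exists2P => h.
have : (\int[P]_w `|(cond_var_at (Y w))%:E| = 0)%E.
  under eq_integral do rewrite gee0_abs ?lee_fin ?cond_var_at_ge0//.
  by rewrite -meanE// mean_var0.
move/(ae_eq_integral_abs _ measurableT) => /(_ _).
have mv : measurable_fun [set: T] (fun w => (cond_var_at (Y w))%:E).
  by apply/measurable_EFinP; case: bv.
move=> /(_ mv)[N [mN N0 subN]].
have mYB : measurable (Y @^-1` B) by rewrite -[X in measurable X]setTI; exact: mY.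
have : (P (Y @^-1` B) <= P N)%E.
  apply: le_measure; rewrite ?inE// => w /= Bw; apply: subN => /= /(_ I) [e].
  by case: (h (Y w)).
by rewrite N0 leNgt PB.
Qed.

Let D (t0 t : R) : set T := [set w | t0 <= Y w < t].

Let mD t0 t : measurable (D t0 t).
Proof. by apply: measurable_boolset; exact: measurable_band. Qed.

(** The hypothesis says that the conditional variance vanishes at almost every level
    for the law of [Y].  A level [t0] outside is compared, through
    [cond_var_at_le], with a level above it where the variance vanishes and such
    that the mass in between is arbitrarily small: with [s] the infimum of the
    levels up to which the law has mass above [t0], either [s] is an atom or there
    are such levels in every interval to the right of [s].  If the law has no mass
    from [t0] on, the indicator itself is null. *)
Lemma cond_var_at0 t0 : cond_var_at t0 = 0.
Proof.
apply/eqP; rewrite eq_le cond_var_at_ge0 andbT.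
pose F := [set t | t0 <= t /\ (0 < P (D t0 t))%E].
have nullD t : ~ F t -> P (D t0 t) = 0%E.
  move=> nF; have [t0t|tt0] := leP t0 t.
    apply/eqP; rewrite eq_le measure_ge0 andbT leNgt; apply/negP => h.
    by apply: nF.
  rewrite (_ : D t0 t = set0) ?measure0//; apply/seteqP; split => // w /= /andP[h1 h2].
  by have := le_lt_trans h1 h2; rewrite ltNge (ltW tt0).
have nullU A B : measurable A -> measurable B -> P A = 0%E -> P B = 0%E ->
    P (A `|` B) = 0%E.
  move=> mA mB a b; apply/eqP; rewrite eq_le measure_ge0 andbT.
  apply: le_trans (measureU2 P mA mB) _; rewrite le_eqVlt; apply/orP; left; apply/eqP.
  by transitivity (P A + P B)%E => //; rewrite a b add0e.
have [F0|/set0P Fne] := eqVneq F set0.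
  (* no mass above [t0] at all *)
  have : P [set w | t0 <= Y w] = 0%E.
    have -> : [set w | t0 <= Y w] = \bigcup_k D t0 k%:R.
      apply/seteqP; split => w /=; last by case=> k _ /andP[].
      move=> h; exists (Num.truncn `|Y w|).+1 => //=; rewrite /D/= h/=.
      by apply: le_lt_trans (ler_norm _) _; rewrite truncnS_gt.
    apply/measure_negligible; first by apply: bigcupT_measurable.
    apply: negligible_bigcup => k; exists (D t0 k%:R); split => //.
    by apply: nullD; rewrite F0.
  rewrite -mean_reach => -[m0].
  rewrite cond_var_atE m0 sub0r oppr_le0; apply: mean_ge0 => w; exact: sqr_ge0.
have lbF : has_inf F by split => //; exists t0 => t [].
set s := inf F.
have t0s : t0 <= s by apply: lb_le_inf => // t [].
have null_below t : t < s -> P (D t0 t) = 0%E.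
  move=> ts; apply: nullD => Ft; have := ge_inf lbF.2 Ft.
  by rewrite leNgt ts.
have nullDs : P (D t0 s) = 0%E.
  have -> : D t0 s = \bigcup_k D t0 (s - k.+1%:R^-1).
    apply/seteqP; split => w /=.
      move=> /andP[h1 h2].
      have [k hk] := ltr_add_invr h2.
      by exists k => //=; rewrite /D/= h1/=; rewrite ltrBrDr.
    move=> [k _ /andP[h1 h2]]; rewrite /D/= h1/=; apply: lt_trans h2 _.
    by rewrite ltrBlDr ltrDl invr_gt0 ltr0n.
  apply/measure_negligible; first by apply: bigcupT_measurable.
  apply: negligible_bigcup => k; exists (D t0 (s - k.+1%:R^-1)); split => //.
  by apply: null_below; rewrite ltrBlDr ltrDl invr_gt0 ltr0n.
have ms : measurable [set w | Y w = s].
  by rewrite -[X in measurable X]setTI; exact: (mY measurableT (measurable_set1 s)).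
rewrite -lee_fin.
have [Ps|Ps] := eqVneq (P [set w | Y w = s]) 0%E; last first.
  (* an atom at [s] *)
  have [t -> vs] : exists2 t, [set s] t & cond_var_at t = 0.
    by apply: good_point => //; rewrite lt_neqAle eq_sym Ps measure_ge0.
  by apply: (le_trans (cond_var_at_le t0s)); rewrite vs add0e -/(D t0 s) nullDs.
(* mass accumulates to the right of [s] *)
pose e k : R := s + k.+1%:R^-1.
have se k : s < e k by rewrite /e ltrDl invr_gt0 ltr0n.
have le_e k : ((cond_var_at t0)%:E <= P (D t0 (e k)))%E.
  have PI : (0 < P (Y @^-1` `]s, e k[%classic))%E.
    have [t Ft tek] : exists2 t, F t & t < e k by apply: inf_lt => //; exact: lbF.
    rewrite lt_neqAle measure_ge0 andbT eq_sym; apply/negP => /eqP P0.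
    case: Ft => _; apply/negP; rewrite -leNgt.
    have mI : measurable (Y @^-1` `]s, e k[%classic).
      by rewrite -[X in measurable X]setTI; exact: mY.
    apply: (@le_trans _ _ (P (D t0 s `|` [set w | Y w = s] `|` Y @^-1` `]s, e k[%classic)))%E.
      apply: le_measure; rewrite ?inE//.
        by apply: measurableU => //; exact: measurableU.
      move=> w /= /andP[h1 h2]; have [ys|sy|->] := ltgtP (Y w) s.
      - by left; left; rewrite /D/= h1 ys.
      - by right; rewrite /= in_itv/= sy (lt_trans h2 tek).
      - by left; right.
    by rewrite nullU// ?nullU//; exact: measurableU.
  have [t /= ] := good_point (measurable_itv _) PI.
  rewrite in_itv/= => /andP[st te] vt.
  apply: (le_trans (cond_var_at_le (le_trans t0s (ltW st)))).
  rewrite vt add0e; apply: le_measure; rewrite ?inE//; first exact: mD.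
  by move=> w /= /andP[h1 h2]; rewrite /D/= h1 (lt_trans h2 te).
have capD : \bigcap_k D t0 (e k) `<=` D t0 s `|` [set w | Y w = s].
  move=> w h; have [ys|sy|ys] := ltgtP (Y w) s; last by right.
    by left; have /andP[h1 _] := h 0%N I; rewrite /D/= h1 ys.
  exfalso; have [k hk] := ltr_add_invr sy.
  by have /andP[_] := h k I; rewrite /e ltNge (ltW hk).
have mcap : measurable (\bigcap_k D t0 (e k)) by apply: bigcapT_measurable.
have cap0 : P (\bigcap_k D t0 (e k)) = 0%E.
  apply/eqP; rewrite eq_le measure_ge0 andbT.
  apply: (@le_trans _ _ (P (D t0 s `|` [set w | Y w = s]))).
    by apply: le_measure; rewrite ?inE//; exact: measurableU.
  by rewrite nullU.
have cvgD : P \o (fun k => D t0 (e k)) @ \oo --> P (\bigcap_k D t0 (e k)).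
  apply: nonincreasing_cvg_mu => //.
    exact: (le_lt_trans (probability_le1 P (mD _ _)) (ltry _)).
  move=> k l kl; apply/subsetPset => w /= /andP[h1 h2]; rewrite /D/= h1/=.
  apply: lt_le_trans h2 _; rewrite /e lerD2l lef_pV2 ?posrE ?ltr0n//.
  by rewrite ler_nat.
have -> : 0%:E = limn (P \o (fun k => D t0 (e k))) by rewrite (cvg_lim _ cvgD)// cap0.
apply: lime_ge.
  by apply/cvg_ex; exists (P (\bigcap_k D t0 (e k))).
by apply: nearW => k /=; exact: le_e.
Qed.

End null_denominator.
End conditional_variance.

(** * The limit coefficient *)

Section determined.
Context {R : realType} {d dE : measure_display}.
Context {T : measurableType d} {E : measurableType dE}.
Variables (P : probability T R) (Y : {mfun T >-> R}) (U : {mfun T >-> E}).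
Variable K : R.-pker E ~> R.

(** If every exceedance indicator is a.s. equal to its conditional probability, then
    the response is recovered as the supremum of the rational levels that are
    exceeded with conditional probability 1. *)
Lemma response_determined : (forall t, cond_var_at P Y U K t = 0) ->
  exists f : E -> R, measurable_fun [set: E] f /\ {ae P, forall w, Y w = f (U w)}.
Proof.
move=> v0.
have mY : measurable_fun [set: T] Y := measurable_funP Y.
have mU : measurable_fun [set: T] U := measurable_funP U.
pose r (k : nat) : R := ratr (odflt (0 : rat) (choice.unpickle k)).
pose level k (x : E) : \bar R := if cond_tail K x (r k) == 1 then (r k)%:E else -oo%E.
have mlevel k : measurable_fun [set: E] (level k).
  apply: measurable_fun_ifT => //.
  apply: measurable_fun_eqr => //.
  by case: (bmeas_cond_tail K (r k)).
exists (fun x => fine (esups (fun k => level k x) 0)); split.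
  by apply: measurableT_comp => //; exact: measurable_fun_esups.
have exceed (k : nat) : {ae P, forall w, reach Y (r k) w = cond_tail K (U w) (r k)}.
  pose D (w : T) : R := (reach Y (r k) w - cond_tail K (U w) (r k)) ^+ 2.
  have bD : bmeas D.
    apply: bmeasX; apply: bmeasB; first exact: bmeas_reach.
    exact: (bmeas_cond_tailU K mU (r k)).
  have : (\int[P]_w `|(D w)%:E| = 0)%E.
    under eq_integral do rewrite gee0_abs ?lee_fin ?sqr_ge0//.
    by rewrite -meanE// -[mean P D]/(cond_var_at P Y U K (r k)) v0.
  move/(ae_eq_integral_abs _ measurableT) => /(_ _).
  have mD : measurable_fun [set: T] (EFin \o D) by apply/measurable_EFinP; case: bD.
  move=> /(_ mD); apply: filterS => w /(_ I) /= [] /eqP.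
  by rewrite /D sqrf_eq0 subr_eq0 => /eqP.
have := ae_foralln exceed; apply: filterS => w h.
suff -> : esups (fun k => level k (U w)) 0 = (Y w)%:E by [].
have levelE k : level k (U w) = if (r k <= Y w)%R then (r k)%:E else -oo%E.
  rewrite /level -h /reach; case: (r k <= Y w)%R => /=; first by rewrite eqxx.
  by rewrite eq_sym oner_eq0.
apply/eqP; rewrite eq_le; apply/andP; split.
  apply: ge_ereal_sup => _ [k _ <-]; rewrite levelE.
  by case: ifP => [ry|_]; [rewrite lee_fin|exact: leNye].
apply/lee_subgt0Pr => e e0.
have /rat_in_itvoo[q] : Y w - e < Y w by rewrite ltrBlDr ltrDl.
rewrite inE/= => /itvP qY.
have rq : r (choice.pickle q) = ratr q by rewrite /r choice.pickleK.
apply: (@le_trans _ _ (level (choice.pickle q) (U w))).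
  by rewrite levelE rq qY -EFinB lee_fin qY.
by apply: ereal_sup_ubound; exists (choice.pickle q).
Qed.

End determined.

Section coefficient.
Context {R : realType} {d : measure_display} {T : measurableType d}.
Variable P : probability T R.

Definition mean_tail_sq {dE} {E : measurableType dE} (Y : T -> R) (U : T -> E)
    (K : R.-pker E ~> R) : R :=
  mean P (fun w' => mean P (fun w => cond_tail K (U w) (Y w') ^+ 2)).

Definition mean_exceed (Y : {mfun T >-> R}) : R := mean P (fun w' => mean P (reach Y (Y w'))).

Lemma bmeas_tail_sq {dE} {E : measurableType dE} (U : T -> E) (K : R.-pker E ~> R) :
  measurable_fun [set: T] U ->
  bmeas (fun t => mean P (fun w => cond_tail K (U w) t ^+ 2)).
Proof.
move=> mU; apply: (bmeas_mean2 P (F := fun x : R * T => cond_tail K (U x.2) x.1 ^+ 2)).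
apply: bmeasX; apply: bmeas_le1; last by move=> x; exact: cond_tail01.
apply: (measurableT_comp (f := fun x : E * R => cond_tail K x.1 x.2)
  (g := fun x : R * T => (U x.2, x.1))); first exact: measurable_cond_tail.
by apply: measurable_fun_pair => //; exact: (measurableT_comp mU measurable_snd).
Qed.

Lemma bmeas_exceed (Y : {mfun T >-> R}) : measurable_fun [set: T] Y ->
  bmeas (fun t => mean P (reach Y t)).
Proof.
move=> mY; apply: (bmeas_mean2 P (F := fun x : R * T => reach Y x.1 x.2)).
apply: bmeas_bool; apply: measurable_fun_ler => //.
exact: (measurableT_comp mY measurable_snd).
Qed.

Variables (p q : nat) (Y : {RV P >-> R}) (X : {RV P >-> p.-tuple R})
  (Z : {RV P >-> q.-tuple R}).
Variable KX : R.-pker (p.-tuple R) ~> R.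
Hypothesis KX_version : regular_cond_distribution P X Y KX.
Variable KXZ : R.-pker (p.-tuple R * q.-tuple R)%type ~> R.
Hypothesis KXZ_version : regular_cond_distribution P (fun w => (X w, Z w)) Y KXZ.

Let mY : measurable_fun [set: T] Y := measurable_funP Y.
Let mX : measurable_fun [set: T] X := measurable_funP X.

Lemma measurable_XZ : measurable_fun [set: T] (fun w => (X w, Z w)).
Proof. by apply: measurable_fun_pair; exact: measurable_funP. Qed.

(** The tower property makes [cond_tail KX] a version of the conditional mean given
    [X] of both integrands, so that total variance applies at each level. *)
Lemma TcoefE : Tcoef Y X Z KXZ =
  (mean_tail_sq Y (fun w => (X w, Z w)) KXZ - mean_tail_sq Y X KX) /
  (mean_exceed Y - mean_tail_sq Y X KX).
Proof.
have outer (f : R -> R) : bmeas f ->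
    fine (\int[distribution P Y]_t (f t)%:E)%E = mean P (fun w => f (Y w)).
  by move=> bf; rewrite -[LHS]/(mean (distribution P Y) f) mean_distribution.
have tail0 dE (E : measurableType dE) (K : R.-pker E ~> R) u t : 0 <= cond_tail K u t.
  by have /andP[] := cond_tail01 K u t.
have num t : ('E_P[cond_variance P X (fun w => cond_tail KXZ (X w, Z w) t)] =
   (mean P (fun w => cond_tail KXZ (X w, Z w) t ^+ 2) -
    mean P (fun w => cond_tail KX (X w) t ^+ 2))%:E)%E.
  apply: (expectation_cond_variance (g := fun x => cond_tail KX x t)) => //.
  - exact: (bmeas_cond_tailU KXZ measurable_XZ t).
  - exact: bmeas_cond_tail.
  - move=> A mA; rewrite -(cond_tail_integral mX mY KX_version)//.
    have mAT : measurable (A `*` [set: q.-tuple R]) by exact: measurableX.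
    have := cond_tail_integral measurable_XZ mY KXZ_version t mAT.
    have -> : (fun w => (X w, Z w)) @^-1` (A `*` [set: q.-tuple R]) = X @^-1` A.
      by apply/seteqP; split => w //= [].
    by move=> ->.
have den (t : R) : ('E_P[cond_variance P X \1_[set w | (t <= Y w)%R]] =
   (mean P (reach Y t) - mean P (fun w => cond_tail KX (X w) t ^+ 2))%:E)%E.
  have -> : \1_[set w | t <= Y w] = reach Y t :> (T -> R).
    apply/funext => w; rewrite indicE /reach; congr (nat_of_bool _)%:R.
    by apply/idP/idP => [/set_mem//|h]; exact/mem_set.
  rewrite (expectation_cond_variance (g := fun x => cond_tail KX x t)) => //.
  - congr (_ - _)%:E; apply: eq_mean => w.
    by rewrite /reach; case: (t <= Y w)%R; rewrite ?expr1n ?expr0n.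
  - exact: bmeas_reach.
  - exact: bmeas_cond_tail.
  - by move=> A mA; exact: cond_tail_integral.
rewrite /Tcoef; congr (_ / _).
  under eq_integral do rewrite num.
  rewrite outer; last first.
    by apply: bmeasB; [exact: (bmeas_tail_sq KXZ measurable_XZ)|exact: bmeas_tail_sq].
  rewrite meanB//.
    exact: (bmeas_comp mY (bmeas_tail_sq KXZ measurable_XZ)).
  exact: (bmeas_comp mY (bmeas_tail_sq KX mX)).
under eq_integral do rewrite den.
rewrite outer; last by apply: bmeasB; [exact: bmeas_exceed|exact: bmeas_tail_sq].
rewrite meanB//; first exact: (bmeas_comp mY (bmeas_exceed mY)).
exact: (bmeas_comp mY (bmeas_tail_sq KX mX)).
Qed.

Lemma Tcoef_den_gt0 :
  ~ (exists f : p.-tuple R -> R,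
       measurable_fun [set: p.-tuple R] f /\ {ae P, forall w, Y w = f (X w)}) ->
  0 < mean_exceed Y - mean_tail_sq Y X KX.
Proof.
move=> nf.
have e : mean_exceed Y - mean_tail_sq Y X KX = mean P (fun w => cond_var_at P Y X KX (Y w)).
  rewrite /mean_exceed /mean_tail_sq -meanB.
  - by apply: eq_mean => w; rewrite (cond_var_atE KX_version).
  - exact: (bmeas_comp mY (bmeas_exceed mY)).
  - exact: (bmeas_comp mY (bmeas_tail_sq KX mX)).
rewrite e lt_neqAle mean_ge0 ?andbT; last by move=> w; exact: cond_var_at_ge0.
apply/negP => /eqP/esym m0; apply: nf.
exact: (response_determined (cond_var_at0 KX_version m0)).
Qed.

End coefficient.

(** * The error of a nearest neighbour average *)

Section transport.
Context {R : realType} {d dS dS' : measure_display} {T : measurableType d}.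
Context {S : measurableType dS} {S' : measurableType dS'}.
Variables (P : probability T R) (phi : S -> S').
Hypothesis mphi : measurable_fun [set: S] phi.

Let mpre A : measurable A -> measurable (phi @^-1` A).
Proof. by move=> mA; rewrite -[X in measurable X]setTI; exact: mphi. Qed.

Lemma mutually_independent_comp (V : nat -> T -> S) :
  mutually_independent P V -> mutually_independent P (fun i w => phi (V i w)).
Proof.
move=> ind J A mA; rewrite -(ind J (fun i => phi @^-1` A i))// => i iJ.
exact/mpre/mA.
Qed.

(** The rule is stated for the whole data (Y, X, Z); it survives when only the part
    [phi] of the data is observed, since events of [phi] are events of the data. *)
Lemma uniform_tie_breaking_comp n (V : nat -> T -> S)
    (cand : T -> 'I_n -> {set 'I_n}) (N : 'I_n -> T -> 'I_n) :
  uniform_tie_breaking P (fun w => [tuple V i w | i < n]) cand N ->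
  uniform_tie_breaking P (fun w => [tuple phi (V i w) | i < n]) cand N.
Proof.
move=> [mN tie]; split => // A k mA.
pose Phi (t : n.-tuple S) : n.-tuple S' := [tuple phi (tnth t i) | i < n].
have mPhi : measurable_fun [set: n.-tuple S] Phi.
  apply/measurable_fun_tnthP => i.
  rewrite (_ : _ \o _ = fun t : n.-tuple S => phi (tnth t i)); last first.
    by apply/funext => t /=; rewrite tnth_mktuple.
  exact: (measurableT_comp mphi (measurable_tnth i)).
have mA' : measurable (Phi @^-1` A) by rewrite -[X in measurable X]setTI; exact: mPhi.
have -> : (fun w => [tuple phi (V i w) | i < n]) @^-1` A =
    (fun w => [tuple V i w | i < n]) @^-1` (Phi @^-1` A).
  apply/funext => w /=; congr A; apply: eq_from_tnth => i.
  by rewrite !tnth_mktuple.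
exact: tie.
Qed.

End transport.

Section pair_sample.
Context {R : realType} {d dE d' : measure_display}.
Context {T : measurableType d} {E : measurableType dE} {T' : measurableType d'}.
Variables (P : probability T R) (Y : {mfun T >-> R}) (U : T -> E).
Hypothesis mU : measurable_fun [set: T] U.
Variable K : R.-pker E ~> R.
Hypothesis version : regular_cond_distribution P U Y K.
Variables (P' : probability T' R) (Ys : nat -> T' -> R) (Us : nat -> T' -> E).
Hypothesis mYs : forall i, measurable_fun [set: T'] (Ys i).
Hypothesis mUs : forall i, measurable_fun [set: T'] (Us i).
Hypothesis same_law : forall i (A : set (R * E)), measurable A ->
  P' [set w | A (Ys i w, Us i w)] = P [set w | A (Y w, U w)].
Hypothesis indep : mutually_independent P' (fun i w => (Ys i w, Us i w)).

Let mY : measurable_fun [set: T] Y := measurable_funP Y.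
Let V i w := (Ys i w, Us i w).

Let mV i : measurable_fun [set: T'] (V i).
Proof. exact: measurable_fun_pair. Qed.

Let mYU : measurable_fun [set: T] (fun w => (Y w, U w)).
Proof. exact: measurable_fun_pair. Qed.

Let YU : {mfun T >-> (R * E)%type} :=
  HB.pack (fun w => (Y w, U w)) (isMeasurableFun.Build _ _ _ _ _ mYU).

Let mu : probability (R * E)%type R := distribution P YU.

Let law i A : measurable A -> P' (V i @^-1` A) = mu A.
Proof. by move=> mA; exact: same_law. Qed.

Let G e s := cond_tail K e s.

Let condG s (f : E -> R) : bmeas f ->
  mean mu (fun v => (s <= v.1)%R%:R * f v.2) = mean mu (fun v => G v.2 s * f v.2).
Proof.
move=> bf.
have bf2 : bmeas (fun v : R * E => f v.2) by exact: (bmeas_comp measurable_snd bf).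
have bG2 : bmeas (fun v : R * E => G v.2 s).
  exact: (bmeas_comp measurable_snd (bmeas_cond_tail K s)).
rewrite (mean_distribution P YU (f := fun v => (s <= v.1)%R%:R * f v.2)); last first.
  by apply: bmeasM => //; apply: bmeas_bool; exact: measurable_fun_ler.
rewrite (mean_distribution P YU (f := fun v => G v.2 s * f v.2)); last exact: bmeasM.
exact: (mean_cond_tail mU mY version s bf).
Qed.

Let bF1 : bmeas (fun x : (R * E) * (R * E) => G x.1.2 x.2.1 ^+ 2).
Proof.
apply: bmeasX; apply: bmeas_le1; last by move=> x; exact: cond_tail01.
apply: (measurableT_comp (f := fun x : E * R => cond_tail K x.1 x.2)
  (g := fun x : (R * E) * (R * E) => (x.1.2, x.2.1))); first exact: measurable_cond_tail.
apply: measurable_fun_pair; first exact: (measurableT_comp measurable_snd measurable_fst).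
exact: (measurableT_comp measurable_fst measurable_snd).
Qed.

Let mean_tail_sqE : mean_tail_sq P Y U K =
  mean mu (fun v' => mean mu (fun v => G v.2 v'.1 ^+ 2)).
Proof.
rewrite /mean_tail_sq (mean_distribution P YU).
  apply: eq_mean => w' /=; rewrite (mean_distribution P YU)//.
  apply: bmeasX; exact: (bmeas_comp measurable_snd (bmeas_cond_tail K _)).
apply: (bmeas_mean2 mu (F := fun x : (R * E) * (R * E) => G x.2.2 x.1.1 ^+ 2)).
apply: (bmeas_comp (phi := fun x : (R * E) * (R * E) => (x.2, x.1)) _ bF1).
by apply: measurable_fun_pair.
Qed.

Let bF2 : bmeas (fun x : (R * E) * (R * E) => (x.2.1 <= x.1.1)%R%:R : R).
Proof.
apply: bmeas_bool; apply: measurable_fun_ler.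
  exact: (measurableT_comp measurable_fst measurable_snd).
exact: (measurableT_comp measurable_fst measurable_fst).
Qed.

Let mean_exceedE : mean_exceed P Y =
  mean mu (fun v' => mean mu (fun v => (v'.1 <= v.1)%R%:R)).
Proof.
rewrite /mean_exceed (mean_distribution P YU).
  apply: eq_mean => w' /=; rewrite (mean_distribution P YU)//.
  by apply: bmeas_bool; exact: measurable_fun_ler.
apply: (bmeas_mean2 mu (F := fun x : (R * E) * (R * E) => (x.1.1 <= x.2.1)%R%:R)).
apply: (bmeas_comp (phi := fun x : (R * E) * (R * E) => (x.2, x.1)) _ bF2).
by apply: measurable_fun_pair.
Qed.

Variable n : nat.
Hypothesis n_gt1 : (1 < n)%N.
Let n_gt0 : (0 < n)%N := ltnW n_gt1.

Let bcoord (F : (R * E) * (R * E) -> R) (i j : nat) : bmeas F ->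
  bmeas (fun w => F (V i w, V j w)).
Proof.
by move=> bF; apply: (bmeas_comp (phi := fun w => (V i w, V j w)) _ bF);
  exact: measurable_fun_pair.
Qed.

Lemma exceed_average : exists A : T' -> R, [/\ bmeas A,
  mean P' (fun w => A w ^+ 2) <= 6 / n%:R &
  forall w, n%:R ^- 2 * \sum_(i < n) \sum_(j < n) (Ys j w <= Ys i w)%R%:R -
            mean_exceed P Y = A w].
Proof.
have n0 : n%:R != 0 :> R by rewrite pnatr_eq0 -lt0n.
pose F (x : (R * E) * (R * E)) : R := (x.2.1 <= x.1.1)%R%:R.
have F01 x : 0 <= F x <= 1 by rewrite /F ler0n lern1 leq_b1.
have := vstat_second_moment mV indep law n_gt0 bF2 F01 mean_exceedE.
exists (fun w => n%:R ^- 2 * \sum_(i < n) \sum_(j < n)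
  (F (V i w, V j w) - mean_exceed P Y)); split => //.
  apply: bmeasM; first exact: bmeas_cst.
  apply: bmeas_sum => i _; apply: bmeas_sum => j _.
  by apply: bmeasB; [exact: bcoord|exact: bmeas_cst].
move=> w; under [in RHS]eq_bigr => i _ do rewrite sumrB sumr_const card_ord.
rewrite sumrB sumr_const card_ord -mulrnA -(mulr_natl (mean_exceed P Y)) natrM mulrBr; congr (_ - _).
by field.
Qed.

Variables (m : nat) (emb : E -> m.-tuple R).
Hypothesis memb : measurable_fun [set: E] emb.
Variable N : 'I_n -> T' -> 'I_n.
Hypothesis tie : uniform_tie_breaking P' (fun w => [tuple V i w | i < n])
  (fun w => nearest (fun j : 'I_n => emb (Us j w))) N.

(** The error has a part of order n^(-1/2), made of the fluctuation around the
    conditional mean and of a two-sample average, and a bias that the distance to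
    the neighbours controls. *)
Lemma neighbour_average_error : exists A : T' -> R, [/\ bmeas A,
  mean P' (fun w => A w ^+ 2) <= (20 + 2 * (cone_count (m := m))%:R) / n%:R &
  forall w (dl : 'I_n -> R),
    (forall (i : 'I_n) s,
       `|cond_tail K (Us i w) s - cond_tail K (Us (N i w) w) s| <= dl i) ->
    `|n%:R ^- 2 * \sum_(i < n) \sum_(j < n)
        ((Ys j w <= Ys i w)%R%:R * (Ys j w <= Ys (N i w) w)%R%:R) -
      mean_tail_sq P Y U K| <= `|A w| + 2 / n%:R + n%:R^-1 * \sum_i dl i].
Proof.
have n0 : n%:R != 0 :> R by rewrite pnatr_eq0 -lt0n.
have mG : measurable_fun [set: E * R] (fun x => G x.1 x.2) by exact: measurable_cond_tail.
have G01 e s : 0 <= G e s <= 1 by exact: cond_tail01.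
pose F (x : (R * E) * (R * E)) : R := G x.1.2 x.2.1 ^+ 2.
have F01 x : 0 <= F x <= 1.
  have /andP[g0 g1] := G01 x.1.2 x.2.1.
  by rewrite /F sqr_ge0/= expr_le1.
pose th := mean_tail_sq P Y U K.
pose A1 w := n%:R ^- 2 * \sum_(i < n) \sum_(j < n) (F (V i w, V j w) - th).
pose A2 := mean_fluct V G N.
have bA1 : bmeas A1.
  apply: bmeasM; first exact: bmeas_cst.
  apply: bmeas_sum => i _; apply: bmeas_sum => j _.
  by apply: bmeasB; [exact: bcoord|exact: bmeas_cst].
have mA1 := vstat_second_moment mV indep law n_gt0 bF1 F01 mean_tail_sqE.
have bA2 : bmeas A2 by exact: (bmeas_mean_fluct mV mG G01 tie).
have mA2 := mean_fluct_second_moment mV indep law mG G01 condG n_gt1 memb tie.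
exists (fun w => A1 w + A2 w); split; first exact: bmeasD.
  apply: (@le_trans _ _ (mean P' (fun w => 2 * A1 w ^+ 2 + 2 * A2 w ^+ 2))).
    apply: le_mean.
    - by apply: bmeasX; exact: bmeasD.
    - by apply: bmeasD; apply: bmeasM; try exact: bmeas_cst; exact: bmeasX.
    move=> w; have := sqr_ge0 (A1 w - A2 w).
    by rewrite sqrrB sqrrD; lra.
  rewrite meanD; [|by apply: bmeasM; [exact: bmeas_cst|exact: bmeasX]..].
  rewrite !meanZ; [|exact: bmeasX|exact: bmeasX].
  move: mA1 mA2; rewrite -/A2.
  set x := mean P' _; set y := mean P' _ => h1 h2.
  have -> : (20 + 2 * (cone_count (m := m))%:R) / n%:R =
     2 * (6 / n%:R) + 2 * ((3 + (1 + (cone_count (m := m))%:R)) / n%:R) :> R by field.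
  by lra.
move=> w dl hdl.
have := @neighbour_average_decomp _ _ _ _ _ V G G01 n n_gt1 N w dl hdl.
rewrite -/A2.
have -> : n%:R ^- 2 * \sum_(i < n) \sum_(j < n)
     (above i j (sample V n w) * above (N i w) j (sample V n w)) =
   n%:R ^- 2 * \sum_(i < n) \sum_(j < n)
        ((Ys j w <= Ys i w)%R%:R * (Ys j w <= Ys (N i w) w)%R%:R) :> R.
  congr (_ * _); apply: eq_bigr => i _; apply: eq_bigr => j _.
  by rewrite /above !tnth_mktuple.
have -> : n%:R ^- 2 * \sum_(i < n) \sum_(j < n) tail G i j (sample V n w) ^+ 2 = A1 w + th.
  have -> : A1 w = n%:R ^- 2 * \sum_(i < n) \sum_(j < n) tail G i j (sample V n w) ^+ 2 - th.
    rewrite /A1; under eq_bigr => i _ do rewrite sumrB sumr_const card_ord.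
    rewrite sumrB sumr_const card_ord -mulrnA -(mulr_natl th) natrM mulrBr; congr (_ - _).
      congr (_ * _); apply: eq_bigr => i _; apply: eq_bigr => j _.
      by rewrite /tail !tnth_mktuple.
    by field.
  by rewrite subrK.
set W := n%:R ^- 2 * _.
move=> h.
have := ler_normD (W - (A1 w + th) - A2 w) (A1 w + A2 w).
have -> : W - (A1 w + th) - A2 w + (A1 w + A2 w) = W - th by ring.
by rewrite -/th => h'; apply: le_trans h' _; lra.
Qed.

(** The tie breaking rule prescribes the law of the indices only, hence the null set. *)
Lemma neighbours_are_nearest :
  exists2 B : set T', measurable B /\ P' B = 0%E &
    forall w, ~ B w -> forall i, N i w \in nearest (fun j : 'I_n => emb (Us j w)) i.
Proof.
exists [set w | ~~ proper_choice emb (choice_of N w) (sample V n w)].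
  split; last exact: (choice_proper mV memb tie).
  have := finmeas_set (fun b => ~~ b) (finmeas_proper mV memb tie).
  exact.
move=> w /negP; rewrite negbK => /forallP h i; have := h i; rewrite ffunE.
have -> // : (fun j => emb (tnth (sample V n w) j).2) = (fun j : 'I_n => emb (Us j w)).
by apply/funext => j; rewrite tnth_mktuple.
Qed.

End pair_sample.

(** * Ranks, ratios and rates *)

Section ranks.
Context {R : realType} {n : nat}.
Variable y : 'I_n -> R.

Lemma rank_ofE i : (rank_of y i)%:R = \sum_j (y j <= y i)%R%:R :> R.
Proof.
rewrite /rank_of -sum1_card natr_sum big_mkcond/=.
by apply: eq_bigr => j _; rewrite inE; case: (_ <= _).
Qed.

(** The sets of responses below [y i] and below [y k] are nested. *)
Lemma minn_rankE i k : (minn (rank_of y i) (rank_of y k))%:R =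
  \sum_j ((y j <= y i)%R%:R * (y j <= y k)%R%:R) :> R.
Proof.
wlog ik : i k / y i <= y k.
  move=> h; have [ik|/ltW ki] := leP (y i) (y k); first exact: h.
  by rewrite minnC h//; apply: eq_bigr => j _; rewrite mulrC.
have /minn_idPl -> : (rank_of y i <= rank_of y k)%N.
  by apply/subset_leq_card/fintype.subsetP => j; rewrite !inE => /le_trans; apply.
rewrite rank_ofE; apply: eq_bigr => j _.
have [ji|] := leP (y j) (y i); last by rewrite mul0r.
by rewrite (le_trans ji ik) mulr1.
Qed.

Lemma TstatE (N M : 'I_n -> 'I_n) :
  let W (k : 'I_n -> 'I_n) : R := n%:R ^- 2 * \sum_(i < n) \sum_(j < n)
    ((y j <= y i)%R%:R * (y j <= y (k i))%R%:R) in
  let L : R := n%:R ^- 2 * \sum_(i < n) \sum_(j < n) (y j <= y i)%R%:R in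
  (0 < n)%N -> L - W N != 0 ->
  Tstat y N M = Some ((W M - W N) / (L - W N)).
Proof.
move=> W L n0 LW.
have n20 : n%:R ^- 2 != 0 :> R by rewrite invr_eq0 expf_neq0// pnatr_eq0 -lt0n.
pose num : R := \sum_(i < n) ((minn (rank_of y i) (rank_of y (M i)))%:R -
   (minn (rank_of y i) (rank_of y (N i)))%:R).
pose den : R := \sum_(i < n) ((rank_of y i)%:R - (minn (rank_of y i) (rank_of y (N i)))%:R).
have numE : W M - W N = n%:R ^- 2 * num.
  rewrite /W /num -mulrBr; congr (_ * _); rewrite -sumrB.
  by apply: eq_bigr => i _; rewrite !minn_rankE.
have denE : L - W N = n%:R ^- 2 * den.
  rewrite /L /W /den -mulrBr; congr (_ * _); rewrite -sumrB.
  by apply: eq_bigr => i _; rewrite minn_rankE rank_ofE.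
have den0 : den != 0 by move: LW; rewrite denE mulf_eq0 negb_or => /andP[].
rewrite /Tstat -/num -/den (negbTE den0) numE denE; congr Some.
by rewrite -mulf_div mulfV// mul1r.
Qed.

End ranks.

(** Errors of at most a quarter of the denominator on its two parts leave half of
    it, which turns the quotient into a Lipschitz function of its entries. *)
Lemma ratio_error {R : realType} (a b c al be ga dl : R) :
  `|a - al| <= dl -> `|b - be| <= dl -> `|c - ga| <= dl ->
  0 < ga - be -> 4 * dl <= ga - be ->
  c - b != 0 /\
  `|(a - b) / (c - b) - (al - be) / (ga - be)| <=
    4 * dl * (ga - be + `|al - be|) / (ga - be) ^+ 2.
Proof.
set S := ga - be; set Q := al - be => ha hb hc S0 dS.
move: ha hb hc; rewrite ler_norml => /andP[a1 a2].
rewrite ler_norml => /andP[b1 b2]; rewrite ler_norml => /andP[c1 c2].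
have y0 : S / 2 <= c - b by rewrite /S in S0 dS *; lra.
have yp : 0 < c - b by lra.
split; first by rewrite gt_eqF.
have -> : (a - b) / (c - b) - Q / S =
    ((a - b - Q) * S - Q * (c - b - S)) / ((c - b) * S).
  by field; rewrite !gt_eqF.
rewrite normrM normfV (gtr0_norm (mulr_gt0 yp S0)).
have dl0 : 0 <= dl by lra.
have num_le : `|(a - b - Q) * S - Q * (c - b - S)| <= 2 * dl * (S + `|Q|).
  apply: le_trans (ler_normB _ _) _; rewrite !normrM (gtr0_norm S0) [leRHS]mulrDr.
  apply: lerD.
    by apply: (ler_wpM2r (ltW S0)); rewrite ler_norml /Q; apply/andP; split; lra.
  rewrite mulrC ler_wpM2r//.
  by rewrite ler_norml /S; apply/andP; split; lra.
apply: (@le_trans _ _ (2 * dl * (S + `|Q|) / (S / 2 * S))).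
  apply: ler_pM => //; first by rewrite invr_ge0 ltW// mulr_gt0.
  have h0 : 0 < S / 2 by lra.
  rewrite lef_pV2 ?posrE//; [|exact: mulr_gt0|exact: mulr_gt0].
  by rewrite ler_wpM2r// ltW.
by rewrite le_eqVlt; apply/orP; left; apply/eqP; field; rewrite gt_eqF.
Qed.

Section rates.
Context {R : realType}.
Variables (k : nat) (beta : R).
Hypothesis k_gt1 : (1 < k)%N.
Hypothesis beta_ge0 : 0 <= beta.

Definition rate (n : nat) : R := ln n%:R `^ (k%:R + beta + 1) / n%:R `^ (k%:R^-1).

Let e : R := k%:R + beta + 1.
Let k0 : 0 < k%:R :> R. Proof. by rewrite ltr0n (ltn_trans _ k_gt1). Qed.
Let e0 : 0 < e. Proof. by rewrite /e addrC ltr_pwDl// addr_ge0// ltW. Qed.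

Section one_size.
Variable n : nat.
Hypothesis ln_ge1 : 1 <= ln n%:R :> R.

Let n1 : 1 <= n%:R :> R.
Proof. by rewrite leNgt; apply/negP => /ltW/ln_le0/(le_trans ln_ge1); rewrite ler10. Qed.

Let npos (x : R) : 0 < n%:R `^ x.
Proof. by rewrite powR_gt0// (lt_le_trans ltr01 n1). Qed.

(** In dimension [k >= 2] the fluctuations of order n^(-1/2) are below the rate. *)
Lemma sqrt_rate : 1 <= n%:R * rate n ^+ 2.
Proof.
have n0 : 0 < n%:R :> R by exact: (lt_le_trans ltr01 n1).
have l1 : 1 <= ln n%:R `^ e.
  by have := ler_powR ln_ge1 (ltW e0); rewrite powRr0.
rewrite /rate -/e expr_div_n mulrA ler_pdivlMr ?exprn_gt0// mul1r.
apply: (@le_trans _ _ n%:R); last first.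
  by apply: ler_peMr; [exact: ltW|exact: exprn_ege1].
rewrite -powR_mulrn ?powR_ge0// -powRrM -[leRHS](powRr1 (ltW n0)).
apply: ler_powR => //.
by rewrite mulrC ler_pdivrMr// mul1r ler_nat.
Qed.

Lemma rate_ge_inv : n%:R^-1 <= rate n.
Proof.
have n0 : 0 < n%:R :> R by exact: (lt_le_trans ltr01 n1).
have l1 : 1 <= ln n%:R `^ e.
  by have := ler_powR ln_ge1 (ltW e0); rewrite powRr0.
rewrite /rate -/e ler_pdivlMr//; apply: le_trans l1.
rewrite ler_pdivrMl// mulr1 -[leRHS](powRr1 (ltW n0)).
apply: ler_powR => //.
by rewrite invf_le1// ler1n (ltn_trans _ k_gt1).
Qed.

Lemma rate_gt0 : 0 < rate n.
Proof. by apply: lt_le_trans rate_ge_inv; rewrite invr_gt0 (lt_le_trans ltr01 n1). Qed.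

(** The growth of the Lipschitz constant, the radius and the number of scales each
    contribute a power of the logarithm. *)
Lemma neighbour_bias_le_rate (m : nat) (u : 'I_n -> m.-tuple R) (nb : 'I_n -> 'I_n)
    (rho c : R) :
  (0 < m <= k)%N -> 0 < rho -> 0 <= c ->
  (forall i x, `|tnth (u i) x| < rho * ln n%:R) ->
  (forall i, nb i \in nearest u i) ->
  n%:R^-1 * \sum_i (c * (1 + 4 * (rho * ln n%:R) `^ beta) * euclid_dist (u i) (u (nb i)))
  <= c * (1 + 4 * rho `^ beta) * (4 * rho * Num.sqrt m%:R) * (1 + 2 ^+ m.+1) * rate n.
Proof.
move=> /andP[m0 mk] rho0 c0 ulr nbP.
have n0 : (0 < n)%N by rewrite -(ltr0n R) (lt_le_trans ltr01 n1).
set l := ln n%:R in ulr *.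
have l0 : 0 < l by exact: (lt_le_trans ltr01 ln_ge1).
have lb1 : 1 <= l `^ beta.
  by have := ler_powR ln_ge1 beta_ge0; rewrite powRr0.
have := nn_sum_le m0 ulr nbP n0; rewrite -/l.
set s := \sum_i _ => hs.
have -> : n%:R^-1 * \sum_i (c * (1 + 4 * (rho * l) `^ beta) * euclid_dist (u i) (u (nb i))) =
   c * (1 + 4 * (rho * l) `^ beta) * (n%:R^-1 * s) by rewrite -mulr_sumr mulrCA.
set q := n%:R `^ _ in hs.
have q0 : 0 < q by exact: npos.
have step1 : 1 + 4 * (rho * l) `^ beta <= (1 + 4 * rho `^ beta) * l `^ beta.
  by rewrite (powRM _ (ltW rho0) (ltW l0)); have := powR_ge0 rho beta; nra.
have step2 : n%:R^-1 * s <= (4 * rho * Num.sqrt m%:R) * (1 + 2 ^+ m.+1) * (l ^+ 2 * q).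
  apply: le_trans hs _.
  have -> : 2 * (2 * (rho * l) * Num.sqrt m%:R) * q * (1 + 2 ^+ m * (2 * l)) =
     (4 * rho * Num.sqrt m%:R) * ((1 + 2 ^+ m.+1 * l) * (l * q)) by rewrite exprS; ring.
  rewrite -[leRHS]mulrA; apply: ler_wpM2l.
    by rewrite !mulr_ge0 ?sqrtr_ge0 ?ltW.
  have -> : (1 + 2 ^+ m.+1) * (l ^+ 2 * q) = ((1 + 2 ^+ m.+1) * l) * (l * q) by ring.
  apply: ler_wpM2r; first by rewrite mulr_ge0 ?ltW.
  by rewrite mulrDl mul1r lerD2r.
have step3 : l `^ beta * (l ^+ 2 * q) <= rate n.
  rewrite /rate -/l -/e mulrA; apply: ler_pM.
  - by rewrite mulr_ge0 ?powR_ge0 ?exprn_ge0 ?ltW.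
  - exact: ltW.
  - rewrite -(powR_mulrn _ (ltW l0)) -powRD; last by apply/implyP => _; rewrite gt_eqF.
    apply: ler_powR => //; rewrite /e.
    have : 2 <= k%:R :> R by rewrite ler_nat.
    by move=> h; rewrite /=; lra.
  - rewrite /q powRN lef_pV2 ?posrE ?npos//; apply: ler_powR => //.
    have k0' : (0 < k)%N := ltnW k_gt1.
    by rewrite lef_pV2 ?posrE ?ltr0n// ler_nat.
apply: (@le_trans _ _ (c * ((1 + 4 * rho `^ beta) * l `^ beta) *
   ((4 * rho * Num.sqrt m%:R) * (1 + 2 ^+ m.+1) * (l ^+ 2 * q)))).
  apply: ler_pM => //.
  - by rewrite mulr_ge0// addr_ge0// mulr_ge0// powR_ge0.
  - by rewrite mulr_ge0 ?invr_ge0// sumr_ge0// => i _; exact: euclid_dist_ge0.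
  - by rewrite ler_wpM2l.
have -> : c * ((1 + 4 * rho `^ beta) * l `^ beta) *
   ((4 * rho * Num.sqrt m%:R) * (1 + 2 ^+ m.+1) * (l ^+ 2 * q)) =
   c * (1 + 4 * rho `^ beta) * (4 * rho * Num.sqrt m%:R) * (1 + 2 ^+ m.+1) *
   (l `^ beta * (l ^+ 2 * q)) by ring.
apply: ler_wpM2l => //.
have h1 : 0 <= 1 + 4 * rho `^ beta by rewrite addr_ge0// mulr_ge0// powR_ge0.
have h2 : 0 <= 4 * rho * Num.sqrt m%:R.
  by rewrite mulr_ge0 ?sqrtr_ge0// mulr_ge0//; exact: ltW.
have h3 : 0 <= 1 + 2 ^+ m.+1 :> R by rewrite addr_ge0// exprn_ge0.
by rewrite mulr_ge0// mulr_ge0// mulr_ge0.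
Qed.

End one_size.

Lemma rate_to0 (eta : R) : 0 < eta -> \forall n \near \oo, rate n <= eta.
Proof.
move=> eta0.
(* half of the power of [n] absorbs the logarithms *)
pose v : R := (2 * k%:R * e)^-1.
have v0 : 0 < v by rewrite invr_gt0 !mulr_gt0.
pose w : R := (v^-1 `^ e / eta) `^ (2 * k%:R).
near=> n.
have n1 : 1 <= n%:R :> R by near: n; exact: nbhs_infty_ger.
have nw : w <= n%:R by near: n; exact: nbhs_infty_ger.
have n0 : 0 < n%:R :> R by exact: (lt_le_trans ltr01 n1).
have npos (x : R) : 0 < n%:R `^ x by exact: powR_gt0.
have l0 : 0 <= ln n%:R :> R by exact: ln_ge0.
have lnle : ln n%:R <= v^-1 * n%:R `^ v.
  rewrite ler_pdivlMl//.
  have := ln_sublinear (npos v); rewrite ln_powR => /ltW.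
  exact.
have v'0 : 0 <= v^-1 by rewrite invr_ge0 ltW.
have le1 : ln n%:R `^ e <= v^-1 `^ e * n%:R `^ ((2 * k%:R)^-1).
  apply: (@le_trans _ _ ((v^-1 * n%:R `^ v) `^ e)).
    apply: (ge0_ler_powR (ltW e0)) => //; rewrite nnegrE//.
    exact: (mulr_ge0 v'0 (ltW (npos v))).
  rewrite (powRM _ v'0 (ltW (npos v))) -powRrM.
  have -> : v * e = (2 * k%:R)^-1 by rewrite /v; field; rewrite !gt_eqF.
  exact: lexx.
rewrite /rate -/e ler_pdivrMr//; apply: le_trans le1 _.
have -> : n%:R `^ (k%:R^-1) = n%:R `^ ((2 * k%:R)^-1) * n%:R `^ ((2 * k%:R)^-1) :> R.
  have -> : k%:R^-1 = (2 * k%:R)^-1 + (2 * k%:R)^-1 :> R by field; rewrite gt_eqF.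
  by apply: powRD; apply/implyP => _; rewrite gt_eqF.
rewrite mulrA; apply: (ler_wpM2r (ltW (npos _))); rewrite mulrC -ler_pdivrMr//.
have h : (w `^ ((2 * k%:R)^-1)) <= n%:R `^ ((2 * k%:R)^-1).
  have x0 : 0 <= (2 * k%:R)^-1 :> R by rewrite invr_ge0 mulr_ge0// ltW.
  by apply: (ge0_ler_powR x0) => //; rewrite nnegrE ?powR_ge0//; exact: ltW.
apply: le_trans h; rewrite /w -powRrM mulfV.
  by rewrite powRr1// divr_ge0 ?powR_ge0//; exact: ltW.
by rewrite mulf_neq0// gt_eqF.
Unshelve. all: by end_near. Qed.

End rates.

(** * Events and concatenated vectors *)

Section events.
Context {R : realType} {d : measure_display} {T : measurableType d}.
Variable P : probability T R.

Lemma measurable_Tstat (n : nat) (y : nat -> T -> R) (N M : 'I_n -> T -> 'I_n)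
    (Q : option R -> Prop) :
  (forall i, measurable_fun [set: T] (y i)) ->
  (forall i, finmeas (N i)) -> (forall i, finmeas (M i)) ->
  measurable [set w | Q (Tstat (fun i : 'I_n => y i w) (fun i => N i w) (fun i => M i w))].
Proof.
move=> my mN mM.
(* the statistic depends only on the comparisons of the responses *)
pose B w : {ffun 'I_n * 'I_n -> bool} := [ffun ij : 'I_n * 'I_n => y ij.2 w <= y ij.1 w].
have mB : finmeas B.
  by apply: finmeas_ffun => ij; apply: finmeas_bool; exact: measurable_fun_ler.
pose stat (r : 'I_n -> nat) (k l : 'I_n -> 'I_n) : option R :=
  let num := \sum_(i < n) ((minn (r i) (r (l i)))%:R - (minn (r i) (r (k i)))%:R) in
  let den := \sum_(i < n) ((r i)%:R - (minn (r i) (r (k i)))%:R) in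
  if den == 0 then None else Some (num / den).
pose Q' (x : {ffun 'I_n * 'I_n -> bool} * ({ffun 'I_n -> 'I_n} * {ffun 'I_n -> 'I_n})) :=
  Q (stat (fun i => #|[set j | x.1 (i, j)]%SET|) x.2.1 x.2.2).
have -> : [set w | Q (Tstat (fun i : 'I_n => y i w) (fun i => N i w) (fun i => M i w))] =
    [set w | Q' (B w, ([ffun i => N i w], [ffun i => M i w]))].
  apply/funext => w /=; congr Q.
  have -> : (fun i => #|[set j | B w (i, j)]%SET|) = rank_of (fun i : 'I_n => y i w).
    by apply/funext => i; congr #|pred_of_set _|; apply/setP => j; rewrite !inE ffunE.
  have -> : ([ffun i => N i w] : 'I_n -> 'I_n) = fun i => N i w.
    by apply/funext => i; rewrite ffunE.
  have -> // : ([ffun i => M i w] : 'I_n -> 'I_n) = fun i => M i w.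
  by apply/funext => i; rewrite ffunE.
exact: (finmeas_set Q' (finmeas_pair mB (finmeas_pair (finmeas_ffun mN) (finmeas_ffun mM)))).
Qed.

Lemma prob_setU_le (A B : set T) (a b : R) : measurable A -> measurable B ->
  (P A <= a%:E)%E -> (P B <= b%:E)%E -> (P (A `|` B) <= (a + b)%:E)%E.
Proof.
move=> mA mB hA hB; apply: (le_trans (measureU2 P mA mB)).
by rewrite EFinD; exact: leeD.
Qed.

Lemma max_norm_tail (m n : nat) (W : nat -> T -> m.-tuple R) (r b : R) :
  (forall i, measurable_fun [set: T] (W i)) ->
  (forall i, P [set w | (r <= euclid_norm (W i w))%R] <= b%:E)%E ->
  exists2 B : set T, measurable B /\ (P B <= (n%:R * b)%:E)%E &
    forall w, ~ B w -> forall i : 'I_n, euclid_norm (W i w) < r.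
Proof.
move=> mW hb.
pose A (i : nat) := [set w | r <= euclid_norm (W i w)].
have mA i : measurable (A i).
  apply: measurable_boolset; apply: measurable_fun_ler => //.
  exact: measurable_euclid_norm.
exists (\big[setU/set0]_(i < n) A i).
  split; first exact: bigsetU_measurable.
  elim: n => [|n IH]; first by rewrite big_ord0 measure0 mul0r.
  rewrite big_ord_recr/= -natr1 mulrDl mul1r.
  apply: prob_setU_le => //; first exact: bigsetU_measurable.
  exact: hb.
move=> w; rewrite -bigcup_mkord => h i; rewrite ltNge; apply/negP => ri.
by apply: h; exists i => //=.
Qed.

End events.

Section concatenation.
Context {R : realType} {p q : nat}.
Implicit Types (x : p.-tuple R) (z : q.-tuple R).

Lemma cat_tuple_coord_lt x z (r : R) : euclid_norm x < r -> euclid_norm z < r ->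
  forall c, `|tnth (cat_tuple x z) c| < r.
Proof.
move=> hx hz c; case: (split_ordP c) => i ->.
  by rewrite tnth_lshift (le_lt_trans (normr_coord_le _ _) hx).
by rewrite tnth_rshift (le_lt_trans (normr_coord_le _ _) hz).
Qed.

Lemma euclid_dist_cat x x' z z' : euclid_dist x x' + euclid_dist z z' <=
  2 * euclid_dist (cat_tuple x z) (cat_tuple x' z').
Proof.
have h : euclid_dist (cat_tuple x z) (cat_tuple x' z') ^+ 2 =
    euclid_dist x x' ^+ 2 + euclid_dist z z' ^+ 2.
  rewrite !sqr_euclid_dist big_split_ord/=; congr (_ + _).
    by apply: eq_bigr => i _; rewrite !tnth_lshift.
  by apply: eq_bigr => i _; rewrite !tnth_rshift.
have le_cat y w : 0 <= w -> y ^+ 2 <= w ^+ 2 -> y <= w :> R.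
  move=> w0 yw; have [y0|/ltW y0] := leP 0 y; last exact: le_trans w0.
  by rewrite -ler_sqr ?nnegrE.
have hx : euclid_dist x x' <= euclid_dist (cat_tuple x z) (cat_tuple x' z').
  by apply: le_cat; rewrite ?euclid_dist_ge0// h lerDl sqr_ge0.
have hz : euclid_dist z z' <= euclid_dist (cat_tuple x z) (cat_tuple x' z').
  by apply: le_cat; rewrite ?euclid_dist_ge0// h lerDr sqr_ge0.
lra.
Qed.

Lemma measurable_cat_tuple :
  measurable_fun [set: p.-tuple R * q.-tuple R] (fun e => cat_tuple e.1 e.2).
Proof.
apply/measurable_fun_tnthP => c; case: (split_ordP c) => i ->.
  rewrite (_ : _ \o _ = (@tnth _ _ ^~ i) \o fst); last first.
    by apply/funext => e /=; rewrite tnth_lshift.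
  exact: (measurableT_comp (measurable_tnth i) measurable_fst).
rewrite (_ : _ \o _ = (@tnth _ _ ^~ i) \o snd); last first.
  by apply/funext => e /=; rewrite tnth_rshift.
exact: (measurableT_comp (measurable_tnth i) measurable_snd).
Qed.

End concatenation.

Unset Implicit Arguments.

(** * The rate of convergence *)

Theorem theorem4p1 (R : realType) (p q : nat) (hp : (1 <= p)%N) (hq : (1 <= q)%N)
  (d : measure_display) (Omega : measurableType d) (P : probability Omega R)
  (Y : {RV P >-> R}) (X : {RV P >-> p.-tuple R}) (Z : {RV P >-> q.-tuple R})
  (Y_not_function_of_X : ~ exists f : p.-tuple R -> R,
     measurable_fun [set: p.-tuple R] f /\ {ae P, forall w, Y w = f (X w)})
  (* the fixed versions of the regular conditional distributions of Y *)
  (KX : R.-pker (p.-tuple R) ~> R)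
  (KX_version : regular_cond_distribution P X Y KX)
  (KXZ : R.-pker (p.-tuple R * q.-tuple R)%type ~> R)
  (KXZ_version : regular_cond_distribution P (fun w => (X w, Z w)) Y KXZ)
  (* (A1) *)
  (beta C : R) (beta_ge0 : 0 <= beta) (C_ge0 : 0 <= C)
  (A1_XZ : forall (t : R) (x x' : p.-tuple R) (z z' : q.-tuple R),
     `|cond_tail KXZ (x, z) t -
       cond_tail KXZ (x', z') t| <=
     C * (1 + euclid_norm x `^ beta + euclid_norm x' `^ beta
            + euclid_norm z `^ beta + euclid_norm z' `^ beta) *
     (euclid_dist x x' + euclid_dist z z'))
  (A1_X : forall (t : R) (x x' : p.-tuple R),
     `|cond_tail KX x t - cond_tail KX x' t| <=
     C * (1 + euclid_norm x `^ beta + euclid_norm x' `^ beta) * euclid_dist x x')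
  (* (A2) *)
  (C1 C2 : R) (C1_gt0 : 0 < C1) (C2_gt0 : 0 < C2)
  (A2_X : forall t : R, 0 < t ->
     (P [set w | (t <= euclid_norm (X w))%R] <= (C1 * expR (- C2 * t))%:E)%E)
  (A2_Z : forall t : R, 0 < t ->
     (P [set w | (t <= euclid_norm (Z w))%R] <= (C1 * expR (- C2 * t))%:E)%E)
  (* the i.i.d. copies, indexed from 0 *)
  (d' : measure_display) (Omega' : measurableType d') (P' : probability Omega' R)
  (Ys : nat -> {RV P' >-> R}) (Xs : nat -> {RV P' >-> p.-tuple R})
  (Zs : nat -> {RV P' >-> q.-tuple R})
  (same_law : forall (i : nat) (A : set (R * p.-tuple R * q.-tuple R)),
     measurable A ->
     P' [set w | A (Ys i w, Xs i w, Zs i w)] = P [set w | A (Y w, X w, Z w)])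
  (indep : mutually_independent P' (fun i w => (Ys i w, Xs i w, Zs i w)))
  (* the nearest neighbour indices for each sample size n *)
  (N M : forall n : nat, 'I_n -> Omega' -> 'I_n)
  (N_nearest : forall n : nat, (2 <= n)%N ->
     uniform_tie_breaking P'
       (fun w => [tuple (Ys i w, Xs i w, Zs i w) | i < n])
       (fun w => nearest (fun j : 'I_n => Xs j w)) (N n))
  (M_nearest : forall n : nat, (2 <= n)%N ->
     uniform_tie_breaking P'
       (fun w => [tuple (Ys i w, Xs i w, Zs i w) | i < n])
       (fun w => nearest (fun j : 'I_n => cat_tuple (Xs j w) (Zs j w))) (M n)) :
  bigO_P P'
    (fun n w => omap (fun v => v - Tcoef Y X Z KXZ)
       (Tstat (fun i : 'I_n => Ys i w) (fun i => N n i w) (fun i => M n i w)))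
    (fun n => ln n%:R `^ ((p + q)%:R + beta + 1) / n%:R `^ ((p + q)%:R^-1)).
Proof.
move=> eps eps0.
pose k := (p + q)%N.
have k_gt1 : (1 < k)%N by rewrite /k; lia.
have mX : measurable_fun [set: Omega] X by exact: measurable_funP.
have mZ : measurable_fun [set: Omega] Z by exact: measurable_funP.
have mXs i : measurable_fun [set: Omega'] (Xs i) by exact: measurable_funP.
have mYs i : measurable_fun [set: Omega'] (Ys i) by exact: measurable_funP.
have mZs i : measurable_fun [set: Omega'] (Zs i) by exact: measurable_funP.
pose data i w := (Ys i w, Xs i w, Zs i w).
pose dX (x : R * p.-tuple R * q.-tuple R) := (x.1.1, x.1.2).
pose dXZ (x : R * p.-tuple R * q.-tuple R) := (x.1.1, (x.1.2, x.2)).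
have m1 : measurable_fun [set: R * p.-tuple R * q.-tuple R] (fun x => x.1.1).
  exact: (measurableT_comp measurable_fst measurable_fst).
have m2 : measurable_fun [set: R * p.-tuple R * q.-tuple R] (fun x => x.1.2).
  exact: (measurableT_comp measurable_snd measurable_fst).
have mdX : measurable_fun [set: R * p.-tuple R * q.-tuple R] dX.
  exact: measurable_fun_pair.
have mdXZ : measurable_fun [set: R * p.-tuple R * q.-tuple R] dXZ.
  by apply: measurable_fun_pair => //; exact: measurable_fun_pair.
pose XZ w := (X w, Z w).
pose XZs i w := (Xs i w, Zs i w).
have mXZs i : measurable_fun [set: Omega'] (XZs i) by exact: measurable_fun_pair.
have mXZ : measurable_fun [set: Omega] XZ by exact: measurable_fun_pair.
have lawX i (A : set (R * p.-tuple R)) : measurable A ->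
    P' [set w | A (Ys i w, Xs i w)] = P [set w | A (Y w, X w)].
  move=> mA; apply: (same_law i (dX @^-1` A)).
  by rewrite -[X in measurable X]setTI; exact: mdX.
have lawXZ i (A : set (R * (p.-tuple R * q.-tuple R))) : measurable A ->
    P' [set w | A (Ys i w, XZs i w)] = P [set w | A (Y w, XZ w)].
  move=> mA; apply: (same_law i (dXZ @^-1` A)).
  by rewrite -[X in measurable X]setTI; exact: mdXZ.
have indX := mutually_independent_comp mdX indep.
have indXZ := mutually_independent_comp mdXZ indep.
(* the limits of the three averages *)
set al := mean_tail_sq P Y XZ KXZ; set be := mean_tail_sq P Y X KX.
set ga := mean_exceed P Y.
have S0 : 0 < ga - be := Tcoef_den_gt0 KX_version Y_not_function_of_X.
have TE : Tcoef Y X Z KXZ = (al - be) / (ga - be) := TcoefE KX_version KXZ_version.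
(* outside of the ball of radius [rho * ln n] a vector has probability at most
   [C1 / n ^ 2], which leaves [C1 / n] for the whole sample *)
pose rho : R := 2 / C2.
have rho0 : 0 < rho by rewrite divr_gt0.
pose bias (m : nat) (c : R) : R :=
  c * (1 + 4 * rho `^ beta) * (4 * rho * Num.sqrt m%:R) * (1 + 2 ^+ m.+1).
have bias_ge0 m c : 0 <= c -> 0 <= bias m c.
  move=> c0.
  have h1 : 0 <= 1 + 4 * rho `^ beta by rewrite addr_ge0// mulr_ge0// powR_ge0.
  have h2 : 0 <= 4 * rho * Num.sqrt m%:R.
    by rewrite mulr_ge0 ?sqrtr_ge0// mulr_ge0//; exact: ltW.
  have h3 : 0 <= 1 + 2 ^+ m.+1 :> R by rewrite addr_ge0// exprn_ge0.
  by rewrite /bias mulr_ge0// mulr_ge0// mulr_ge0.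
(* any constant that dominates those of the three mean square errors *)
pose cst : R := 20 + 2 * (cone_count (m := p))%:R + (20 + 2 * (cone_count (m := k))%:R) + 6.
have cp : 0 <= (cone_count (m := p))%:R :> R by [].
have ck : 0 <= (cone_count (m := k))%:R :> R by [].
have cst0 : 0 < cst by rewrite /cst; lra.
have [cstX cstXZ cstY] : [/\ (0 : R) <= 20 + 2 * (cone_count (m := p))%:R <= cst,
    (0 : R) <= 20 + 2 * (cone_count (m := k))%:R <= cst & (0 : R) <= 6 <= cst].
  by rewrite /cst; split; apply/andP; split; lra.
(* the level of the fluctuations that is exceeded with probability at most [eps / 2] *)
pose lam : R := 1 + 6 * cst / eps.
have lam1 : 1 <= lam by rewrite /lam lerDl divr_ge0 ?mulr_ge0 ?ltW.
have cst_lam : cst / lam ^+ 2 <= eps / 6.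
  have l0 : 0 < lam by exact: lt_le_trans lam1.
  rewrite ler_pdivrMr ?exprn_gt0//.
  apply: (@le_trans _ _ (eps / 6 * lam)).
    rewrite /lam mulrDr mulr1.
    have -> : eps / 6 * (6 * cst / eps) = cst by field; rewrite gt_eqF.
    by rewrite lerDr divr_ge0 ?ltW.
  by apply: ler_wpM2l; [rewrite divr_ge0 ?ltW|rewrite expr2 ler_peMr// ltW].
pose kap : R := lam + 2 + bias p C + bias k (2 * C).
have C20 : 0 <= 2 * C by rewrite mulr_ge0.
have bias1 := bias_ge0 p C C_ge0; have bias2 := bias_ge0 k (2 * C) C20.
have kap0 : 0 < kap by rewrite /kap; lra.
pose a n := rate k beta n : R.
exists (4 * kap * (ga - be + `|al - be|) / (ga - be) ^+ 2).
near=> n.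
have n3 : 3 <= n%:R :> R by near: n; exact: nbhs_infty_ger.
have n1 : (1 < n)%N by rewrite -(ltr_nat R); lra.
have n0 : 0 < n%:R :> R by lra.
have ln1 : 1 <= ln n%:R :> R.
  have e1 : expR 1 <= n%:R :> R by near: n; exact: nbhs_infty_ger.
  by rewrite -[leLHS]expRK ler_ln ?posrE ?expR_gt0.
have nC1 : 4 * C1 / eps <= n%:R by near: n; exact: nbhs_infty_ger.
have small : a n <= (ga - be) / (4 * kap).
  near: n; apply: rate_to0 => //; by rewrite divr_gt0// mulr_gt0.
have a0 : 0 < a n := rate_gt0 k_gt1 beta_ge0 ln1.
have tieX := uniform_tie_breaking_comp mdX (V := data) (N_nearest n n1).
have tieXZ := uniform_tie_breaking_comp mdXZ (V := data) (M_nearest n n1).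
pose embXZ (e : p.-tuple R * q.-tuple R) := cat_tuple e.1 e.2.
have membXZ : measurable_fun [set: p.-tuple R * q.-tuple R] embXZ.
  exact: measurable_cat_tuple.
have membX : measurable_fun [set: p.-tuple R] (@id (p.-tuple R)) by exact: measurable_id.
have [Ex [bEx mEx decX]] :=
  neighbour_average_error mX KX_version mYs mXs lawX indX n1 membX tieX.
have [Exz [bExz mExz decXZ]] :=
  neighbour_average_error mXZ KXZ_version mYs mXZs lawXZ indXZ n1 membXZ tieXZ.
have [Ey [bEy mEy decY]] := exceed_average mX mYs mXs lawX indX n1.
have [BN [mBN BN0] nearN] := neighbours_are_nearest mYs mXs membX tieX.
have [BM [mBM BM0] nearM] := neighbours_are_nearest mYs mXZs membXZ tieXZ.
pose r : R := rho * ln n%:R.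
have r0 : 0 < r by rewrite mulr_gt0//; lra.
pose tl : R := C1 * expR (- C2 * r).
have tlE : n%:R * tl = C1 / n%:R.
  have -> : tl = C1 * n%:R ^- 2.
    rewrite /tl; congr (_ * _).
    have -> : - C2 * r = - (ln n%:R *+ 2).
      by rewrite /r /rho -mulr_natl; field; rewrite gt_eqF.
    by rewrite expRN -lnXn// lnK ?posrE ?exprn_gt0.
  by field; rewrite gt_eqF.
have tailX i : (P' [set w | (r <= euclid_norm (Xs i w))%R] <= tl%:E)%E.
  have mA : measurable [set v : R * p.-tuple R | r <= euclid_norm v.2].
    apply: measurable_boolset; apply: measurable_fun_ler => //.
    by apply: measurable_euclid_norm; exact: measurable_snd.
  by rewrite (lawX i _ mA); exact: A2_X.
have tailZ i : (P' [set w | (r <= euclid_norm (Zs i w))%R] <= tl%:E)%E.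
  have mA : measurable [set v : R * (p.-tuple R * q.-tuple R) | r <= euclid_norm v.2.2].
    apply: measurable_boolset; apply: measurable_fun_ler => //.
    apply: measurable_euclid_norm.
    exact: (measurableT_comp measurable_snd measurable_snd).
  by rewrite (lawXZ i _ mA); exact: A2_Z.
have [BX [mBX PBX] normX] := max_norm_tail n mXs tailX.
have [BZ [mBZ PBZ] normZ] := max_norm_tail n mZs tailZ.
have lama0 : 0 < lam * a n by rewrite mulr_gt0//; lra.
have fluct_prob (E : Omega' -> R) (c : R) : bmeas E -> 0 <= c <= cst ->
    mean P' (fun w => E w ^+ 2) <= c / n%:R ->
    (P' [set w | (lam * a n <= `|E w|)%R] <= (eps / 6)%:E)%E.
  move=> bE /andP[c0 cc] mE.
  apply: (le_trans (second_moment_tail bE lama0 mE)); rewrite lee_fin.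
  apply: le_trans cst_lam.
  have l0 : 0 < lam by exact: lt_le_trans lam1.
  have h := sqrt_rate k_gt1 beta_ge0 ln1.
  have -> : c / n%:R / (lam * a n) ^+ 2 = c / lam ^+ 2 * (n%:R * a n ^+ 2)^-1.
    by field; rewrite !gt_eqF.
  have l2 : 0 <= (lam ^+ 2)^-1 by rewrite invr_ge0 exprn_ge0// ltW.
  have i0 : 0 <= (n%:R * a n ^+ 2)^-1 by rewrite invr_ge0 mulr_ge0// exprn_ge0// ltW.
  rewrite -[leRHS]mulr1; apply: ler_pM => //; first exact: mulr_ge0.
    by rewrite ler_wpM2r.
  by rewrite invf_le1//; apply: lt_le_trans h.
have mEv (E : Omega' -> R) : bmeas E -> measurable [set w | (lam * a n <= `|E w|)%R].
  move=> [mE _]; apply: measurable_boolset; apply: measurable_fun_ler => //.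
  exact: measurableT_comp.
pose Fx := [set w | (lam * a n <= `|Ex w|)%R].
pose Fxz := [set w | (lam * a n <= `|Exz w|)%R].
pose Fy := [set w | (lam * a n <= `|Ey w|)%R].
have PFx : (P' Fx <= (eps / 6)%:E)%E.
  exact: fluct_prob bEx cstX mEx.
have PFxz : (P' Fxz <= (eps / 6)%:E)%E.
  exact: fluct_prob bExz cstXZ mExz.
have PFy : (P' Fy <= (eps / 6)%:E)%E.
  exact: fluct_prob bEy cstY mEy.
pose Bad := Fx `|` (Fxz `|` (Fy `|` (BX `|` (BZ `|` (BN `|` BM))))).
have mBad : measurable Bad.
  by do ?[apply: measurableU]; rewrite ?mBX ?mBZ ?mBN ?mBM//; exact: mEv.
have PBad : (P' Bad <= eps%:E)%E.
  have PB0 (B : set Omega') : P' B = 0%E -> (P' B <= 0%:E)%E by move=> ->.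
  apply: (@le_trans _ _ (eps / 6 + (eps / 6 + (eps / 6 +
     (n%:R * tl + (n%:R * tl + (0 + 0))))))%:E).
    do 6 (apply: prob_setU_le; rewrite ?PB0//;
      try by [exact: mEv | do ?[apply: measurableU]; rewrite ?mBX ?mBZ ?mBN ?mBM//; exact: mEv]).
  rewrite lee_fin tlE.
  have : C1 / n%:R <= eps / 4.
    by rewrite ler_pdivrMr// -ler_pdivrMl ?divr_gt0// invf_div mulrC mulrA [C1 * _]mulrC.
  lra.
apply: le_trans PBad; apply: le_measure; rewrite ?inE//.
  apply: (measurable_Tstat (y := fun i => Ys i) (N := N n) (M := M n)
    (fun o => ~~ oapp (fun v => `|v| <= 4 * kap * (ga - be + `|al - be|) / (ga - be) ^+ 2 *
      (ln n%:R `^ ((p + q)%:R + beta + 1) / n%:R `^ ((p + q)%:R^-1))) false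
      (omap (fun v => v - Tcoef Y X Z KXZ) o))) => //.
  - by move=> i l; have [h _] := N_nearest n n1; exact: h.
  - by move=> i l; have [h _] := M_nearest n n1; exact: h.
move=> w /= hw; apply: contrapT => notBad; move/negP: hw; apply.
move: notBad; rewrite /Bad => /not_orP[nFx /not_orP[nFxz /not_orP[nFy /not_orP[nBX
  /not_orP[nBZ /not_orP[nBN nBM]]]]]].
have ltF (E : Omega' -> R) : ~ [set w | (lam * a n <= `|E w|)%R] w -> `|E w| <= lam * a n.
  by move=> /= /negP; rewrite -ltNge => /ltW.
have hEx := ltF _ nFx; have hExz := ltF _ nFxz; have hEy := ltF _ nFy.
have nN := nearN w nBN; have nM := nearM w nBM.
have hX := normX w nBX; have hZ := normZ w nBZ.
have ainv := rate_ge_inv k_gt1 beta_ge0 ln1.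
(* the Lipschitz constants on the ball of radius [r] *)
have pow_le (m : nat) (x : m.-tuple R) : euclid_norm x < r -> euclid_norm x `^ beta <= r `^ beta.
  by move=> xr; apply: ge0_ler_powR; rewrite ?nnegrE ?sqrtr_ge0// ltW.
have rb0 : 0 <= r `^ beta by exact: powR_ge0.
have combine (x z : R) : x <= lam * a n -> z <= (bias p C + bias k (2 * C)) * a n ->
    x + 2 / n%:R + z <= kap * a n.
  move=> hx hz.
  have -> : kap * a n = lam * a n + 2 * a n + (bias p C + bias k (2 * C)) * a n.
    by rewrite /kap; ring.
  by apply: lerD => //; apply: lerD => //; rewrite ler_pM2l.
have errX : `|n%:R ^- 2 * \sum_(i < n) \sum_(j < n)
    ((Ys j w <= Ys i w)%R%:R * (Ys j w <= Ys (N n i w) w)%R%:R) - be| <= kap * a n.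
  pose dl (i : 'I_n) := C * (1 + 4 * r `^ beta) * euclid_dist (Xs i w) (Xs (N n i w) w).
  have hdl (i : 'I_n) s :
      `|cond_tail KX (Xs i w) s - cond_tail KX (Xs (N n i w) w) s| <= dl i.
    apply: le_trans (A1_X _ _ _) _; rewrite /dl ler_wpM2r ?euclid_dist_ge0//.
    rewrite ler_wpM2l//.
    have := lerD (pow_le _ _ (hX i)) (pow_le _ _ (hX (N n i w))); move: rb0.
    by clear; lra.
  apply: (le_trans (decX w (fun i => dl i) hdl)).
  have p0k : (0 < p <= k)%N by rewrite hp leq_addr.
  have ulr (i : 'I_n) c : `|tnth (Xs i w) c| < rho * ln n%:R.
    exact: le_lt_trans (normr_coord_le _ _) (hX i).
  apply: combine => //.
  have h : n%:R^-1 * \sum_i dl i <= bias p C * a n.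
    exact: (neighbour_bias_le_rate k_gt1 beta_ge0 ln1 p0k rho0 C_ge0 ulr nN).
  by apply: (le_trans h); apply: (ler_wpM2r (ltW a0)); rewrite lerDl.
have errXZ : `|n%:R ^- 2 * \sum_(i < n) \sum_(j < n)
    ((Ys j w <= Ys i w)%R%:R * (Ys j w <= Ys (M n i w) w)%R%:R) - al| <= kap * a n.
  pose u (i : 'I_n) := embXZ (XZs i w).
  pose dl (i : 'I_n) := 2 * C * (1 + 4 * r `^ beta) * euclid_dist (u i) (u (M n i w)).
  have hdl (i : 'I_n) s :
      `|cond_tail KXZ (XZs i w) s - cond_tail KXZ (XZs (M n i w) w) s| <= dl i.
    apply: le_trans (A1_XZ _ _ _ _ _) _.
    have -> : dl i = C * (1 + 4 * r `^ beta) * (2 * euclid_dist (u i) (u (M n i w))).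
      by rewrite /dl; ring.
    apply: ler_pM.
    - by rewrite mulr_ge0// !addr_ge0// powR_ge0.
    - by rewrite addr_ge0// euclid_dist_ge0.
    - rewrite ler_wpM2l//.
      have := lerD (lerD (pow_le _ _ (hX i)) (pow_le _ _ (hX (M n i w))))
        (lerD (pow_le _ _ (hZ i)) (pow_le _ _ (hZ (M n i w)))).
      by clear; lra.
    - exact: euclid_dist_cat.
  apply: (le_trans (decXZ w (fun i => dl i) hdl)).
  have k0k : (0 < k <= k)%N by rewrite leqnn andbT ltnW.
  have ulr (i : 'I_n) c : `|tnth (u i) c| < rho * ln n%:R.
    exact: (cat_tuple_coord_lt (hX i) (hZ i) c).
  apply: combine => //.
  have h : n%:R^-1 * \sum_i dl i <= bias k (2 * C) * a n.
    exact: (neighbour_bias_le_rate k_gt1 beta_ge0 ln1 k0k rho0 C20 ulr nM).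
  by apply: (le_trans h); apply: (ler_wpM2r (ltW a0)); rewrite lerDr.
have errY : `|n%:R ^- 2 * \sum_(i < n) \sum_(j < n) (Ys j w <= Ys i w)%R%:R - ga| <= kap * a n.
  rewrite decY; apply: le_trans hEy _; apply: (ler_wpM2r (ltW a0)).
  have -> : kap = lam + (2 + bias p C + bias k (2 * C)) by rewrite /kap; ring.
  by rewrite lerDl addr_ge0// addr_ge0.
have fourd : 4 * (kap * a n) <= ga - be.
  by rewrite mulrA mulrC -ler_pdivlMr// mulr_gt0.
have [den0 err] := ratio_error errXZ errX errY S0 fourd.
rewrite (TstatE (y := fun i : 'I_n => Ys i w) (fun i => M n i w) (ltnW n1) den0)/= TE.
apply: le_trans err _.
rewrite (_ : ln n%:R `^ _ / n%:R `^ _ = a n)//.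
by rewrite le_eqVlt; apply/orP; left; apply/eqP; ring.
Unshelve. all: by end_near.
Qed.
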